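(* Fix $p\in(1,\infty)$ and let $\mathfrak X=(X,\rho,\mu)$ be a metric measure space with $\mu(X\setminus\operatorname{supp}\mu)=0$. Then one of the following holds: (1) the topological boundary of $\Omega^p_{\rm HL}(\mathfrak X)$ in $[0,1]^2$ is empty, i.e. $\Omega^p_{\rm HL}(\mathfrak X)=\emptyset$ or $\Omega^p_{\rm HL}(\mathfrak X)=[0,1]^2$; or (2) this boundary equals $\{\delta\}\times[0,\lim_{u\to\delta}F(u)]\ \cup\ \{(u,F(u)):u\in(\delta,1]\}$ for some $\delta\in[0,1]$ and some concave nondecreasing $F:[\delta,1]\to[0,1]$ with $F(u)\le u$ (for $\delta=1$ read $\lim_{u\to\delta}F(u)=F(1)$). Conversely, for each $\delta\in[0,1]$ and each concave nondecreasing $F:[\delta,1]\to[0,1]$ with $F(u)\le u$ there exists a metric measure space $\mathfrak X$ such that $\mathcal M^{\rm c}_{\mathfrak X}$ is bounded from $L^{p,q}(\mathfrak X)$ to $L^{p,r}(\mathfrak X)$ if and only if $1/q\ge\delta$ and $1/r\le F(1/q)$.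
   Context: Metric measure space $(X,\rho,\mu)$: nonempty set, metric, nonnegative Borel measure; $\operatorname{supp}\mu=\{x:\mu(B(x,s))>0\ \forall s>0\}$. $\mathcal M^{\rm c}_{\mathfrak X}f(x)=\sup_{s>0}\mu(B(x,s))^{-1}\int_{B(x,s)}|f|d\mu$, balls with measure $0$ or $\infty$ omitted. Lorentz quasinorm: $d_f(t)=\mu(\{|f|>t\})$, $\|f\|_{p,q}=p^{1/q}(\int_0^\infty(t d_f(t)^{1/p})^q dt/t)^{1/q}$ for $q<\infty$, $\|f\|_{p,\infty}=\sup_{t>0}t d_f(t)^{1/p}$. $\Omega^p_{\rm HL}(\mathfrak X)=\{(1/q,1/r)\in[0,1]^2:\ \mathcal M^{\rm c}_{\mathfrak X}\text{ is bounded from }L^{p,q}(\mathfrak X)\text{ to }L^{p,r}(\mathfrak X)\}$, with $q,r\in[1,\infty]$ and the convention $1/\infty=0$. *)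

(* Defs.v *)
From HB Require Import structures.
From mathcomp Require Import all_boot all_order all_algebra.
From mathcomp Require Import all_classical all_reals all_analysis.
Set Implicit Arguments.
Unset Strict Implicit.
Unset Printing Implicit Defensive.
Import Order.TTheory GRing.Theory Num.Theory.
Import numFieldNormedType.Exports.
Local Open Scope classical_set_scope.
Local Open Scope ring_scope.

Section MMS.
Variable R : realType.

Definition is_metric (X : Type) (rho : X -> X -> R) : Prop :=
  [/\ forall x y, 0 <= rho x y,
      forall x y, rho x y = 0 <-> x = y,
      forall x y, rho x y = rho y x &
      forall x y z, rho x z <= rho x y + rho y z].

Definition oball (X : Type) (rho : X -> X -> R) (x : X) (s : R) : set X :=
  [set y | rho x y < s].

Definition rho_open (X : Type) (rho : X -> X -> R) : set (set X) :=
  [set U | forall x, U x -> exists2 s : R, 0 < s & oball rho x s `<=` U].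

Record mms := MMS {
  mms_d : measure_display;
  mms_T : measurableType mms_d;
  mms_rho : mms_T -> mms_T -> R;
  mms_mu : {measure set mms_T -> \bar R};
  mms_metric : is_metric mms_rho;
  mms_borel : forall A : set mms_T,
      measurable A <-> <<s rho_open mms_rho >> A }.

Arguments mms_d : clear implicits.
Arguments mms_T : clear implicits.
Arguments mms_rho : clear implicits.
Arguments mms_mu : clear implicits.

Variable M : mms.
Let X := mms_T M.
Let rho : X -> X -> R := mms_rho M.
Let mu : {measure set X -> \bar R} := mms_mu M.

Definition supp : set X :=
  [set x | forall s : R, 0 < s -> (0 < mu (oball rho x s))%E].

(** outer measure induced by mu (coincides with mu on measurable sets) *)
Definition mu_out (A : set X) : \bar R :=
  ereal_inf [set mu B | B in [set B | measurable B /\ A `<=` B]].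

(** centered maximal function (balls of measure 0 or +oo omitted;
    sup of the empty family read as 0) *)
Definition maxfun (f : X -> R) (x : X) : \bar R :=
  ereal_sup ([set 0%E] `|`
    [set (((fine (mu (oball rho x s)))^-1)%:E *
         \int[mu]_(y in oball rho x s) (`|f y|)%:E)%E
    | s in [set s : R | 0 < s /\ (0 < mu (oball rho x s) < +oo)%E]]).

Definition distr (g : X -> \bar R) (t : R) : \bar R :=
  mu_out [set x | (t%:E < `|g x|)%E].

Definition lorentz (p : R) (q : \bar R) (g : X -> \bar R) : \bar R :=
  match q with
  | +oo%E => ereal_sup [set (t%:E * (distr g t) `^ p^-1)%E | t in [set t : R | (0 < t)%R]]
  | q'%:E => ((p `^ q'^-1)%:E *
       (\int[@lebesgue_measure R]_(t in [set t : R | (0 < t)%R])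
          (((t%:E * (distr g t) `^ p^-1) `^ q') * (t^-1)%:E)) `^ q'^-1)%E
  | -oo%E => 0%E
  end.

Definition hl_bounded (p : R) (q r : \bar R) : Prop :=
  exists C : R, forall f : X -> R, measurable_fun setT f ->
    (lorentz p q (fun x => (f x)%:E) < +oo)%E ->
    (lorentz p r (maxfun f) <= C%:E * lorentz p q (fun x => (f x)%:E))%E.

Definition exp_of_inv (u : R) : \bar R := if u == 0 then +oo%E else (u^-1)%:E.

Definition unit_square : set (R * R) :=
  [set uv | 0 <= uv.1 <= 1 /\ 0 <= uv.2 <= 1].

Definition Omega_HL (p : R) : set (R * R) :=
  [set uv | unit_square uv /\ hl_bounded p (exp_of_inv uv.1) (exp_of_inv uv.2)].

End MMS.

Arguments mms_d {R} m.
Arguments mms_T {R} m.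
Arguments mms_rho {R} m.
Arguments mms_mu {R} m.
Arguments supp {R} M.

Definition rel_boundary (T : topologicalType) (S A : set T) : set T :=
  S `&` closure (S `&` A) `&` closure (S `\` A).

Definition concave_on (R : realType) (D : set R) (F : R -> R) : Prop :=
  forall x y t, D x -> D y -> 0 <= t <= 1 ->
    t * F x + (1 - t) * F y <= F (t * x + (1 - t) * y).

Definition nondecr_on (R : realType) (D : set R) (F : R -> R) : Prop :=
  forall x y, D x -> D y -> x <= y -> F x <= F y.

Definition admissible (R : realType) (delta : R) (F : R -> R) : Prop :=
  [/\ 0 <= delta <= 1,
      concave_on `[delta, 1] F,
      nondecr_on `[delta, 1] F,
      (forall u, delta <= u <= 1 -> 0 <= F u <= 1) &
      (forall u, delta <= u <= 1 -> F u <= u)].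

(* Main.v *)
(* A Lorentz bound for a function is a weighted l^q bound on its dyadic
   distribution 2^k mu(|g| > 2^k)^(1/p), so the scale in q is governed by how
   the level sets of g spread over the integers.  Splitting a function according
   to the size of these dyadic terms makes the boundedness region of the maximal
   operator convex up to its boundary, and a bound from L^{p,q} to L^{p,r} with
   r < q forces the whole square; both facts together give the shape of the
   boundary.

   For the converse, the space is a disjoint union of finite bipartite graphs
   with distances in {0, 1, 2}.  Component j joins N+1 levels of source atoms,
   of masses 2^(ip), to K+1 levels of target atoms indexed by random samples of
   the sources, so that the maximal function at almost every target is the mean
   of a functional of norm about (N+1)^(1-1/q), reproduced on K+1 dyadic levels.
   The norm contributed by component j is therefore about
   h (N+1)^(1-1/q) (K+1)^(1/r), i.e. the exponential of an affine function of
   (1/q, 1/r), and countably many affine functions cut out the region below a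
   concave function. *)
Require Import Defs.
From HB Require Import structures.
From mathcomp Require Import all_boot all_order all_algebra.
From mathcomp Require Import all_classical all_reals all_analysis.
From mathcomp Require Import measurable_realfun lra ring zify.
Import Order.TTheory GRing.Theory Num.Theory.
Import numFieldNormedType.Exports.
Local Open Scope classical_set_scope.
Local Open Scope ring_scope.
Set Implicit Arguments.
Unset Strict Implicit.
Unset Printing Implicit Defensive.

(** * Dyadic sums and weak sequence norms *)

(** Lorentz quasinorms in general lack a triangle inequality with constant 1, and no measurability
    of [maxfun] is at hand. Both obstacles are met on superlevel sets: g is under control once each
    of its levels is reached, up to a shift by n + 1 dyadic steps, by some piece g_n of size 8^-n.
    Of the factor 8, one 2 pays for the shift, one for a pigeonhole on the measure, and one leaves a
    summable series. This superposition serves the interpolation, where a strict inequality between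
    exponents buys the decay (hence convexity only up to the boundary), and also the countable union
    of components. A bound above the diagonal leaves finitely many dyadic sizes for open sets, hence
    finitely many relevant atoms. In the example the sampling has two opposite tasks: every sample
    must see the test function in full, yet for an arbitrary function almost all samples must stay
    near the mean. Splitting each source level into many independent blocks makes the variance
    small; the few bad samples are paid for by a crude pointwise bound. Infinite total mass removes
    the balls of radius above 2. *)

Section GeometricSums.
Variable R : realType.
Implicit Types (r t : R) (J : seq int).

(** Once the largest index is removed, the others lie below it, and the bound reproduces itself: r^m
    + r^(m-1) * r/(r-1) = r^m * r/(r-1). *)
Lemma sum_expz_le r J (m : int) : 1 < r -> uniq J ->
  (forall k, k \in J -> k <= m) -> \sum_(k <- J) r ^ k <= r ^ m * (r / (r - 1)).
Proof.
move=> r1; move sJ : (size J) => n; elim: n J m sJ => [|n IH] J m sJ uJ Jm.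
  by move/size0nil: sJ => ->; rewrite big_nil mulr_ge0 ?exprz_ge0 ?divr_ge0 //; lra.
have [k0 k0J k0max] : exists2 k0, k0 \in J & forall k, k \in J -> k <= k0.
  case: J sJ uJ Jm => // a J _ _ _.
  elim: J a => [|b J IHJ] a.
    by exists a; rewrite ?mem_head// => k; rewrite inE => /eqP ->.
  have [k kJ kmax] := IHJ b; have [ak|ka] := leP a k.
    exists k; first by rewrite in_cons kJ orbT.
    by move=> l; rewrite in_cons => /orP[/eqP ->//|/kmax].
  exists a; rewrite ?mem_head// => l; rewrite in_cons => /orP[/eqP ->//|/kmax lk].
  exact: (le_trans lk (ltW ka)).
rewrite (perm_big _ (perm_to_rem k0J)) big_cons.
have sr : size (rem k0 J) = n by rewrite size_rem // sJ.
have := IH _ (k0 - 1) sr (rem_uniq _ uJ).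
have H : forall k, k \in rem k0 J -> k <= k0 - 1.
  move=> k; rewrite mem_rem_uniq// inE => /andP[/= kk0 kJ].
  have := k0max _ kJ; move/eqP: kk0; lia.
move=> /(_ H) le1.
have r0 : r != 0 by lra.
have r10 : r - 1 != 0 by lra.
have rk : r ^ k0 <= r ^ m by rewrite ler_weXz2l ?Jm // ltW.
apply: (@le_trans _ _ (r ^ k0 * (r / (r - 1)))); last first.
  by rewrite ler_wpM2r // divr_ge0 //; lra.
apply: (le_trans (lerD (lexx _) le1)).
rewrite expfzDr// exprN1 le_eqVlt; apply/orP; left; apply/eqP.
by move: (r ^ k0) => y; field; apply/andP.
Qed.

Lemma floor_expz t : 0 < t -> exists k : int, 2 ^ k <= t < 2 ^ (k + 1).
Proof.
move=> t0; have l2 : 0 < ln 2 :> R by rewrite ln_gt0 // ltr1n.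
have e2 (k : int) : (2 : R) ^ k = expR (k%:~R * ln 2).
  by rewrite -powR_intmul // /powR pnatr_eq0.
exists (Num.floor (ln t / ln 2)); rewrite !e2 -{2 3}(lnK t0) ler_expR ltr_expR.
rewrite -ler_pdivlMr // -ltr_pdivrMr //.
by rewrite floor_le floorD1_gt.
Qed.

(** Open on the left, to match the strict inequality in superlevel sets. *)
Lemma ltS_expz t : 0 < t -> exists k : int, 2 ^ k < t <= 2 ^ (k + 1).
Proof.
move=> t0; have [k /andP[k1 k2]] := floor_expz t0.
move: k1; rewrite le_eqVlt => /orP[/eqP <-|k1]; last by exists k; rewrite k1 ltW.
exists (k - 1); rewrite subrK lexx andbT.
by rewrite ltr_eXz2l ?ltr1n //; lia.
Qed.

Lemma sum_exp2z_le t J : uniq J -> (forall k, k \in J -> 2 ^ k <= t) -> 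
  0 <= t -> \sum_(k <- J) 2 ^ k <= 2 * t.
Proof.
move=> uJ Jt; rewrite le_eqVlt => /orP[/eqP t0|t0].
  rewrite -t0 mulr0 big_seq big1 // => k /Jt; rewrite -t0.
  by have := exprz_gt0 k (ltr0Sn R 1); lra.
have [m /andP[m1 m2]] := floor_expz t0.
have /(sum_expz_le _ uJ) : forall k, k \in J -> k <= m.
  move=> k /Jt kt; have : (2 : R) ^ k < 2 ^ (m + 1) by apply: le_lt_trans m2.
  rewrite ltr_eXz2l ?ltr1n //; lia.
move=> /(_ 2); rewrite ltr1n => /(_ isT) /le_trans; apply.
rewrite (_ : 2 / (2 - 1) = 2 :> R); last by field.
lra.
Qed.

(** Two geometric series: 2 bounds the terms with 2^k <= t, the quotient those with 2^k > t. *)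
Definition two_sided_const (a : R) := 2 + 2 `^ a / (2 `^ a - 1).

(** The summand peaks where 2^k is near t and decays geometrically on both sides, hence a bound
    uniform in t. *)
Lemma sum_two_sided_le (a t : R) J : 0 < a -> 0 < t -> uniq J ->
  \sum_(k <- J) Num.min (2 ^ k / t) ((2 ^ k / t) `^ (- a)) <= two_sided_const a.
Proof.
move=> a0 t0 uJ; rewrite (bigID (fun k : int => 2 ^ k <= t)) /=.
have r1 : 1 < (2 : R) `^ a.
  have : (1 : R) `^ a < 2 `^ a by rewrite gt0_ltr_powR ?nnegrE ?ltr1n.
  by rewrite powR1.
apply: lerD.
  apply: (@le_trans _ _ (\sum_(k <- J | 2 ^ k <= t) 2 ^ k / t)).
    by apply: ler_sum => k _; rewrite ge_min lexx.
  rewrite -mulr_suml ler_pdivrMr // -big_filter.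
  apply: sum_exp2z_le; rewrite ?filter_uniq ?ltW // => k.
  by rewrite mem_filter => /andP[].
have [m /andP[m1 m2]] := floor_expz t0.
apply: (@le_trans _ _ (\sum_(k <- J | ~~ (2 ^ k <= t)) t `^ a * (2 `^ a) ^ (- k))).
  apply: ler_sum => k _; rewrite ge_min; apply/orP; right.
  rewrite powRM ?invr_ge0 ?exprz_ge0 ?(ltW t0) // -(powR_inv1 (ltW t0)) -powRrM.
  rewrite mulN1r opprK mulrC ler_wpM2l ?powR_ge0 //.
  rewrite -(powR_intmul _ (ler0n R 2)) -(powR_intmul _ (powR_ge0 _ _)) -!powRrM.
  by rewrite mulrN intrN mulrN mulrC.
rewrite -mulr_sumr.
rewrite -big_filter -(big_map (fun k : int => - k) xpredT (fun k => (2 `^ a) ^ k)).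
apply: (@le_trans _ _ (t `^ a * ((2 `^ a) ^ (- m - 1) * (2 `^ a / (2 `^ a - 1))))).
  rewrite ler_wpM2l ?powR_ge0 //; apply: sum_expz_le => //.
    by rewrite map_inj_uniq ?filter_uniq //; exact: oppr_inj.
  move=> _ /mapP[k + ->]; rewrite mem_filter -ltNge => /andP[tk _].
  have : (2 : R) ^ m < 2 ^ k by apply: le_lt_trans tk.
  rewrite ltr_eXz2l ?ltr1n //; lia.
have c0 : 0 <= (2 : R) `^ a / (2 `^ a - 1).
  by rewrite divr_ge0 ?powR_ge0 // subr_ge0 ltW.
rewrite mulrA ler_piMl //.
have ta : t `^ a <= (2 `^ a) ^ (m + 1).
  rewrite -powR_intmul ?powR_ge0 // powRAC powR_intmul //.
  by rewrite ge0_ler_powR ?nnegrE ?exprz_ge0 ?ltW.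
apply: (@le_trans _ _ ((2 `^ a) ^ (m + 1) * (2 `^ a) ^ (- m - 1))).
  by rewrite ler_wpM2r // exprz_ge0 ?powR_ge0.
rewrite -expfzDr; last by rewrite gt_eqF // powR_gt0.
by rewrite (_ : m + 1 + (- m - 1) = 0) ?expr0z //; lia.
Qed.

Lemma exp2z_shift (k : int) (n : nat) :
  (2 : R) ^ (k - n%:Z - 1) = 2 ^ k / (2 ^ n.+1)%:R.
Proof.
rewrite (_ : k - n%:Z - 1 = k + - n.+1%:Z); last by lia.
by rewrite expfzDr // -exprnN natrX.
Qed.

Lemma exp2z_absz_le (e : int) (m : nat) : (`|e| <= m)%N ->
  (2 : R) ^- m.+1 <= 2 ^ e /\ (2 : R) ^ (e + 1) <= 2 ^+ m.+1.
Proof.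
move=> em; split; first by rewrite exprnN ler_eXz2l ?ltr1n //; lia.
by rewrite exprnP ler_eXz2l ?ltr1n //; lia.
Qed.

End GeometricSums.

Section WeakSequences.
Variable R : realType.
Implicit Types (u v B : R) (a b : int -> R) (J : seq int).

(** Norm at most B in the sequence space with exponent 1/u, tested on finite sums; u = 0 encodes the
    exponent infinity, where the supremum bound is everything. *)
Definition lq u a B := (forall k, 0 <= a k <= B) /\
  (0 < u -> forall J, uniq J -> \sum_(k <- J) a k `^ u^-1 <= B `^ u^-1).

Lemma lq_ge0 u a B : lq u a B -> 0 <= B.
Proof. by case=> /(_ 0) /andP[a0 aB] _; exact: le_trans aB. Qed.

Lemma lq_weaken u a B B' : lq u a B -> B <= B' -> lq u a B'.
Proof.
move=> aB BB'; have B0 := lq_ge0 aB; case: aB => aB sB; split=> [k|u0 J uJ].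
  by have /andP[-> /le_trans] := aB k; apply.
apply: (le_trans (sB u0 J uJ)).
by rewrite ge0_ler_powR ?nnegrE ?invr_ge0 ?(ltW u0) // (le_trans B0).
Qed.

Lemma lq_sum u a B : 0 < u -> 0 <= B -> (forall k, 0 <= a k) ->
  (forall J, uniq J -> \sum_(k <- J) a k `^ u^-1 <= B `^ u^-1) -> lq u a B.
Proof.
move=> u0 B0 a0 sB; split=> // k; rewrite a0 /=.
have := sB [:: k] isT; rewrite big_seq1 => h.
rewrite leNgt; apply/negP => Ba.
have : B `^ u^-1 < a k `^ u^-1 by rewrite gt0_ltr_powR ?invr_gt0 ?nnegrE.
by rewrite ltNge h.
Qed.

(** Factor a^(1/u) = a^(1/v) * a^(1/u - 1/v) and bound the second factor by the supremum. *)
Lemma lq_embed u v a B : 0 <= u -> u <= v -> lq v a B -> lq u a B.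
Proof.
move=> u0 uv aB; have := lq_ge0 aB; case: aB => aB sB.
rewrite le_eqVlt => /orP[/eqP B0|B0].
  have a0 k : a k = 0 by have := aB k; rewrite -B0 -eq_le => /eqP.
  split=> [//|up J uJ]; rewrite big1 ?powR_ge0 // => k _.
  by rewrite a0 powR0 // invr_neq0 // gt_eqF.
split=> // up J uJ; have vp : 0 < v by apply: lt_le_trans uv.
have d0 : 0 <= u^-1 - v^-1 by rewrite subr_ge0 lef_pV2 ?posrE.
have E (x : R) : x != 0 -> x `^ u^-1 = x `^ v^-1 * x `^ (u^-1 - v^-1).
  by move=> x0; rewrite -powRD ?x0 ?implybT //; congr powR; ring.
rewrite (E B) ?gt_eqF //.
apply: (@le_trans _ _ ((\sum_(k <- J) a k `^ v^-1) * B `^ (u^-1 - v^-1))).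
  rewrite mulr_suml; apply: ler_sum => k _; have /andP[ak0 akB] := aB k.
  have [->|ak] := eqVneq (a k) 0.
    by rewrite !powR0 ?mul0r // invr_neq0 // gt_eqF.
  by rewrite E // ler_wpM2l ?powR_ge0 // ge0_ler_powR // nnegrE ltW.
by rewrite ler_wpM2r ?powR_ge0 // sB.
Qed.

Lemma powR_le1 (x t : R) : 0 <= x <= 1 -> 0 <= t -> x `^ t <= 1.
Proof.
move=> /andP[x0 x1] t0; have : x `^ t <= 1 `^ t by rewrite ge0_ler_powR ?nnegrE.
by rewrite powR1.
Qed.

Lemma powR_ge1 (x t : R) : 1 <= x -> 0 <= t -> 1 <= x `^ t.
Proof.
move=> x1 t0; have : 1 `^ t <= x `^ t.
  by rewrite ge0_ler_powR ?nnegrE // (le_trans ler01).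
by rewrite powR1.
Qed.

Lemma powR_mul_le_add (x y t : R) : 0 <= x -> 0 <= y -> 0 <= t <= 1 ->
  x `^ (1 - t) * y `^ t <= x + y.
Proof.
move=> x0 y0 /andP[t0 t1].
apply: (@le_trans _ _ (Num.max x y)); last first.
  by rewrite ge_max lerDl lerDr x0 y0.
have m0 : 0 <= Num.max x y by rewrite le_max x0.
have -> : Num.max x y = Num.max x y `^ (1 - t) * Num.max x y `^ t.
  have [->|mn] := eqVneq (Num.max x y) 0.
    have [->|tn] := eqVneq t 0; first by rewrite subr0 powR0 ?oner_eq0 // mul0r.
    by rewrite (powR0 tn) mulr0.
  by rewrite -powRD ?mn ?implybT // subrK powRr1.
apply: ler_pM; rewrite ?powR_ge0 //.
  by rewrite ge0_ler_powR ?nnegrE ?subr_ge0 // le_max lexx.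
by rewrite ge0_ler_powR ?nnegrE // le_max lexx orbT.
Qed.

(** Hoelder's inequality up to a factor 2: after division by [P0] and [P1], each term is a weighted
    geometric mean of two summable terms, hence at most their sum. *)
Lemma lq_interp v0 v1 (t P0 P1 : R) a : 0 <= v0 -> 0 <= v1 -> 0 <= t <= 1 ->
  (1 - t) * v0 + t * v1 <= 1 -> 0 < P0 -> 0 < P1 ->
  lq v0 a P0 -> lq v1 a P1 ->
  lq ((1 - t) * v0 + t * v1) a (2 * (P0 `^ (1 - t) * P1 `^ t)).
Proof.
set v := _ + _ => v00 v10 t01 v1le P0p P1p [a0 s0] [a1 s1].
have /andP[t0 t1] := t01.
have age0 k : 0 <= a k by have /andP[] := a0 k.
set P := P0 `^ (1 - t) * P1 `^ t.
have Pp : 0 < P by rewrite mulr_gt0 ?powR_gt0.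
have y01 k : a k / P = (a k / P0) `^ (1 - t) * (a k / P1) `^ t.
  have [->|akn] := eqVneq (a k) 0.
    rewrite !mul0r; have [->|tn] := eqVneq t 0.
      by rewrite subr0 powR0 ?oner_eq0 // mul0r.
    by rewrite (powR0 tn) mulr0.
  rewrite !powRM ?invr_ge0 ?(ltW P0p) ?(ltW P1p) // mulrACA -powRD ?akn ?implybT // subrK powRr1 //.
  rewrite /P invfM -!powRN -(powR_inv1 (ltW P0p)) -(powR_inv1 (ltW P1p)).
  by rewrite -!powRrM !mulN1r.
have aP k : a k <= P.
  rewrite -[leRHS]mul1r -ler_pdivrMr // y01 mulr_ile1 ?powR_ge0 //.
    by rewrite powR_le1 ?subr_ge0 // divr_ge0 ?(ltW P0p) //= ler_pdivrMr // mul1r; have /andP[] := a0 k.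
  by rewrite powR_le1 // divr_ge0 ?(ltW P1p) //= ler_pdivrMr // mul1r; have /andP[] := a1 k.
have v0' : 0 <= v by rewrite addr_ge0 ?mulr_ge0 ?subr_ge0.
apply: (@lq_weaken _ _ (2 `^ v * P)); last first.
  by rewrite ler_wpM2r ?(ltW Pp) // -[leRHS]powRr1 // ler_powR // ler1n.
have P2 : P <= 2 `^ v * P by rewrite ler_peMl ?(ltW Pp) // powR_ge1 ?ler1n.
split=> [k|vp J uJ]; first by rewrite age0 (le_trans (aP k)).
have vi0 : v^-1 != 0 by rewrite invr_neq0 // gt_eqF.
rewrite powRM ?powR_ge0 ?(ltW Pp) // -powRrM divff ?gt_eqF // powRr1 //.
have E w (Q : R) (b := fun k => (a k / Q) `^ w^-1) : 0 <= w -> 0 < Q -> lq w a Q ->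
    exists2 c : int -> R, \sum_(k <- J) c k <= 1 &
     forall k, 0 <= c k /\ (forall r : R, 0 <= r -> (a k / Q) `^ (r / v) <= c k `^ (r * w / v)).
  move=> w0 Qp [aQ sQ].
  have aQ1 k : 0 <= a k / Q <= 1.
    by rewrite divr_ge0 ?(ltW Qp) //= ler_pdivrMr // mul1r; have /andP[] := aQ k.
  have [wz|wn] := eqVneq w 0.
    (* At w = 0 the exponent r * w / v is 0, and 0 to the power 0 equals 1, so the zero sequence
       majorises terms that are at most 1. *)
    exists (fun=> 0); first by rewrite big1.
    move=> k; split=> // r r0; rewrite wz mulr0 mul0r powRr0 powR_le1 //.
    by rewrite divr_ge0.
  have wp : 0 < w by rewrite lt_neqAle eq_sym wn.
  exists b => [|k].
    rewrite /b; under eq_bigr do rewrite powRM ?invr_ge0 ?(ltW Qp) //.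
    rewrite -mulr_suml -(powR_inv1 (ltW Qp)) powRAC powR_inv1 ?powR_ge0 //.
    by rewrite ler_pdivrMr ?powR_gt0 // mul1r sQ.
  split=> [|r r0]; first exact: powR_ge0.
  rewrite /b -powRrM le_eqVlt; apply/orP; left; apply/eqP; congr powR.
  have vn : v != 0 by rewrite gt_eqF.
  by field; rewrite wn vn.
have [c0 sc0 hc0] := E v0 P0 v00 P0p (conj a0 s0).
have [c1 sc1 hc1] := E v1 P1 v10 P1p (conj a1 s1).
rewrite -ler_pdivrMr ?powR_gt0 // mulr_suml.
apply: (@le_trans _ _ (\sum_(k <- J) (c0 k + c1 k))); last first.
  by rewrite big_split /= (le_trans (lerD sc0 sc1)).
apply: ler_sum => k _.
have -> : a k `^ v^-1 / P `^ v^-1 = (a k / P) `^ v^-1.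
  by rewrite powRM ?invr_ge0 ?(ltW Pp) // -(powR_inv1 (ltW Pp)) powRAC powR_inv1 ?powR_ge0.
rewrite y01 powRM ?powR_ge0 // -!powRrM.
have [[c00 h0] [c10 h1]] := (hc0 k, hc1 k).
have s0' : 0 <= 1 - t by rewrite subr_ge0.
apply: (le_trans (ler_pM (powR_ge0 _ _) (powR_ge0 _ _) (h0 _ s0') (h1 _ t0))).
have -> : (1 - t) * v0 / v = 1 - t * v1 / v.
  have vn : v != 0 by rewrite gt_eqF.
  by apply: (mulIf vn); rewrite [RHS]mulrBl mul1r !divfK // /v addrK.
apply: powR_mul_le_add => //.
rewrite divr_ge0 ?mulr_ge0 //= ler_pdivrMr // mul1r /v lerDr.
by rewrite mulr_ge0.
Qed.

(** Each term is charged to one sequence; the weights give 8 * 4^n * 8^-n = 8 * 2^-n, summable in n.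
    Injectivity of the shifts keeps indices distinct, and v <= 1 makes the powers 1/v of 2^-n no
    larger than 2^-n. *)
Lemma lq_superpose v a (b : nat -> int -> R) (s : nat -> int -> int) B :
  v <= 1 -> (forall n, injective (s n)) -> (forall k, 0 <= a k) ->
  (forall n, lq v (b n) (8^-1 ^+ n * B)) ->
  (forall k, exists n, a k <= 8 * 4 ^+ n * b n (s n k)) -> lq v a (16 * B).
Proof.
move=> v1 si a0 bB /choice[nk ank].
have B0 : 0 <= B by have := lq_ge0 (bB 0%N); rewrite expr0 mul1r.
have eq8 n : 8 * 4 ^+ n * (8^-1 ^+ n * B) = 2^-1 ^+ n * (8 * B).
  have e4 : 4 ^+ n * 4^-1 ^+ n = 1 :> R by rewrite -exprMn divff ?expr1n ?pnatr_eq0.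
  rewrite (_ : 8^-1 = 4^-1 * 2^-1 :> R) ?exprMn; last by field.
  move: e4; move: (4 ^+ n) (4^-1 ^+ n) (2^-1 ^+ n) => x y z e4.
  by rewrite -[RHS]mul1r -e4; ring.
have bs n k : 0 <= 8 * 4 ^+ n * b n (s n k) <= 2^-1 ^+ n * (8 * B).
  have /andP[b0 b1] := (bB n).1 (s n k).
  rewrite !mulr_ge0 ?exprn_ge0 //=.
  by rewrite -eq8 ler_wpM2l // mulr_ge0 ?exprn_ge0.
split=> [k|vp J uJ].
  rewrite a0 (le_trans (ank k)) //; have /andP[_ /le_trans] := bs (nk k) k; apply.
  rewrite -[leRHS]mul1r (_ : 16 = 2 * 8); last by ring.
  rewrite -!mulrA [1 * _]mul1r ler_pM ?mulr_ge0 ?exprn_ge0 //.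
  by rewrite (le_trans (y := 1)) ?ler1n // exprn_ile1 // invf_le1 ?ler1n.
have vi : 1 <= v^-1 by rewrite invf_ge1.
have vi0 : 0 <= v^-1 by rewrite invr_ge0 ltW.
pose M := (\max_(k <- J) nk k).+1.
apply: (@le_trans _ _ (\sum_(k <- J) \sum_(n < M) (8 * 4 ^+ n * b n (s n k)) `^ v^-1)).
  rewrite big_seq [leRHS]big_seq; apply: ler_sum => k kJ.
  have kM : (nk k < M)%N by rewrite ltnS; exact: leq_bigmax_seq.
  rewrite (bigD1 (Ordinal kM)) //=.
  have /andP[h _] := bs (nk k) k.
  apply: (@le_trans _ _ ((8 * 4 ^+ nk k * b (nk k) (s (nk k) k)) `^ v^-1)).
    by rewrite ge0_ler_powR ?nnegrE.
  by rewrite lerDl sumr_ge0 // => i _; rewrite powR_ge0.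
rewrite exchange_big /=.
apply: (@le_trans _ _ (\sum_(n < M) 2^-1 ^+ n * (8 * B) `^ v^-1)).
  apply: ler_sum => n _.
  under eq_bigr do rewrite powRM ?mulr_ge0 ?exprn_ge0 ?((andP ((bB n).1 _)).1) //.
  rewrite -mulr_sumr.
  have := (bB n).2 vp (map (s n) J); rewrite (map_inj_uniq (si n)) => /(_ uJ).
  rewrite big_map => /(ler_wpM2l (powR_ge0 (8 * 4 ^+ n) v^-1)) /le_trans; apply.
  rewrite -powRM ?mulr_ge0 ?exprn_ge0 ?invr_ge0 //.
  rewrite eq8.
  rewrite [leLHS]powRM ?mulr_ge0 ?exprn_ge0 ?invr_ge0 // ler_wpM2r ?powR_ge0 //.
  apply: ge1r_powR => //; rewrite exprn_gt0 ?invr_gt0 //=.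
  by rewrite exprn_ile1 // invf_le1 ?ler1n.
rewrite -mulr_suml (_ : 16 * B = 2 * (8 * B)); last by ring.
rewrite [leRHS]powRM ?mulr_ge0 // ler_wpM2r ?powR_ge0 //.
apply: (@le_trans _ _ 2); last by rewrite le1r_powR ?ler1n.
have -> : \sum_(n < M) 2^-1 ^+ n = 2 * (1 - 2^-1 ^+ M) :> R.
  elim: M => [|m IH]; first by rewrite big_ord0 expr0 subrr mulr0.
  by rewrite big_ord_recr /= IH exprS; field.
by rewrite mulrBr mulr1 gerBl mulr_ge0 // exprn_ge0.
Qed.

End WeakSequences.

(** * Dyadic Lorentz bounds *)

Section DyadicQuasinorm.
Variables (R : realType) (M : mms R).
Local Notation X := (mms_T M).
Local Notation mu := (mms_mu M).
Implicit Types (A : set X) (g : X -> \bar R) (p u B : R) (k : int).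

(** Covers by one measurable set and by countably many give the same infimum. This provides
    countable subadditivity for the superlevel sets of [maxfun]. *)
Lemma mu_outE A : mu_out A = mu_ext mu A.
Proof.
apply/eqP; rewrite eq_le; apply/andP; split; apply: le_ereal_inf_tmp.
  move=> _ [F [mF AF] <-]; apply: (@le_trans _ _ (mu (\bigcup_n F n))).
    by apply: ereal_inf_lbound; exists (\bigcup_n F n) => //; split => //;
      exact: bigcupT_measurable.
  by apply: measure_sigma_subadditive => //; exact: bigcupT_measurable.
move=> _ [C [mC AC] <-]; rewrite -(measurable_mu_extE mu mC).
exact: le_mu_ext.
Qed.

Lemma mu_out_ge0 A : (0 <= mu_out A)%E.
Proof. by rewrite mu_outE mu_ext_ge0. Qed.

Lemma le_mu_out A C : A `<=` C -> (mu_out A <= mu_out C)%E.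
Proof. by rewrite !mu_outE; exact: le_mu_ext. Qed.

Lemma mu_out_measurable A : measurable A -> mu_out A = mu A.
Proof. by move=> mA; rewrite mu_outE measurable_mu_extE. Qed.

Lemma mu_out_bigcup (F : nat -> set X) :
  (mu_out (\bigcup_n F n) <= \sum_(n <oo) mu_out (F n))%E.
Proof.
rewrite mu_outE; under eq_eseriesr do rewrite mu_outE.
exact: mu_ext_sigma_subadditive.
Qed.

Lemma mu_out0 : mu_out (set0 : set X) = 0%E.
Proof. by rewrite mu_out_measurable // measure0. Qed.

Lemma mu_outU A C : (mu_out (A `|` C) <= mu_out A + mu_out C)%E.
Proof. by rewrite !mu_outE; exact: outer_measureU2. Qed.

Lemma mu_out_bigsetU (I : Type) (s : seq I) (P : pred I) (F : I -> set X) :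
  (mu_out (\big[setU/set0]_(i <- s | P i) F i) <= \sum_(i <- s | P i) mu_out (F i))%E.
Proof.
elim/big_rec2 : _ => [|i C m _ Cm]; first by rewrite mu_out0.
exact: le_trans (mu_outU _ _) (leeD2l _ Cm).
Qed.

Lemma distr_ge0 g t : (0 <= distr g t)%E.
Proof. exact: mu_out_ge0. Qed.

Lemma le_distr g s t : s <= t -> (distr g t <= distr g s)%E.
Proof.
move=> st; apply: le_mu_out => x /=; apply: le_lt_trans; by rewrite lee_fin.
Qed.

(** [fine] turns an infinite distribution value into 0, so finiteness is a separate clause of
    [lor]. *)
Definition dyadic p g k : R := 2 ^ k * fine (distr g (2 ^ k)) `^ p^-1.

(** [lor p u g B] is, up to constants, the bound [B] for the Lorentz
    quasinorm of [g] with exponents [p] and [1/u]: the dyadic values of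
    [t * d_g(t) `^ p^-1] are bounded by [B] in the sequence space with
    exponent [1/u]. *)
Definition lor p u g B :=
  (forall k, distr g (2 ^ k) < +oo)%E /\ lq u (dyadic p g) B.

Lemma dyadic_ge0 p g k : 0 <= dyadic p g k.
Proof. by rewrite mulr_ge0 ?exprz_ge0 ?powR_ge0. Qed.

Lemma distr_fin p u g B k : lor p u g B -> distr g (2 ^ k) \is a fin_num.
Proof. by case=> /(_ k); rewrite ge0_fin_numE ?distr_ge0. Qed.

Lemma lor_ge0 p u g B : lor p u g B -> 0 <= B.
Proof. by case=> _ /lq_ge0. Qed.

Lemma lor_weaken p u g B B' : lor p u g B -> B <= B' -> lor p u g B'.
Proof. by case=> gf gB BB'; split=> //; exact: lq_weaken gB BB'. Qed.

Lemma lor_embed p u v g B : 0 <= u -> u <= v -> lor p v g B -> lor p u g B.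
Proof. by move=> u0 uv [gf gB]; split=> //; exact: lq_embed gB. Qed.

Lemma lor_interp p v0 v1 (t P0 P1 : R) g : 0 <= v0 -> 0 <= v1 -> 0 <= t <= 1 ->
  (1 - t) * v0 + t * v1 <= 1 -> 0 < P0 -> 0 < P1 ->
  lor p v0 g P0 -> lor p v1 g P1 ->
  lor p ((1 - t) * v0 + t * v1) g (2 * (P0 `^ (1 - t) * P1 `^ t)).
Proof. by move=> v00 v10 t01 v1' P00 P10 [gf g0] [_ g1]; split=> //; exact: lq_interp. Qed.

Variable p : R.
Hypothesis p1 : 1 < p.
Let p0 : 0 < p. Proof. exact: lt_trans p1. Qed.
Let pi0 : 0 <= p^-1. Proof. by rewrite invr_ge0 ltW. Qed.

Lemma powR_inv_le (x c : R) : 0 <= x -> 0 <= c -> (x `^ p^-1 <= c) = (x <= c `^ p).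
Proof.
move=> x0 c0; apply/idP/idP => [h|h].
  have : (x `^ p^-1) `^ p <= c `^ p.
    by rewrite ge0_ler_powR ?nnegrE ?powR_ge0 // ltW.
  by rewrite -powRrM mulVf ?gt_eqF // powRr1.
have : x `^ p^-1 <= (c `^ p) `^ p^-1 by rewrite ge0_ler_powR ?nnegrE ?powR_ge0.
by rewrite -powRrM divff ?gt_eqF // powRr1.
Qed.

Lemma dyadic_le g k c : 0 <= c -> (distr g (2 ^ k) < +oo)%E ->
  (dyadic p g k <= c) = (distr g (2 ^ k) <= ((c / 2 ^ k) `^ p)%:E)%E.
Proof.
move=> c0 gf; rewrite /dyadic mulrC -ler_pdivlMr ?exprz_gt0 //.
rewrite powR_inv_le ?fine_ge0 ?distr_ge0 ?divr_ge0 ?exprz_ge0 //.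
by rewrite -lee_fin fineK // ge0_fin_numE ?distr_ge0.
Qed.

Lemma distr_le u g B k : lor p u g B -> (distr g (2 ^ k) <= ((B / 2 ^ k) `^ p)%:E)%E.
Proof.
move=> gB; have B0 := lor_ge0 gB; case: gB => gf [gB _].
by rewrite -dyadic_le //; have /andP[] := gB k.
Qed.

(** Superadditivity of the p-th power: y^p = y * y^(p-1) <= y * S^(p-1) for every term y of the sum
    S. *)
Lemma sum_powR_le (I : Type) (s : seq I) (P : pred I) (y : I -> R) :
  (forall i, 0 <= y i) -> \sum_(i <- s | P i) y i `^ p <= (\sum_(i <- s | P i) y i) `^ p.
Proof.
move=> y0; set S := \sum_(i <- s | P i) y i.
have S0 : 0 <= S by rewrite sumr_ge0.
have yS i : P i -> List.In i s -> y i <= S.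
  rewrite /S; elim: s {S S0} => // a s IH Pi [->|si].
    by rewrite big_cons Pi lerDl sumr_ge0.
  by rewrite big_cons; case: ifP => _; [apply: le_trans (IH Pi si) _; rewrite lerDr|exact: IH].
have -> : S `^ p = \sum_(i <- s | P i) y i * S `^ (p - 1).
  by rewrite -mulr_suml mulr_powRB1.
have h i : P i -> List.In i s -> y i `^ p <= y i * S `^ (p - 1).
  move=> Pi si; rewrite -mulr_powRB1 // ler_wpM2l //.
  by rewrite ge0_ler_powR ?nnegrE ?yS // subr_ge0 ltW.
move: (S `^ (p - 1)) h => C; elim: s {S S0 yS} => [|a s IH] h; first by rewrite !big_nil.
rewrite !big_cons; case: ifP => Pa.
  by apply: lerD; [apply: h => //; left|apply: IH => i Pi si; apply: h => //; right].
by apply: IH => i Pi si; apply: h => //; right.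
Qed.

End DyadicQuasinorm.

Section Profiles.
Variables (R : realType) (M : mms R) (p : R).
Hypothesis p1 : 1 < p.
Local Notation X := (mms_T M).
Implicit Types (g : X -> \bar R) (h x s : R).
Let p0 : 0 < p. Proof. exact: lt_trans p1. Qed.
Let pi0 : 0 <= p^-1. Proof. by rewrite invr_ge0 ltW. Qed.

(** The superlevel set lies in the union of the [V e] whose height x / 2^e exceeds the level;
    [sum_powR_le] merges their masses into one p-th power. *)
Lemma profile_distr_le (J : seq int) (V : int -> set X) h x g l :
  0 < h -> 0 < x -> (forall e, e \in J -> (mu_out (V e) <= ((h * 2 ^ e) `^ p)%:E)%E) ->
  (forall y k, ((2 ^ k)%:E < `|g y|)%E -> exists e, [/\ e \in J, V e y & 2 ^ k < x / 2 ^ e]) ->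
  (distr g (2 ^ l) <= ((h * \sum_(e <- J | 2 ^ l < x / 2 ^ e) 2 ^ e) `^ p)%:E)%E.
Proof.
move=> h0 x0 VJ gV.
apply: (@le_trans _ _ (mu_out (\big[setU/set0]_(e <- J | 2 ^ l < x / 2 ^ e) V e))).
  apply: le_mu_out => y /= /gV [e [eJ Ve le]].
  by rewrite -bigcup_seq_cond; exists e => //=; rewrite eJ.
apply: (le_trans (mu_out_bigsetU _ _ _)).
have H : (\sum_(e <- J | (2 ^ l < x / 2 ^ e)%R) mu_out (V e) <=
    \sum_(e <- J | (2 ^ l < x / 2 ^ e)%R) ((h * 2 ^ e) `^ p)%:E)%E.
  by rewrite big_seq_cond [leRHS]big_seq_cond; apply: lee_sum => e /andP[eJ _]; exact: VJ.
apply: (le_trans H).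
rewrite sumEFin lee_fin mulr_sumr; apply: sum_powR_le => // e.
by rewrite mulr_ge0 ?exprz_ge0 // ltW.
Qed.

(** Level e has mass^(1/p) about h * 2^e and height x / 2^e, so it contributes about h * x to the
    dyadic sequence, at its own place. Geometric sums settle s = 0 and s = 1; interpolation gives
    the rest. *)
Lemma profile_upper (J : seq int) (V : int -> set X) h x (S : R) s g :
  0 < h -> 0 < x -> 1 <= S -> 0 <= s <= 1 -> uniq J -> (size J)%:R <= S ->
  (forall e, e \in J -> (mu_out (V e) <= ((h * 2 ^ e) `^ p)%:E)%E) ->
  (forall y k, ((2 ^ k)%:E < `|g y|)%E -> exists e, [/\ e \in J, V e y & 2 ^ k < x / 2 ^ e]) ->
  lor p s g (4 * (h * x) * S `^ s).
Proof.
move=> h0 x0 S1 s01 uJ JS VJ gV.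
have hx0 : 0 < 2 * (h * x) by rewrite mulr_gt0 // mulr_gt0.
have D := profile_distr_le _ h0 x0 VJ gV.
have S0 l : 0 <= \sum_(e <- J | 2 ^ l < x / 2 ^ e) (2 : R) ^ e.
  by rewrite sumr_ge0 // => e _; rewrite exprz_ge0.
have gf k : (distr g (2 ^ k) < +oo)%E by apply: le_lt_trans (D k) _; rewrite ltry.
have da l : dyadic p g l <= 2 ^ l * (h * \sum_(e <- J | 2 ^ l < x / 2 ^ e) 2 ^ e).
  have c0 : 0 <= 2 ^ l * (h * \sum_(e <- J | 2 ^ l < x / 2 ^ e) 2 ^ e).
    by rewrite !mulr_ge0 ?exprz_ge0 // ltW.
  by rewrite dyadic_le // mulrAC divff ?mul1r // expfz_neq0.
have xl (e l : int) : (2 ^ l < x / 2 ^ e) = (2 ^ e < x / 2 ^ l).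
  by rewrite !ltr_pdivlMr ?exprz_gt0 // mulrC.
have sup k : 0 <= dyadic p g k <= 2 * (h * x).
  rewrite dyadic_ge0 (le_trans (da k)) //.
  have : \sum_(e <- J | 2 ^ k < x / 2 ^ e) 2 ^ e <= 2 * (x / 2 ^ k).
    rewrite -big_filter; apply: sum_exp2z_le; rewrite ?filter_uniq //.
      by move=> e; rewrite mem_filter xl => /andP[/ltW].
    by rewrite divr_ge0 ?exprz_ge0 // ltW.
  move=> /(ler_wpM2l (ltW h0)) /(ler_wpM2l (exprz_ge0 k (ler0n R 2))) /le_trans; apply.
  rewrite le_eqVlt; apply/orP; left; apply/eqP; field.
  by rewrite expfz_neq0.
have s1 : lq 1 (dyadic p g) (2 * (h * x) * S).
  have S00 : 0 <= S by apply: le_trans S1.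
  apply: lq_sum => //; first by rewrite mulr_ge0 // ltW.
    by move=> k; have /andP[] := sup k.
  move=> L uL; rewrite invr1 powRr1; last by rewrite mulr_ge0 // ltW.
  under eq_bigr do rewrite powRr1 ?dyadic_ge0 //.
  apply: (le_trans (ler_sum _ (fun l _ => da l))).
  under eq_bigr do rewrite mulrCA mulr_sumr mulr_sumr.
  under eq_bigr do rewrite big_mkcond /=.
  rewrite exchange_big /=.
  apply: (@le_trans _ _ (\sum_(e <- J) 2 * (h * x))).
    apply: ler_sum => e _; rewrite -big_mkcond /=.
    under eq_bigr do rewrite mulrA mulrAC.
    rewrite -mulr_sumr -big_filter.
    have : \sum_(l <- [seq l <- L | 2 ^ l < x / 2 ^ e]) 2 ^ l <= 2 * (x / 2 ^ e).
      apply: sum_exp2z_le; rewrite ?filter_uniq //.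
        by move=> l; rewrite mem_filter => /andP[/ltW].
      by rewrite divr_ge0 ?exprz_ge0 // ltW.
    have he : 0 <= h * 2 ^ e by rewrite mulr_ge0 ?exprz_ge0 // ltW.
    move=> /(ler_wpM2l he) /le_trans; apply.
    rewrite le_eqVlt; apply/orP; left; apply/eqP; field.
    by rewrite expfz_neq0.
  rewrite big_const_seq count_predT iter_addr addr0 -[_ *+ size J]mulr_natr.
  by rewrite ler_wpM2l // ltW.
have s0 : lq 0 (dyadic p g) (2 * (h * x)) by split=> //; rewrite ltxx.
have hS : 0 < 2 * (h * x) * S by rewrite mulr_gt0 // (lt_le_trans ltr01).
have := @lq_interp _ 0 1 s _ _ _ (lexx _) ler01 s01 _ hx0 hS s0 s1.
rewrite mulr0 add0r mulr1; have /andP[s00 s11] := s01.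
move=> /(_ s11) H.
split=> //; apply: lq_weaken H _.
rewrite (@powRM _ _ S) ?(ltW hx0) ?(le_trans ler01) // [X in 2 * X]mulrA -powRD; last first.
  by rewrite subrK oner_eq0.
by rewrite subrK powRr1 ?(ltW hx0) // !mulrA -natrM.
Qed.

(** With 2^m just below x, the place m - e sees the full mass of level e. Distinct levels occupy
    distinct places, so [size J] terms are at least h * x / 2. *)
Lemma profile_lower (J : seq int) h x s g B :
  0 < h -> 0 < x -> 0 <= s -> uniq J -> (0 < size J)%N ->
  (forall e l, e \in J -> 2 ^ l < x / 2 ^ e ->
    (((h * 2 ^ e) `^ p)%:E <= distr g (2 ^ l))%E) ->
  lor p s g B -> h * x / 2 * (size J)%:R `^ s <= B.
Proof.
move=> h0 x0 s0 uJ J0 gJ gB; have B0 := lor_ge0 gB.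
have [m /andP[m1 m2]] := ltS_expz x0.
have hx0 : 0 <= h * x / 2 by rewrite divr_ge0 // mulr_ge0 // ltW.
have da e : e \in J -> h * x / 2 <= dyadic p g (m - e).
  move=> eJ; have hD : (((h * 2 ^ e) `^ p)%:E <= distr g (2 ^ (m - e)))%E.
    by apply: gJ => //; rewrite expfzDr // -invr_expz ltr_pM2r ?invr_gt0 ?exprz_gt0.
  have fi := distr_fin (m - e) gB.
  have : h * 2 ^ e <= fine (distr g (2 ^ (m - e))) `^ p^-1.
    have he : 0 <= h * 2 ^ e by rewrite mulr_ge0 ?exprz_ge0 // ltW.
    have -> : h * 2 ^ e = ((h * 2 ^ e) `^ p) `^ p^-1.
      by rewrite -powRrM divff ?gt_eqF // powRr1.
    rewrite ge0_ler_powR ?nnegrE ?powR_ge0 ?fine_ge0 ?distr_ge0 //.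
    by rewrite -lee_fin fineK.
  move=> /(ler_wpM2l (exprz_ge0 (m - e) (ler0n R 2))); apply: le_trans.
  rewrite expfzDr // -invr_expz.
  rewrite (_ : 2 ^ m / 2 ^ e * (h * 2 ^ e) = h * 2 ^ m); last first.
    by field; rewrite expfz_neq0.
  rewrite -mulrA ler_wpM2l ?(ltW h0) // ler_pdivrMr //.
  by move: m2; rewrite expfzDr // expr1z.
case: gB => gf [gB1 gB2]; move: s0; rewrite le_eqVlt => /orP[/eqP <-|s0].
  rewrite powRr0 mulr1; case: J J0 da {uJ gJ} => // e J _ /(_ e (mem_head _ _)).
  by move=> /le_trans; apply; have /andP[] := gB1 (m - e).
have uJ' : uniq (map (fun e => m - e) J).
  by rewrite map_inj_uniq // => a b /addrI /oppr_inj.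
have := gB2 s0 _ uJ'; rewrite big_map => H.
have {}H : (size J)%:R * (h * x / 2) `^ s^-1 <= B `^ s^-1.
  apply: le_trans H; rewrite -[X in X%:R]count_predT mulr_natl.
  rewrite -iter_addr_0 -big_const_seq big_seq [leRHS]big_seq; apply: ler_sum => e eJ.
  by rewrite ge0_ler_powR ?nnegrE ?invr_ge0 ?dyadic_ge0 ?da // ltW.
have : ((size J)%:R * (h * x / 2) `^ s^-1) `^ s <= (B `^ s^-1) `^ s.
  by rewrite ge0_ler_powR ?nnegrE ?mulr_ge0 ?powR_ge0 // ltW.
rewrite powRM ?powR_ge0 // -!powRrM mulVf ?gt_eqF // !powRr1 //.
by rewrite mulrC.
Qed.

(** Replaces a countable triangle inequality. The shifted superlevel sets of the pieces cover that
    of g, so some n carries a fraction 2^-(n+2) of its measure. This costs a factor of order 2^n,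
    the shift another, and the weights 8^-n leave a convergent series. *)
Lemma lor_superpose s g (gn : nat -> X -> \bar R) B : 0 <= s <= 1 ->
  (forall y k, ((2 ^ k)%:E < `|g y|)%E ->
     exists n : nat, ((2 ^ (k - n%:Z - 1))%:E < `|gn n y|)%E) ->
  (forall n, lor p s (gn n) (8^-1 ^+ n * B)) -> lor p s g (16 * B).
Proof.
move=> /andP[s0 s1] ggn gnB.
have B0 : 0 <= B by have := lor_ge0 (gnB 0%N); rewrite expr0 mul1r.
have sub k : (distr g (2 ^ k) <= \sum_(n <oo) distr (gn n) (2 ^ (k - n%:Z - 1)))%E.
  apply: le_trans (mu_out_bigcup _); apply: le_mu_out => y /= /ggn [n ny].
  by exists n.
have split2 (k : int) (n : nat) : (2 : R) ^ (k - n%:Z - 1) = 2 ^ k * 2^-1 ^+ n.+1.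
  rewrite (_ : k - n%:Z - 1 = k + - n.+1%:Z); last by lia.
  by rewrite expfzDr // -exprnN exprVn.
have half n : (2^-1 ^+ n.+1) = 1 / (2 ^ n.+1)%:R :> R by rewrite div1r natrX exprVn.
have gf k : (distr g (2 ^ k) < +oo)%E.
  apply: (le_lt_trans (sub k)).
  apply: (@le_lt_trans _ _ (((2 * B / 2 ^ k) `^ p * 2)%:E)); last by rewrite ltry.
  apply: le_trans (@epsilon_trick0 _ ((2 * B / 2 ^ k) `^ p * 2) predT _); last first.
    by rewrite mulr_ge0 ?powR_ge0.
  apply: lee_nneseries => [n _ _|n _]; first exact: distr_ge0.
  apply: (le_trans (distr_le p1 _ (gnB n))); rewrite lee_fin split2.
  have -> : 8^-1 ^+ n * B / (2 ^ k * 2^-1 ^+ n.+1) = (2 * B / 2 ^ k) * 4^-1 ^+ n.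
    rewrite (_ : 8^-1 = 4^-1 * 2^-1 :> R) ?exprMn ?exprS; last by field.
    have : 2^-1 ^+ n != 0 :> R by rewrite expf_neq0.
    move: (4^-1 ^+ n) (2^-1 ^+ n) => a b bn; field; rewrite expfz_neq0 //=.
  rewrite [leLHS]powRM ?exprn_ge0 ?divr_ge0 ?mulr_ge0 ?exprz_ge0 // -[leRHS]mulrA ler_wpM2l ?powR_ge0 //.
  rewrite natrX exprS invfM mulrA divff // mul1r -exprVn.
  apply: (@le_trans _ _ (4^-1 ^+ n)).
    rewrite ge1r_powR ?(ltW p1) // exprn_gt0 ?invr_gt0 //= exprn_ile1 //.
    by rewrite invf_le1 ?ler1n.
  by rewrite lerXn2r ?nnegrE ?invr_ge0 // lef_pV2 ?posrE // ler_nat.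
split=> //; apply: (@lq_superpose _ _ _ (fun n => dyadic p (gn n)) (fun n k => k - n%:Z - 1)) => //.
- by move=> n a b /addIr /addIr.
- by move=> k; exact: dyadic_ge0.
- by move=> n; have [] := gnB n.
(* Otherwise piece n has at most the fraction 2^-(n+2) of the measure D of the superlevel set. These
   sum to D / 2, so D = 0, and then the negated inequality is absurd. *)
move=> k; apply: contrapT => /forallNP nle.
pose D := fine (distr g (2 ^ k)).
have DE : distr g (2 ^ k) = D%:E by rewrite /D fineK // ge0_fin_numE ?distr_ge0.
have D0 : 0 <= D by rewrite -lee_fin -DE distr_ge0.
have lt n : (distr (gn n) (2 ^ (k - n%:Z - 1)) <= (D / 2 / (2 ^ n.+1)%:R)%:E)%E.
  have := nle n => /negP; rewrite -ltNge => h.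
  have fi := distr_fin (k - n%:Z - 1) (gnB n).
  rewrite -(fineK fi) lee_fin.
  move: h; rewrite /dyadic -/D split2.
  set d := fine _; have d0 : 0 <= d by rewrite fine_ge0 // distr_ge0.
  have e4 : 4 ^+ n * 2^-1 ^+ n = 2 ^+ n :> R.
    by rewrite (_ : 4 = 2 * 2 :> R) ?exprMn -?mulrA -?exprMn ?divff ?expr1n ?mulr1 // -natrM.
  have -> : 8 * 4 ^+ n * (2 ^ k * 2^-1 ^+ n.+1 * d `^ p^-1) =
           2 ^ k * ((4 * 2 ^+ n) * d `^ p^-1).
    by rewrite -e4 exprS; field.
  rewrite ltr_pM2l ?exprz_gt0 // => h.
  have : ((4 * 2 ^+ n) * d `^ p^-1) `^ p <= (D `^ p^-1) `^ p.
    by rewrite ge0_ler_powR ?nnegrE ?mulr_ge0 ?exprn_ge0 ?powR_ge0 // ltW.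
  rewrite powRM ?mulr_ge0 ?exprn_ge0 ?powR_ge0 // -!powRrM mulVf ?gt_eqF // !powRr1 //.
  move=> h2; rewrite natrX -mulrA -invfM -exprS ler_pdivlMr ?exprn_gt0 // mulrC.
  apply: le_trans h2; rewrite ler_wpM2r // (_ : 2 ^+ n.+2 = 4 * 2 ^+ n); last by rewrite !exprS; ring.
  rewrite le1r_powR ?(ltW p1) //; rewrite (le_trans (y := 4 * 1)) ?ler1n ?mulr1 ?ler1n //.
  by rewrite ler_peMr // exprn_ege1 ?ler1n.
have : (distr g (2 ^ k) <= (D / 2)%:E)%E.
  apply: (le_trans (sub k)); apply: le_trans (@epsilon_trick0 _ (D / 2) predT _); last first.
    by rewrite divr_ge0.
  by apply: lee_nneseries => // n _ _; exact: distr_ge0.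
rewrite DE lee_fin => D2; have Dz : D = 0 by lra.
have := nle 0%N => /negP; rewrite -ltNge /dyadic -/D Dz powR0 ?mulr0; last first.
  by rewrite invr_neq0 // gt_eqF.
by apply/negP; rewrite -leNgt mulr_ge0 ?mulr_ge0 // ?exprz_ge0 ?powR_ge0 ?exprn_ge0.
Qed.

End Profiles.

(** * Integrals over the half-line by dyadic blocks *)

Section DyadicIntegration.
Variable R : realType.
Local Notation leb := (@lebesgue_measure R).

Definition dyadic_block (k : int) : set R := `[2 ^ k, 2 ^ (k + 1)[%classic.

Lemma measurable_dyadic_block k : measurable (dyadic_block k).
Proof. exact: measurable_itv. Qed.

Lemma dyadic_block_gt0 k (t : R) : dyadic_block k t -> 0 < t.
Proof.
by rewrite /dyadic_block /= in_itv /= => /andP[+ _]; apply: lt_le_trans; rewrite exprz_gt0.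
Qed.

Lemma lebesgue_dyadic_block k : leb (dyadic_block k) = (2 ^ k)%:E.
Proof.
rewrite /dyadic_block lebesgue_measure_itv /= lte_fin ltr_eXz2l ?ltr1n // ltrDl ltr01.
by rewrite -EFinB expfzDr // expr1z mulrDr mulr1 addrK.
Qed.

Lemma dyadic_block_inj (j k : int) t : dyadic_block j t -> dyadic_block k t -> j = k.
Proof.
rewrite /dyadic_block /= !in_itv /= => /andP[a1 a2] /andP[b1 b2].
have := le_lt_trans a1 b2; have := le_lt_trans b1 a2.
rewrite !ltr_eXz2l ?ltr1n //; lia.
Qed.

Lemma trivIset_dyadic_block (J : set int) : trivIset J dyadic_block.
Proof. by move=> j k _ _ [t [jt kt]]; exact: dyadic_block_inj jt kt. Qed.

(** Superlevel sets of an antitone function are intervals. *)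
Lemma antitone_measurable (D : R -> \bar R) : (forall s t, s <= t -> (D t <= D s)%E) ->
  measurable_fun [set: R] D.
Proof.
move=> aD; apply: (measurability _ (ErealGenOInfty.measurableE R)).
move=> _ [_ [y ->] <-]; rewrite setTI; apply: is_interval_measurable.
move=> a b /= _ yb t /andP[_ tb].
move: yb; rewrite !in_itv /= !andbT => yb; exact: lt_le_trans yb (aD _ _ tb).
Qed.

Variable F : R -> \bar R.
Hypothesis mF : measurable_fun [set t : R | 0 < t] F.
Hypothesis F0 : forall t, 0 < t -> (0 <= F t)%E.
Local Notation pos := [set t : R | 0 < t].

Let mpos : measurable pos.
Proof.
by apply: is_interval_measurable => a b /= a0 _ t /andP[ta _]; exact: lt_le_trans ta.
Qed.

Let mFb k : measurable_fun (dyadic_block k) F.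
Proof.
by apply: measurable_funS mF => // t; exact: dyadic_block_gt0.
Qed.

Lemma integral_dyadic_le (c : int -> R) B : 
  (forall k t, 2 ^ k <= t < 2 ^ (k + 1) -> (F t <= (c k / 2 ^ k)%:E)%E) ->
  (forall J, uniq J -> \sum_(k <- J) c k <= B) ->
  (\int[leb]_(t in pos) F t <= B%:E)%E.
Proof.
(* The blocks are indexed by [int] but countable unions by [nat]; numbers that encode no integer
   receive the empty block. *)
move=> Fc cB; pose G n := if pickle_inv n is Some k then dyadic_block k else set0.
have GE : pos = \bigcup_n G n.
  apply/seteqP; split => [t t0|t [n _]].
    have [k kt] := floor_expz t0.
    by exists (pickle k) => //; rewrite /G pickleK_inv /dyadic_block /= in_itv.
  by rewrite /G; case: pickle_inv => // k; exact: dyadic_block_gt0.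
have mG n : measurable (G n).
  by rewrite /G; case: pickle_inv => // k; exact: measurable_dyadic_block.
have Gpos n t : G n t -> 0 < t.
  by rewrite /G; case: pickle_inv => // k; exact: dyadic_block_gt0.
rewrite GE ge0_integral_bigcup //; last 3 first.
- by rewrite -GE.
- by move=> t; rewrite -GE; exact: F0.
- move=> m n _ _ [t []]; rewrite /G.
  case Em : (pickle_inv m) => [j|//]; case En : (pickle_inv n) => [k|//].
  move=> jt kt; have jk := dyadic_block_inj jt kt.
  have := pickle_invK (T := int) m; have := pickle_invK (T := int) n.
  by rewrite Em En /= jk => -> ->.
apply: lime_le.
  by apply: is_cvg_nneseries => n _ _; apply: integral_ge0 => t /Gpos; exact: F0.
apply: nearW => N.
apply: (@le_trans _ _ (\sum_(k <- pmap (@pickle_inv int) (iota 0 N)) c k)%:E); last first.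
  rewrite lee_fin; apply: cB; apply: pmap_uniq (iota_uniq _ _).
  exact: pickle_invK.
rewrite -sumEFin /index_iota subn0; elim: (iota 0 N) => [|n s IH].
  by rewrite !big_nil.
rewrite big_cons /=; rewrite {1}/G; case: (pickle_inv n) => [k|] /=; last first.
  by rewrite integral_set0 add0e.
rewrite big_cons leeD // {IH}.
apply: (@le_trans _ _ (\int[leb]_(t in dyadic_block k) (cst (c k / 2 ^ k)%:E) t)%E).
  apply: ge0_le_integral => //.
  - exact: measurable_dyadic_block.
  - by move=> t /dyadic_block_gt0; exact: F0.
  - exact: mFb.
  - by move=> t; rewrite /dyadic_block /= in_itv; exact: Fc.
rewrite integral_cst; last exact: measurable_dyadic_block.
rewrite [X in (_ * X)%E](lebesgue_dyadic_block k) -EFinM divfK //.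
by rewrite expfz_neq0.
Qed.

(** The values are extended reals because this bound is what proves the distribution function
    finite. *)
Lemma integral_dyadic_ge_ereal (c : int -> \bar R) (J : seq int) : uniq J ->
  (forall k, 0 <= c k)%E ->
  (forall k t, 2 ^ k <= t < 2 ^ (k + 1) -> (c k <= F t)%E) ->
  (\sum_(k <- J) c k * (2 ^ k)%:E <= \int[leb]_(t in pos) F t)%E.
Proof.
move=> uJ c0 Fc.
apply: (@le_trans _ _ (\int[leb]_(t in \big[setU/set0]_(k <- J) dyadic_block k) F t)%E).
  have JP t : (\big[setU/set0]_(k <- J) dyadic_block k) t -> 0 < t.
    by rewrite -bigcup_seq => -[k _]; exact: dyadic_block_gt0.
  have mJ : measurable_fun (\big[setU/set0]_(k <- J) dyadic_block k) F.
    exact: measurable_funS mF.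
  rewrite (ge0_integral_bigsetU leb measurable_dyadic_block uJ) //; last 2 first.
  - exact: trivIset_dyadic_block.
  - by move=> t /JP; exact: F0.
  apply: lee_sum => k _.
  have := integral_cst leb (measurable_dyadic_block k) (c k).
  rewrite [X in (_ * X)%E](lebesgue_dyadic_block k) => <-.
  apply: ge0_le_integral => //.
  - exact: measurable_dyadic_block.
  - by move=> t _; exact: c0.
  - exact: mFb.
  - by move=> t; rewrite /dyadic_block /= in_itv; exact: Fc.
apply: ge0_subset_integral => //.
  by apply: bigsetU_measurable => k _; exact: measurable_dyadic_block.
by move=> t; rewrite -bigcup_seq => -[k _]; exact: dyadic_block_gt0.
Qed.

End DyadicIntegration.

Section LorentzEquivalence.
Variables (R : realType) (M : mms R) (p : R).
Hypothesis p1 : 1 < p.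
Local Notation X := (mms_T M).
Implicit Types (g : X -> \bar R) (f : X -> R) (u v B : R).
Let p0 : 0 < p. Proof. exact: lt_trans p1. Qed.
Let pi0 : 0 <= p^-1. Proof. by rewrite invr_ge0 ltW. Qed.

Let integrand q g (t : R) : \bar R :=
  ((t%:E * distr g t `^ p^-1) `^ q * (t^-1)%:E)%E.

Let integrand_ge0 q g t : 0 < t -> (0 <= integrand q g t)%E.
Proof. by move=> t0; rewrite mule_ge0 ?poweR_ge0 // lee_fin invr_ge0 ltW. Qed.

Let measurable_integrand q g : measurable_fun [set t : R | 0 < t] (integrand q g).
Proof.
apply: emeasurable_funM.
  apply: (measurableT_comp (measurable_poweR q)); apply: emeasurable_funM.
    by apply/measurable_EFinP; exact: measurable_id.
  apply: (measurableT_comp (measurable_poweR p^-1)).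
  apply: measurable_funTS; apply: antitone_measurable => s t; exact: le_distr.
apply/measurable_EFinP; apply: (eq_measurable_fun (fun t : R => t `^ (- 1))).
  by move=> t; rewrite inE /= => t0; rewrite powR_inv1 // ltW.
by apply: measurable_funTS; exact: measurable_powR.
Qed.

Lemma lorentz_le_of_lor u g B : 0 <= u -> lor p u g B ->
  (lorentz p (exp_of_inv u) g <= (2 * p `^ u * B)%:E)%E.
Proof.
move=> u0 gB; have B0 := lor_ge0 gB; case: (gB) => gf [gB1 gB2].
have bd k (t : R) : 2 ^ k <= t < 2 ^ (k + 1) ->
    (t%:E * distr g t `^ p^-1 <= (2 * dyadic p g k)%:E)%E.
  move=> /andP[t1 t2]; have t0 : 0 < t by apply: lt_le_trans t1; rewrite exprz_gt0.
  have gk := distr_fin k gB.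
  have le := le_distr g t1.
  have gt : distr g t \is a fin_num.
    by rewrite ge0_fin_numE ?distr_ge0 // (le_lt_trans le) // gf.
  rewrite -(fineK gt) poweR_EFin -EFinM lee_fin /dyadic mulrA ler_pM ?powR_ge0 ?(ltW t0) //.
    by move: t2; rewrite expfzDr // expr1z mulrC => /ltW.
  by rewrite ge0_ler_powR ?nnegrE ?fine_ge0 ?distr_ge0 ?fine_le.
rewrite /exp_of_inv; case: eqVneq => [->|un].
  rewrite powRr0 mulr1 /=; apply: ge_ereal_sup => _ [t /= t0 <-].
  have [k kt] := floor_expz t0; apply: (le_trans (bd _ _ kt)).
  by rewrite lee_fin ler_wpM2l //; have /andP[] := gB1 k.
have up : 0 < u by rewrite lt_neqAle eq_sym un.
rewrite /= invrK mulrAC mulrC EFinM lee_pmul2l ?lte_fin ?powR_gt0 //.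
set I := (\int[_]_(t in _) _)%E.
have I0 : (0 <= I)%E by apply: integral_ge0 => t t0; exact: integrand_ge0.
have IB : (I <= ((2 * B) `^ u^-1)%:E)%E.
  apply: (@integral_dyadic_le R (integrand u^-1 g) _ _ (fun k => (2 * dyadic p g k) `^ u^-1)).
  - exact: measurable_integrand.
  - exact: integrand_ge0.
  - move=> k t kt; have := bd _ _ kt; have /andP[t1 t2] := kt.
    have t0 : 0 < t by apply: lt_le_trans t1; rewrite exprz_gt0.
    move=> h; rewrite /integrand EFinM lee_pmul ?poweR_ge0 ?lee_fin ?invr_ge0 ?(ltW t0) //.
      rewrite -poweR_EFin gt0_ler_poweR ?invr_ge0 ?(ltW up) ?in_itv /= ?leey ?andbT //.
        by rewrite mule_ge0 ?poweR_ge0 // lee_fin ltW.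
      by rewrite lee_fin mulr_ge0 ?dyadic_ge0.
    by rewrite lef_pV2 ?posrE ?exprz_gt0.
  - move=> J uJ; under eq_bigr do rewrite powRM ?dyadic_ge0 //.
    by rewrite -mulr_sumr powRM // ler_wpM2l ?powR_ge0 // gB2.
apply: (@le_trans _ _ (((2 * B) `^ u^-1)%:E `^ u)%E).
  by rewrite gt0_ler_poweR ?in_itv /= ?leey ?andbT ?lee_fin ?powR_ge0.
by rewrite poweR_EFin -powRrM mulVf // powRr1 ?mulr_ge0.
Qed.

(** On the block of 2^k the distribution is at least its value at 2^(k+1). This shift by one index
    costs a factor 2; bounding 1/t by its value at the right end of the block accounts for the other
    factor 2. *)
Lemma lor_of_lorentz_le u g B : 0 <= u <= 1 -> 0 <= B ->
  (lorentz p (exp_of_inv u) g <= B%:E)%E -> lor p u g (4 * B).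
Proof.
move=> /andP[u0 u1] B0; rewrite /exp_of_inv; case: eqVneq => [->|un] /=.
  move=> /ereal_supP h.
  have hk k : ((2 ^ k)%:E * distr g (2 ^ k) `^ p^-1 <= B%:E)%E.
    by apply: h; exists (2 ^ k) => //=; rewrite exprz_gt0.
  have gf k : (distr g (2 ^ k) < +oo)%E.
    rewrite ltNge leye_eq; apply/negP => /eqP E.
    have := hk k; rewrite E poweRyr ?invr_neq0 ?gt_eqF //.
    by rewrite gt0_muley ?lte_fin ?exprz_gt0 // leNgt ltry.
  split=> //; split=> [k|]; last by rewrite ltxx.
  rewrite dyadic_ge0 /=; apply: (@le_trans _ _ B); last by rewrite ler_peMl // ler1n.
  have := hk k; rewrite -[distr _ _]fineK; last by rewrite ge0_fin_numE ?distr_ge0.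
  by rewrite poweR_EFin -EFinM lee_fin.
have up : 0 < u by rewrite lt_neqAle eq_sym un.
rewrite invrK; set I := (\int[_]_(t in _) _)%E => hI.
have I0 : (0 <= I)%E by apply: integral_ge0 => t t0; exact: integrand_ge0.
have ui : 0 < u^-1 by rewrite invr_gt0.
have u1i : 1 <= u^-1 by rewrite invf_ge1.
have IB : (I <= (B `^ u^-1)%:E)%E.
  have : (I `^ u <= B%:E)%E.
    apply: le_trans hI; rewrite -[leLHS]mul1e lee_wpmul2r ?poweR_ge0 // lee_fin.
    by rewrite powR_ge1 // ltW.
  move=> h; have : ((I `^ u) `^ u^-1 <= B%:E `^ u^-1)%E.
    by rewrite gt0_ler_poweR ?(ltW ui) ?in_itv /= ?leey ?andbT ?poweR_ge0 ?lee_fin.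
  by rewrite poweR_EFin -poweRrM divff // poweRe1.
pose c k : \bar R := (((2 ^ k)%:E * distr g (2 ^ (k + 1)) `^ p^-1) `^ u^-1 *
  ((2 ^ (k + 1))^-1)%:E)%E.
have c0 k : (0 <= c k)%E by rewrite mule_ge0 ?poweR_ge0 // lee_fin invr_ge0 exprz_ge0.
have cF k t : 2 ^ k <= t < 2 ^ (k + 1) -> (c k <= integrand u^-1 g t)%E.
  move=> /andP[t1 t2]; have t0 : 0 < t by apply: lt_le_trans t1; rewrite exprz_gt0.
  have D : (distr g (2 ^ (k + 1)) <= distr g t)%E by apply: le_distr; exact: ltW.
  rewrite /c /integrand lee_pmul ?poweR_ge0 ?lee_fin ?invr_ge0 ?exprz_ge0 //; last first.
    by rewrite lef_pV2 ?posrE ?exprz_gt0 // ltW.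
  have h1 : (0 <= (2 ^ k)%:E * distr g (2 ^ (k + 1)) `^ p^-1)%E.
    by rewrite mule_ge0 ?poweR_ge0 // lee_fin exprz_ge0.
  have h2 : (0 <= t%:E * distr g t `^ p^-1)%E by rewrite mule_ge0 ?poweR_ge0 // lee_fin ltW.
  rewrite gt0_ler_poweR ?(ltW ui) ?in_itv /= ?leey ?andbT ?h1 ?h2 //.
  rewrite lee_pmul ?poweR_ge0 ?lee_fin ?exprz_ge0 //.
  by rewrite gt0_ler_poweR ?in_itv /= ?leey ?andbT ?distr_ge0.
have cI J : uniq J -> (\sum_(k <- J) c k * (2 ^ k)%:E <= (B `^ u^-1)%:E)%E.
  move=> uJ; apply: le_trans IB; apply: integral_dyadic_ge_ereal => //.
    exact: measurable_integrand.
  exact: integrand_ge0.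
have gf k : (distr g (2 ^ k) < +oo)%E.
  rewrite ltNge leye_eq; apply/negP => /eqP E.
  have := cI [:: k - 1] isT; rewrite big_seq1 /c subrK E poweRyr ?invr_neq0 ?gt_eqF //.
  rewrite gt0_muley ?lte_fin ?exprz_gt0 // poweRyr ?gt_eqF //.
  rewrite gt0_mulye ?lte_fin ?invr_gt0 ?exprz_gt0 // gt0_mulye ?lte_fin ?exprz_gt0 //.
split=> //; apply: lq_sum => //.
- by rewrite mulr_ge0.
- by move=> k; exact: dyadic_ge0.
move=> J uJ; have uJ' : uniq (map (fun k => k - 1) J) by rewrite map_inj_uniq //; exact: addIr.
have := cI _ uJ'; rewrite big_map.
have cE k : (c (k - 1)%R * (2 ^ (k - 1))%:E = ((dyadic p g k / 2) `^ u^-1 / 2)%:E)%E.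
  rewrite /c subrK -[distr _ _]fineK; last by rewrite ge0_fin_numE ?distr_ge0.
  rewrite poweR_EFin -EFinM; congr EFin.
  have k2 : 2 ^ (k - 1) = 2 ^ k / 2 :> R by rewrite expfzDr.
  rewrite k2 -[LHS]mulrA (_ : (2 ^ k)^-1 * (2 ^ k / 2) = 2^-1); last first.
    by rewrite mulrA mulVf ?mul1r // expfz_neq0.
  by congr (_ `^ _ / 2); rewrite /dyadic mulrAC.
under eq_bigr do rewrite cE.
rewrite sumEFin lee_fin -mulr_suml ler_pdivrMr // => h.
have e2 k : dyadic p g k `^ u^-1 = (dyadic p g k / 2) `^ u^-1 * 2 `^ u^-1.
  by rewrite -powRM ?divr_ge0 ?dyadic_ge0 // divfK.
under eq_bigr do rewrite e2.
rewrite -mulr_suml (_ : 4 * B = B * 2 * 2); last by ring.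
rewrite !powRM ?mulr_ge0 // ler_wpM2r ?powR_ge0 // (le_trans h) // ler_wpM2l ?powR_ge0 //.
by rewrite le1r_powR ?ler1n.
Qed.

Lemma lorentz_ge0 q g : (0 <= lorentz p q g)%E.
Proof.
case: q => [q| |] //=; first by rewrite mule_ge0 ?poweR_ge0 // lee_fin powR_ge0.
apply: (@le_trans _ _ (1%:E * distr g 1 `^ p^-1)%E).
  by rewrite mule_ge0 ?poweR_ge0.
by apply: ereal_sup_ubound; exists 1 => //=; rewrite ltr01.
Qed.

(** Boundedness of the maximal operator from the exponent [1/u] to the exponent
    [1/v], in terms of the dyadic quasinorms; quantifying over all bounds [B > 0]
    makes the condition homogeneous without ever scaling a function. *)
Definition lor_bounded u v := exists2 C : R, 0 < C &
  forall f, measurable_fun setT f -> forall B, 0 < B ->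
    lor p u (EFin \o f) B -> lor p v (maxfun f) (C * B).

Lemma hl_boundedP u v : 0 <= u <= 1 -> 0 <= v <= 1 ->
  hl_bounded M p (exp_of_inv u) (exp_of_inv v) <-> lor_bounded u v.
Proof.
move=> u01 v01; have /andP[u0 _] := u01; have /andP[v0 _] := v01.
split=> [[C hC]|[C C0 hC]].
  pose C' := Num.max C 1 * (2 * p `^ u).
  have m1 : 0 < Num.max C 1 by rewrite lt_max ltr01 orbT.
  have cp : 0 < 2 * p `^ u by rewrite mulr_gt0 // powR_gt0.
  exists (4 * C'); first by rewrite mulr_gt0 // mulr_gt0.
  move=> f mf B B0 fB; rewrite -mulrA; apply: lor_of_lorentz_le => //.
    by rewrite /C' !mulr_ge0 ?(ltW B0) ?powR_ge0 // ltW.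
  have le := lorentz_le_of_lor u0 fB.
  have lf : (lorentz p (exp_of_inv u) (fun x => (f x)%:E) < +oo)%E.
    by apply: (le_lt_trans le); rewrite ltry.
  apply: (le_trans (hC f mf lf)).
  have l0 := lorentz_ge0 (exp_of_inv u) (fun x => (f x)%:E).
  apply: (@le_trans _ _ ((Num.max C 1)%:E * lorentz p (exp_of_inv u) (fun x => (f x)%:E))%E).
    by rewrite lee_wpmul2r // lee_fin le_max lexx.
  rewrite /C' -mulrA EFinM lee_wpmul2l // lee_fin ltW //.
pose C' := 2 * p `^ v * (C * 4).
have C'0 : 0 < C' by rewrite !mulr_gt0 // powR_gt0.
exists C' => f mf.
set l := lorentz p (exp_of_inv u) _ => lf.
have l0 : (0 <= l)%E by exact: lorentz_ge0.
have lE : l = (fine l)%:E by rewrite fineK // ge0_fin_numE.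
rewrite lE -EFinM.
(* The quasinorm of f may vanish while [lor_bounded] asks for B > 0; so B exceeds it by e / C' with
   e arbitrary. *)
apply/lee_addgt0Pr => e e0.
have B0 : 0 < fine l + e / C' by rewrite ltr_wpDl ?fine_ge0 // divr_gt0.
have lB : (l <= (fine l + e / C')%:E)%E by rewrite lE lee_fin lerDl divr_ge0 // ltW.
have := hC f mf _ _ (lor_of_lorentz_le u01 (ltW B0) lB).
rewrite mulr_gt0 // => /(_ isT) /(lorentz_le_of_lor v0) /le_trans; apply.
rewrite -EFinD lee_fin (_ : 2 * _ * _ = C' * (fine l + e / C')); last by rewrite /C'; ring.
by rewrite mulrDr mulrCA divff ?mulr1 // gt_eqF.
Qed.

End LorentzEquivalence.

(** * Centered maximal function and interpolation *)

Section MaximalFunction.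
Variables (R : realType) (M : mms R).
Local Notation X := (mms_T M).
Local Notation mu := (mms_mu M).
Local Notation rho := (@mms_rho R M).
Implicit Types (f : X -> R).

Lemma oball_open x s : rho_open rho (oball rho x s).
Proof.
case: (mms_metric M) => rho0 rhoI rhoC rhoT y /= xy.
exists (s - rho x y); first by rewrite subr_gt0.
move=> z /= yz; apply: le_lt_trans (rhoT x y z) _.
by rewrite -ltrBrDl.
Qed.

Lemma rho_open_measurable (A : set X) : rho_open rho A -> measurable A.
Proof. by move=> oA; apply/mms_borel; exact: sub_gen_smallest. Qed.

Lemma oball_measurable x s : measurable (oball rho x s).
Proof. exact/rho_open_measurable/oball_open. Qed.

Lemma maxfun_ge0 f x : (0 <= maxfun f x)%E.
Proof. by apply: ereal_sup_ubound; left. Qed.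

Lemma maxfun_abs f x : `|maxfun f x|%E = maxfun f x.
Proof. by rewrite gee0_abs ?maxfun_ge0. Qed.

Lemma maxfun_leP f x (t : R) : 0 <= t ->
  (forall s, 0 < s -> (0 < mu (oball rho x s) < +oo)%E ->
    (\int[mu]_(y in oball rho x s) (`|f y|)%:E <= t%:E * mu (oball rho x s))%E) ->
  (maxfun f x <= t%:E)%E.
Proof.
move=> t0 h; apply: ge_ereal_sup => _ [->|[s [s0 ms] <-]]; first by rewrite lee_fin.
have := h s s0 ms; have /andP[m0 moo] := ms.
have fi : mu (oball rho x s) \is a fin_num by rewrite ge0_fin_numE // ltW.
rewrite -[X in (_ <= _ * X)%E](fineK fi) => {}h.
have f0 : 0 < fine (mu (oball rho x s)) by rewrite fine_gt0 // m0.
by rewrite muleC lee_pdivrMr.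
Qed.

Lemma maxfun_ge_avg f x s : 0 < s -> (0 < mu (oball rho x s) < +oo)%E ->
  ((fine (mu (oball rho x s)))^-1%:E *
     \int[mu]_(y in oball rho x s) (`|f y|)%:E <= maxfun f x)%E.
Proof. by move=> s0 ms; apply: ereal_sup_ubound; right; exists s. Qed.

Let measurable_abs f D : measurable_fun setT f ->
  measurable_fun D (fun y => (`|f y|)%:E).
Proof.
move=> mf; apply: measurable_funTS; apply/measurable_EFinP.
exact: measurableT_comp.
Qed.

(** Domination is asked almost everywhere only, because the pieces used for interpolation miss a
    null set. *)
Lemma maxfun_le_nneseries f (fn : nat -> X -> R) x :
  measurable_fun setT f -> (forall n, measurable_fun setT (fn n)) ->
  (\forall y \ae mu, (`|f y|%:E <= \sum_(n <oo) `|fn n y|%:E)%E) ->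
  (maxfun f x <= \sum_(n <oo) maxfun (fn n) x)%E.
Proof.
move=> mf mfn le.
have s0 : (0 <= \sum_(n <oo) maxfun (fn n) x)%E.
  by apply: nneseries_ge0 => n _ _; exact: maxfun_ge0.
apply: ge_ereal_sup => _ [->//|[s [sp ms] <-]].
have mB := oball_measurable x s.
have H : (\int[mu]_(y in oball rho x s) (`|f y|)%:E <=
    \sum_(n <oo) \int[mu]_(y in oball rho x s) (`|fn n y|)%:E)%E.
  rewrite -integral_nneseries //; last first.
    by move=> n; exact: measurable_abs.
  apply: ae_ge0_le_integral => //.
  - exact: measurable_abs.
  - by move=> y _; apply: nneseries_ge0.
  - apply: ge0_emeasurable_sum => [n y _ _ //|n _]; exact: measurable_abs.
  - by apply: filterS le => y + _; apply.
have m0 : 0 <= (fine (mu (oball rho x s)))^-1 by rewrite invr_ge0 fine_ge0.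
apply: (le_trans (lee_wpmul2l _ H)); first by rewrite lee_fin.
rewrite -nneseriesZl; last by move=> n _; exact: integral_ge0.
apply: lee_nneseries => n _.
  by move=> _; rewrite mule_ge0 ?lee_fin //; exact: integral_ge0.
exact: maxfun_ge_avg.
Qed.

End MaximalFunction.

Lemma finite_enum (R : realType) (T : choiceType) (E : set T) (m : R) :
  (forall J : seq T, uniq J -> (forall k, k \in J -> E k) -> (size J)%:R <= m) ->
  exists2 J : seq T, uniq J & forall k, k \in J <-> E k.
Proof.
move=> Em; have [|iE] := pselect (finite_set E).
  move=> /finite_seqP[s Es]; exists (undup s); first exact: undup_uniq.
  by move=> k; rewrite mem_undup Es.
have [B BE sB] := infinite_set_fset (Num.truncn m).+1 iE.
have := Em (finmap.enum_fset B) (finmap.fset_uniq B) (fun k kB => BE k kB).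
move=> /le_lt_trans /(_ (truncnS_gt m)); rewrite ltr_nat => h.
by have := leq_trans h sB; rewrite ltnn.
Qed.

Section Interpolation.
Variables (R : realType) (M : mms R) (p : R).
Hypothesis p1 : 1 < p.
Local Notation X := (mms_T M).
Local Notation mu := (mms_mu M).
Local Notation lor_bounded := (lor_bounded M p).
Implicit Types (f : X -> R) (u v : R).
Let p0 : 0 < p. Proof. exact: lt_trans p1. Qed.

Lemma lor_bounded_mono u v u' v' : 0 <= u -> u <= u' -> 0 <= v' -> v' <= v ->
  lor_bounded u v -> lor_bounded u' v'.
Proof.
move=> u0 uu v0 vv [C C0 hC]; exists C => // f mf B B0 fB.
exact: (lor_embed v0 vv (hC f mf B B0 (lor_embed u0 uu fB))).
Qed.

Lemma geometric_level (r x : R) : 2 <= r -> 0 < x <= 1 ->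
  exists n : nat, r^-1 ^+ n.+1 < x <= r^-1 ^+ n.
Proof.
move=> r2 /andP[x0 x1]; have r0 : 0 < r by apply: lt_le_trans r2.
have ex : exists n, r^-1 ^+ n < x.
  exists (Num.truncn x^-1).+1; rewrite exprVn -[ltRHS]invrK ltf_pV2 ?posrE ?exprn_gt0 ?invr_gt0 //.
  apply: (lt_trans (truncnS_gt _)).
  apply: (@lt_le_trans _ _ (2 ^+ (Num.truncn x^-1).+1)).
    by rewrite -natrX ltr_nat ltn_expl.
  by rewrite lerXn2r ?nnegrE // ltW.
case: (ex_minnP ex) => -[|n] nx nmin; first by move: nx; rewrite expr0 ltNge x1.
exists n; rewrite nx /= leNgt; apply/negP => /nmin; by rewrite ltnn.
Qed.

Lemma geometric_mean_mul (c0 c1 h T t u0 u1 : R) : 0 <= c0 -> 0 <= c1 -> 0 <= h -> 0 < T ->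
  (c0 * (8 * h * T `^ u0)) `^ (1 - t) * (c1 * (8 * h * T `^ u1)) `^ t =
  (c0 * 8) `^ (1 - t) * (c1 * 8) `^ t * (h * T `^ ((1 - t) * u0 + t * u1)).
Proof.
move=> c00 c10 h0 T0; rewrite !mulrA.
rewrite !(@powRM _ (_ * _ * h)) ?(@powRM _ (_ * 8)) ?mulr_ge0 ?powR_ge0 //.
rewrite -![(T `^ _) `^ _]powRrM.
have -> : (1 - t) * u0 + t * u1 = u0 * (1 - t) + u1 * t by ring.
rewrite [T `^ (_ + _)]powRD; last by apply/implyP => _; rewrite gt_eqF.
have {3}-> : h = h `^ (1 - t) * h `^ t.
  by rewrite -powRD ?subrK ?powRr1 // oner_eq0.
ring.
Qed.

(** Piece [fn n] collects the dyadic layers of f whose term a_k lies near h n = r^-n * B. The source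
    bound allows at most T n such layers, so the piece has norm about h n * (T n)^s for all
    exponents s at once, and both hypotheses apply to it. Interpolating the two results gives h n *
    (T n)^ut, which decays in n because ut < u. *)
Lemma lor_bounded_interp u0 v0 u1 v1 (t u : R) :
  0 <= u0 <= 1 -> 0 <= u1 <= 1 -> 0 <= v0 <= 1 -> 0 <= v1 <= 1 -> 0 <= t <= 1 ->
  (1 - t) * u0 + t * u1 < u -> u <= 1 ->
  lor_bounded u0 v0 -> lor_bounded u1 v1 -> lor_bounded u ((1 - t) * v0 + t * v1).
Proof.
set ut := (1 - t) * u0 + t * u1; set vt := (1 - t) * v0 + t * v1.
move=> u0u u1u v01 v11 t01 utu ule [C0 C0p hC0] [C1 C1p hC1].
have /andP[u00 _] := u0u; have /andP[u10 _] := u1u.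
have ut0 : 0 <= ut by have /andP[a b] := t01; rewrite addr_ge0 ?mulr_ge0 ?subr_ge0.
have vt01 : 0 <= vt <= 1.
  have /andP[a b] := t01; have /andP[a0 b0] := v01; have /andP[a1 b1] := v11.
  rewrite addr_ge0 ?mulr_ge0 ?subr_ge0 //= /vt -[leRHS](subrK t) lerD //.
    by rewrite ler_piMr ?subr_ge0.
  by rewrite ler_piMr.
have up : 0 < u by apply: le_lt_trans utu.
have ui : 0 <= u^-1 by rewrite invr_ge0 ltW.
pose c := 1 - ut / u.
have c0 : 0 < c by rewrite subr_gt0 ltr_pdivrMr // mul1r.
have c1 : c <= 1 by rewrite gerBl divr_ge0 // ltW.
(* The interpolated norm of piece n is of order r^(-c n); this [r] makes it the 8^-n required by
   [lor_superpose]. *)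
pose r := (8 : R) `^ c^-1.
have r8 : 8 <= r by rewrite le1r_powR ?ler1n // invf_ge1.
have rp : 0 < r by apply: lt_le_trans r8.
have r2 : 2 <= r by apply: le_trans r8; rewrite ler_nat.
have rc : r `^ c = 8 by rewrite /r -powRrM mulVf ?powRr1 // gt_eqF.
pose T n := r `^ (n.+1%:R / u).
have T1 n : 1 <= T n.
  by rewrite powR_ge1 ?mulr_ge0 // (le_trans _ r2) // ler1n.
exists (16 * (2 * ((C0 * 8) `^ (1 - t) * (C1 * 8) `^ t * r `^ (ut / u)))).
  by rewrite !mulr_gt0 ?powR_gt0 // mulr_gt0.
move=> f mf B B0 fB.
pose a k := dyadic p (EFin \o f) k.
pose h n := r^-1 ^+ n * B.
have h0 n : 0 < h n by rewrite mulr_gt0 // exprn_gt0 // invr_gt0.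
have aB k : 0 <= a k <= B by case: fB => _ [+ _]; exact.
have sz n (J : seq int) : uniq J -> (forall k, k \in J -> h n.+1 < a k <= h n) ->
    (size J)%:R <= T n.
  move=> uJ JE; have := fB.2.2 up J uJ.
  have : (size J)%:R * (h n.+1) `^ u^-1 <= \sum_(k <- J) a k `^ u^-1.
    rewrite -[X in X%:R]count_predT mulr_natl.
    rewrite -iter_addr_0 -big_const_seq big_seq [leRHS]big_seq; apply: ler_sum => k kJ.
    rewrite ge0_ler_powR ?nnegrE ?(ltW (h0 _)) //; first by have /andP[] := aB k.
    by have /andP[/ltW] := JE _ kJ.
  move=> /le_trans /[apply].
  rewrite /h powRM ?exprn_ge0 ?invr_ge0 ?(ltW rp) ?(ltW B0) // mulrA.
  rewrite ger_pMl ?powR_gt0 // exprVn -powR_mulrn ?(ltW rp) // -powRN -powRrM mulNr powRN.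
  by rewrite ler_pdivrMr ?powR_gt0 // mul1r.
have [K HK] : exists K : nat -> seq int, forall n, uniq (K n) /\
    forall k, k \in K n <-> h n.+1 < a k <= h n.
  have HE n : exists J : seq int, uniq J /\ forall k, k \in J <-> h n.+1 < a k <= h n.
    have [|J uJ JE] := @finite_enum R _ [set k | h n.+1 < a k <= h n] (T n); last by exists J.
    exact: sz.
  by have [K HK] := choice HE; exists K.
pose inK n x := has (fun k => 2 ^ k < `|f x| <= 2 ^ (k + 1)) (K n).
pose fn n x := if inK n x then f x else 0.
have mfn n : measurable_fun setT (fn n).
  apply: measurable_fun_ifT => //; rewrite /inK.
  elim: (K n) => [|k s IH] /=; first exact: measurable_cst.
  apply: measurable_or => //; apply: measurable_and.
    by apply: measurable_fun_ltr => //; exact: measurableT_comp.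
  by apply: measurable_fun_ler => //; exact: measurableT_comp.
have fnB n s : 0 <= s <= 1 -> lor p s (EFin \o fn n) (8 * h n * T n `^ s).
  move=> s01.
  have -> : 8 * h n = 4 * (h n * 2) by ring.
  have [uK KE] := HK n.
  (* Profiles have heights x / 2^e, so layer k enters as e = -k. *)
  apply: (@profile_upper _ _ _ p1 (map -%R (K n)) (fun e => [set x | (2 ^ (- e))%:E < `|(f x)%:E|]%E)) => //.
  - by rewrite map_inj_uniq //; exact: oppr_inj.
  - by rewrite size_map; apply: sz uK _ => k /KE.
  - move=> e /mapP[k /KE /andP[_ ak] ->]; rewrite opprK.
    have gf := fB.1 k.
    have := @dyadic_le _ _ _ p1 (EFin \o f) k (h n) (ltW (h0 n)) gf.
    by rewrite -/(a k) ak => /esym; rewrite -invr_expz.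
  - move=> y k /=; rewrite lte_fin /fn; case: ifP => [/hasP[j jK /andP[j1 j2]] kf|_]; last first.
      by rewrite normr0 ltNge exprz_ge0.
    exists (- j); rewrite opprK lte_fin; split=> //; first by rewrite map_f.
    rewrite -invr_expz invrK; apply: (lt_le_trans kf); apply: (le_trans j2).
    by rewrite expfzDr // expr1z mulrC.
have Mfn n : lor p vt (maxfun (fn n)) (8^-1 ^+ n *
    (2 * ((C0 * 8) `^ (1 - t) * (C1 * 8) `^ t * r `^ (ut / u)) * B)).
  have Tn : 0 < T n by exact: (lt_le_trans ltr01 (T1 n)).
  have Tp s : 0 < T n `^ s by exact: powR_gt0.
  have P0 s : 0 < 8 * h n * T n `^ s.
    by apply: (mulr_gt0 _ (Tp s)); exact: (mulr_gt0 _ (h0 n)).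
  have m0 := hC0 _ (mfn n) _ (P0 u0) (fnB n u0 u0u).
  have m1 := hC1 _ (mfn n) _ (P0 u1) (fnB n u1 u1u).
  have /andP[v00 _] := v01; have /andP[v10 _] := v11.
  have := lor_interp v00 v10 t01 (andP vt01).2 (mulr_gt0 C0p (P0 _)) (mulr_gt0 C1p (P0 _)) m0 m1.
  congr lor.
  rewrite [RHS](_ : _ = 2 * (((C0 * 8) `^ (1 - t) * (C1 * 8) `^ t * r `^ (ut / u)) *
    (8^-1 ^+ n * B))); last by ring.
  congr (2 * _).
  rewrite geometric_mean_mul ?(ltW C0p) ?(ltW C1p) ?(ltW (h0 n)) // -/ut /T -powRrM.
  have -> : n.+1%:R / u * ut = ut / u + n%:R * (ut / u) by rewrite -natr1; field; rewrite gt_eqF.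
  have E : r^-1 ^+ n * r `^ (n%:R * (ut / u)) = 8^-1 ^+ n.
    rewrite -rc -powRN exprVn -powR_mulrn ?(ltW rp) // -powRN -[RHS]powR_mulrn ?powR_ge0 //.
    rewrite -powRrM -powRD; first by congr powR; rewrite /c; ring.
    by apply/implyP => _; rewrite gt_eqF.
  rewrite [r `^ (_ + _)]powRD; last by apply/implyP => _; rewrite gt_eqF.
  by rewrite -E /h; ring.
rewrite -mulrA; apply: (@lor_superpose _ _ _ p1 _ _ (fun n => maxfun (fn n))) => //.
(* If every piece stayed below 2^(k-n-1) at y, the sum of these bounds would be 2^k. *)
move=> y k ky; apply: contrapT => /forallNP nk.
have : (maxfun f y <= (2 ^ k)%:E)%E.
  apply: (@le_trans _ _ (\sum_(n <oo) maxfun (fn n) y)%E).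
    apply: maxfun_le_nneseries => //.
    (* Layers with a_j = 0 belong to no [K n], but their superlevel sets are null; elsewhere the
       pieces recover |f|. *)
    pose G n : set X := if pickle_inv n is Some j then
      (if a j == 0 then [set x | 2 ^ j < `|f x|] else set0) else set0.
    have nG : mu.-negligible (\bigcup_n G n).
      apply: negligible_bigcup => n; rewrite /G.
      case: (pickle_inv n) => [j|]; last exact: negligible_set0.
      case: eqP => [aj|_]; last exact: negligible_set0.
      have mj : measurable [set x : X | 2 ^ j < `|f x|].
        rewrite -[X in measurable X]setTI.
        by apply: measurable_fun_ltr => //; exact: measurableT_comp.
      apply/(negligibleP _ mj); transitivity (distr (EFin \o f) (2 ^ j)).
        by rewrite /distr mu_out_measurable.
      have /eqP : a j == 0 by rewrite aj.
      rewrite -(fineK (distr_fin j fB)) /a /dyadic => /eqP.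
      rewrite mulf_eq0 gt_eqF ?exprz_gt0 //= powR_eq0 => /andP[/eqP -> _].
      by [].
    apply: negligibleS nG => x /= /negP; rewrite -ltNge => fx.
    have s0 (N : nat) : (\sum_(n < N) (`|fn n x|)%:E < (`|f x|)%:E)%E.
      apply: le_lt_trans fx; rewrite -(big_mkord predT (fun n => (`|fn n x|)%:E)).
      exact: nneseries_lim_ge.
    have fp : 0 < `|f x| by have := s0 0%N; rewrite big_ord0 lte_fin.
    have [j jx] := ltS_expz fp; have /andP[jx1 jx2] := jx.
    have [aj|aj0] := eqVneq (a j) 0.
      by exists (pickle j); rewrite /G ?pickleK_inv ?aj ?eqxx.
    exfalso.
    have /andP[aj1 aj2] := aB j.
    have [|n /andP[n1 n2]] := @geometric_level r (a j / B) r2.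
      have ajp : 0 < a j by rewrite lt0r aj0 aj1.
      by rewrite divr_gt0 //= ler_pdivrMr // mul1r.
    have jK : j \in K n.
      by apply/(HK n).2; rewrite /h -ltr_pdivlMr // n1 -ler_pdivrMr.
    have := s0 n.+1; rewrite big_ord_recr /= ltNge => /negP; case.
    rewrite /fn; have -> : inK n x by apply/hasP; exists j.
    by rewrite leeDr // sume_ge0.
  apply: le_trans (@epsilon_trick0 _ (2 ^ k) predT _); last by rewrite exprz_ge0.
  apply: lee_nneseries => n _; first by move=> _; exact: maxfun_ge0.
  have /negP := nk n; rewrite -leNgt maxfun_abs => /le_trans; apply; rewrite lee_fin.
  by rewrite exp2z_shift.
by rewrite leNgt -(maxfun_abs f y) ky.
Qed.

End Interpolation.

(** * Bounds above the diagonal force the whole square *)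

Section SuperDiagonal.
Variables (R : realType) (M : mms R) (p : R).
Hypothesis p1 : 1 < p.
Local Notation X := (mms_T M).
Local Notation mu := (mms_mu M).
Local Notation rho := (@mms_rho R M).
Local Notation lor_bounded := (lor_bounded M p).
Local Notation supp := (supp M).
Implicit Types (f : X -> R) (u v : R).
Let p0 : 0 < p. Proof. exact: lt_trans p1. Qed.

(** Take the maximum of 0 and the functions equal to 2^(-e) on [V e]. *)
Lemma upper_envelope (J : seq int) (V : int -> set X) :
  (forall e, e \in J -> measurable (V e)) ->
  exists f : X -> R, [/\ measurable_fun setT f,
    forall x e, e \in J -> V e x -> 2 ^ (- e) <= f x &
    forall x (t : R), 0 <= t -> t < `|f x| -> exists e, [/\ e \in J, V e x & t < 2 ^ (- e)]].
Proof.
elim: J => [|a J IH] mV.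
  by exists (fun=> 0); split => // x t t0; rewrite normr0 ltNge t0.
have mJ e : e \in J -> measurable (V e) by move=> eJ; apply: mV; rewrite in_cons eJ orbT.
have [f [mf f1 f2]] := IH mJ.
have ma := mV a (mem_head _ _).
exists (fun x => Num.max (f x) (2 ^ (- a) * \1_(V a) x)); split.
- apply: measurable_maxr => //; apply: measurable_funM => //; exact: measurable_indic.
- move=> x e; rewrite in_cons le_max => /orP[/eqP ->|eJ] Ve.
    by apply/orP; right; rewrite indicE mem_set // mulr1.
  by rewrite (f1 x e eJ Ve).
- move=> x t t0; rewrite /Num.max; case: ifP => _.
    rewrite indicE; case: (boolP (x \in V a)) => [/set_mem Va|_]; last first.
      by rewrite mulr0 normr0 ltNge t0.
    rewrite mulr1 ger0_norm ?exprz_ge0 // => ta.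
    by exists a; rewrite mem_head.
  by move=> /(f2 x t t0)[e [eJ Ve te]]; exists e; rewrite in_cons eJ orbT.
Qed.

Hypothesis supp0 : mu (~` supp) = 0%E.

Lemma setC_supp_open : rho_open rho (~` supp).
Proof.
move=> x /existsNP[s /not_implyP[s0 /negP]].
rewrite -leNgt => ms; exists s => // y ys sy.
have [t t0 ts] := oball_open ys.
have := sy t t0; rewrite ltNge => /negP; apply.
apply: le_trans ms; apply: le_measure => //; rewrite ?inE; exact: oball_measurable.
Qed.

Lemma measurable_supp : measurable supp.
Proof.
rewrite -[X in measurable X]setCK; apply: measurableC.
by apply: rho_open_measurable; exact: setC_supp_open.
Qed.

Lemma mu_out_supp (A : set X) : (mu_out A <= mu_out (A `&` supp))%E.
Proof.
rewrite -[leRHS]adde0 -supp0 -(mu_out_measurable (measurableC measurable_supp)).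
apply: le_trans (mu_outU _ _); apply: le_mu_out => x Ax.
by have [sx|nsx] := pselect (supp x); [left|right].
Qed.

(** A small ball inside V around a point of the support has positive finite measure and average at
    least c. *)
Lemma maxfun_ge_on_open f (V : set X) (c : R) x : 0 <= c -> rho_open rho V ->
  (mu V < +oo)%E -> (forall y, V y -> c <= `|f y|) -> measurable_fun setT f -> V x -> supp x ->
  (c%:E <= maxfun f x)%E.
Proof.
move=> c0 oV Voo fc mf Vx sx; have [s s0 sV] := oV x Vx.
have ms : (0 < mu (oball rho x s) < +oo)%E.
  rewrite sx //= (le_lt_trans _ Voo) //; apply: le_measure => //; rewrite inE.
    exact: oball_measurable.
  exact: rho_open_measurable.
apply: le_trans (maxfun_ge_avg _ s0 ms).
have /andP[m0 moo] := ms.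
have fi : mu (oball rho x s) \is a fin_num by rewrite ge0_fin_numE // ltW.
have f0 : 0 < fine (mu (oball rho x s)) by rewrite fine_gt0 // m0.
rewrite muleC lee_pdivlMr // fineK //.
rewrite -(integral_cst mu (oball_measurable x s)).
apply: ge0_le_integral => //.
- exact: oball_measurable.
- apply: measurable_funTS; apply/measurable_EFinP; exact: measurableT_comp.
- by move=> y /sV /fc; rewrite lee_fin.
Qed.

(** For the envelope of the heights 2^(-e) on open sets of measure about 2^(ep), the norm of f is at
    most of order (size J)^u, while its maximal function has a dyadic term of order 1 at each scale,
    hence norm at least of order (size J)^v. *)
Lemma lor_bounded_many_scales u v (C : R) (J : seq int) (V : int -> set X) :
  0 <= u <= 1 -> 0 <= v -> (0 < size J)%N -> uniq J -> 
  (forall e, e \in J -> rho_open rho (V e) /\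
     (((2 ^ e) `^ p)%:E <= mu (V e) < ((2 ^ (e + 1)) `^ p)%:E)%E) ->
  (forall f, measurable_fun setT f ->
    forall B, 0 < B -> lor p u (EFin \o f) B -> lor p v (maxfun f) (C * B)) ->
  (size J)%:R `^ v <= 16 * C * (size J)%:R `^ u.
Proof.
move=> u01 v0 J0 uJ HV hC.
have mV e : e \in J -> measurable (V e) by move=> /HV[/rho_open_measurable].
have [f [mf f1 f2]] := upper_envelope mV.
have sJ : 1 <= (size J)%:R :> R by rewrite ler1n.
have fB : lor p u (EFin \o f) (4 * (2 * 1) * (size J)%:R `^ u).
  apply: (@profile_upper _ _ _ p1 J V) => //.
    move=> e eJ; have [_ /andP[_ /ltW]] := HV e eJ.
    by rewrite (mu_out_measurable (mV e eJ)) expfzDr // expr1z mulrC.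
  move=> y k /=; rewrite lte_fin => /f2; rewrite exprz_ge0 // => /(_ isT)[e [eJ Ve ke]].
  by exists e; split=> //; rewrite div1r invr_expz.
have B0 : 0 < 4 * (2 * 1) * (size J)%:R `^ u :> R.
  by rewrite mulr_gt0 // powR_gt0 // (lt_le_trans ltr01).
have := hC f mf _ B0 fB.
have low e l : e \in J -> (2 : R) ^ l < 1 / 2 ^ e -> (((1 * 2 ^ e) `^ p)%:E <= distr (maxfun f) (2 ^ l))%E.
  move=> eJ le; have [oV /andP[V1 V2]] := HV e eJ.
  rewrite mul1r (le_trans V1) // -(mu_out_measurable (mV e eJ)) (le_trans (mu_out_supp _)) //.
  apply: le_mu_out => x [Vx sx] /=; rewrite maxfun_abs.
  apply: (@lt_le_trans _ _ (2 ^ (- e))%:E).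
    by rewrite lte_fin -invr_expz; move: le; rewrite div1r.
  apply: (maxfun_ge_on_open _ oV) => //; first by rewrite exprz_ge0.
    by apply: lt_trans V2 _; rewrite ltry.
  by move=> y Vy; apply: le_trans (ler_norm _); exact: f1.
move=> /(profile_lower p1 ltr01 ltr01 v0 uJ J0 low).
rewrite !mulr1 div1r mulrC ler_pdivrMr // => /le_trans; apply.
by rewrite le_eqVlt; apply/orP; left; apply/eqP; ring.
Qed.

Section FewScales.
Variables a b : R.
Hypothesis a0 : 0 < a.
Hypothesis scale : forall V, rho_open rho V -> (0 < mu V < +oo)%E ->
  (a%:E <= mu V <= b%:E)%E.

(** Points of the support at which some ball is admissible; at the other points of the support all
    balls have infinite measure and [maxfun] is 0. *)
Definition finite_part : set X :=
  [set x | supp x /\ exists2 s : R, 0 < s & (mu (oball rho x s) < +oo)%E].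

Lemma oball_self x s : 0 < s -> oball rho x s x.
Proof.
case: (mms_metric M) => _ rhoI _ _ s0.
by rewrite /oball /= (_ : rho x x = 0) //; apply/rhoI.
Qed.

Lemma set1_bigcap_oball x s : 0 < s ->
  [set x] = \bigcap_n oball rho x (s / n.+1%:R).
Proof.
move=> s0; case: (mms_metric M) => rho0 rhoI _ _.
apply/seteqP; split => [y -> n _|y Fy]; first by apply: oball_self; rewrite divr_gt0.
apply/esym/rhoI/eqP; rewrite eq_le rho0 andbT leNgt; apply/negP => r0.
have := Fy (Num.truncn (s / rho x y)) Logic.I.
rewrite /oball /= ltr_pdivlMr // mulrC -ltr_pdivlMr // ltNge => /negP; apply.
exact: ltW (truncnS_gt _).
Qed.

Lemma measurable_mms_set1 (x : X) : measurable [set x].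
Proof.
rewrite (set1_bigcap_oball x ltr01); apply: bigcapT_measurable => n.
exact: oball_measurable.
Qed.

(** Balls shrinking to x have measure at least a by [scale], and the limit inherits this: x is an
    atom. *)
Lemma atom_ge x : finite_part x -> (a%:E <= mu [set x])%E.
Proof.
move=> [sx [s s0 ms]]; pose F n := oball rho x (s / n.+1%:R).
have mF n : measurable (F n) by exact: oball_measurable.
have F0 : (mu (F 0%N) < +oo)%E by rewrite /F divr1.
have dF : {homo F : n m / (n <= m)%N >-> (m <= n)%O}.
  move=> n m nm; apply/subsetPset => y /= /lt_le_trans; apply.
  by rewrite ler_pM2l // lef_pV2 ?posrE // ler_nat.
have mc : measurable (\bigcap_n F n) by exact: bigcapT_measurable.
have := nonincreasing_cvg_mu F0 mF mc dF.
rewrite (set1_bigcap_oball x s0) -/F => cF; rewrite -(cvg_lim _ cF) //.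
apply: lime_ge; first by apply/cvg_ex; exists (mu (\bigcap_n F n)).
apply: nearW => n /=; have sn : 0 < s / n.+1%:R by rewrite divr_gt0.
have : (0 < mu (F n) < +oo)%E.
  rewrite sx //= (le_lt_trans _ F0) //; apply: le_measure; rewrite ?inE //.
  by apply/subsetPset; exact: dF.
by move=> /(scale (oball_open (x := x) (s := _)))/andP[].
Qed.

(** Finitely many such points have a common open neighbourhood of finite measure, so of measure at
    most b by [scale]; this limits their number to b / a. The empty list is the exception, since
    [scale] needs positive measure. *)
Lemma finite_part_cover (J : seq X) : uniq J -> (forall x, x \in J -> finite_part x) ->
  exists V, [/\ rho_open rho V, (mu V <= b%:E \/ V = set0)%E, [set` J] `<=` V &
     (((size J)%:R * a)%:E <= mu V)%E].
Proof.
move=> uJ JF.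
suff [V [oV Voo JV mJs mJ]] : exists V, [/\ rho_open rho V, (mu V < +oo)%E, [set` J] `<=` V,
     measurable [set` J] & (((size J)%:R * a)%:E <= mu [set` J])%E].
  have le : (((size J)%:R * a)%:E <= mu V)%E.
    apply: (le_trans mJ); apply: le_measure; rewrite ?inE //; exact: rho_open_measurable.
  case: J uJ JF JV mJ le mJs => [|x J] uJ JF JV mJ le mJs.
    exists set0; split => //; [by right|].
    by rewrite mul0r measure0.
  exists V; split => //; left.
  have : (0 < mu V < +oo)%E.
    by rewrite Voo andbT (lt_le_trans _ le) // lte_fin mulr_gt0.
  by move=> /(scale oV)/andP[].
elim: J uJ JF => [|x J IH] /=.
  move=> _ _; exists set0; split => //.
  - by rewrite measure0.
  - by rewrite (_ : [set` _] = set0) //; apply/seteqP; split.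
  - by rewrite mul0r measure_ge0.
move=> /andP[xJ uJ] JF.
have JF' y : y \in J -> finite_part y by move=> yJ; apply: JF; rewrite in_cons yJ orbT.
have [V [oV Voo JV mJs mJ]] := IH uJ JF'.
have Fx := JF x (mem_head _ _); have [sx [s s0 ms]] := Fx.
have E : [set` x :: J] = [set x] `|` [set` J].
  apply/seteqP; split => y /=; rewrite in_cons.
    by move=> /orP[/eqP ->|yJ]; [left|right].
  by move=> [->|->]; rewrite ?eqxx ?orbT.
exists (V `|` oball rho x s); split.
- move=> y [/oV[r r0 rV]|/oball_open[r r0 rV]]; exists r => // z /rV; by [left|right].
- apply: (le_lt_trans (measureU2 _ _ _)).
  + exact: rho_open_measurable.
  + exact: oball_measurable.
  + by rewrite lte_add_pinfty.
- by rewrite E => y [->|/JV]; [right; exact: oball_self|left].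
- by rewrite E; apply: measurableU => //; exact: measurable_mms_set1.
- rewrite E measureU //; last 2 first.
  + exact: measurable_mms_set1.
  + by apply/seteqP; split => // y [-> /=]; rewrite (negbTE xJ).
  rewrite -natr1 mulrDl mul1r addrC EFinD leeD //; exact: atom_ge.
Qed.

(** On atoms of mass at least a, a weak-type bound limits |f| pointwise, hence [maxfun f] too. As
    [finite_part] has finite measure, [maxfun f] is a profile with one level. *)
Lemma few_scales_lor_bounded u v : 0 <= u -> 0 <= v <= 1 -> lor_bounded u v.
Proof.
move=> u0 v01.
have [J uJ JE] : exists2 J : seq X, uniq J & forall x, x \in J <-> finite_part x.
  apply: (@finite_enum R _ _ (Num.max (b / a) 0)) => J uJ JF.
  have [V [_ + _ le]] := finite_part_cover uJ JF.
  rewrite le_max !ler_pdivlMr //; case=> [Vb|V0].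
    by have := le_trans le Vb; rewrite lee_fin => ->.
  move: le; rewrite V0 measure0 lee_fin => le; apply/orP; right.
  by rewrite -(@ler_pM2r _ a) // mul0r.
pose b' := Num.max b 1; have b'0 : 0 < b' by rewrite lt_max ltr01 orbT.
have mF : (mu_out finite_part <= b'%:E)%E.
  have [V [oV + JV _]] := finite_part_cover uJ (fun x => (JE x).1).
  have FV : finite_part `<=` V by move=> x /JE; exact: JV.
  move=> VE; apply: (le_trans (le_mu_out FV)).
  rewrite (mu_out_measurable (rho_open_measurable oV)).
  case: VE => [Vb|->]; last by rewrite measure0 lee_fin ltW.
  by apply: (le_trans Vb); rewrite lee_fin le_max lexx.
pose al := a `^ p^-1; have al0 : 0 < al by rewrite powR_gt0.
pose h := b' `^ p^-1; have h0 : 0 < h by rewrite powR_gt0.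
exists (4 * (h * (4 / al))); first by rewrite !mulr_gt0 // invr_gt0.
move=> f mf B B0 fB; pose t0 := 2 * (B / al).
have t00 : 0 < t0 by rewrite mulr_gt0 // divr_gt0.
have ft x : finite_part x -> `|f x| <= t0.
  move=> Fx; have [->|fx] := eqVneq (f x) 0; first by rewrite normr0 ltW.
  have [k /andP[k1 k2]] := ltS_expz (t := `|f x|) (ltac:(by rewrite normr_gt0)).
  apply: (le_trans k2); rewrite expfzDr // expr1z mulrC /t0 ler_pM2l //.
  have : (a%:E <= ((B / 2 ^ k) `^ p)%:E)%E.
    apply: le_trans (distr_le p1 k fB); apply: (le_trans (atom_ge Fx)).
    rewrite -(mu_out_measurable (measurable_mms_set1 x)).
    by apply: le_mu_out => y -> /=; rewrite lte_fin.
  rewrite lee_fin -powR_inv_le ?(ltW a0) ?divr_ge0 ?exprz_ge0 ?(ltW B0) // -/al.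
  by rewrite !ler_pdivlMr ?exprz_gt0 // mulrC.
have Mf x : (maxfun f x <= t0%:E)%E.
  apply: maxfun_leP => [|s s0 /andP[m0 moo]]; first exact: ltW.
  rewrite -(integral_cst mu (oball_measurable x s)).
  apply: ae_ge0_le_integral => //.
  - exact: oball_measurable.
  - by apply: measurable_funTS; apply/measurable_EFinP; exact: measurableT_comp.
  - by move=> y _; rewrite lee_fin ltW.
  - exists (~` supp); split => //; first exact: measurableC measurable_supp.
    move=> y /= /not_implyP[yB yt] sy; apply: yt; rewrite lee_fin; apply: ft.
    split=> //; have [r r0 rB] := oball_open yB; exists r => //.
    apply: le_lt_trans moo; apply: le_measure => //; rewrite inE; exact: oball_measurable.
have Mf0 x : supp x -> ~ finite_part x -> maxfun f x = 0%E.
  move=> sx nx; apply/eqP; rewrite eq_le maxfun_ge0 andbT.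
  by apply: maxfun_leP => // s s0 /andP[_ moo]; exfalso; apply: nx; split=> //; exists s.
have := @profile_upper _ M p p1 [:: 0] (fun=> finite_part `|` ~` supp) h (4 / al * B) 1 v (maxfun f).
rewrite powR1 mulr1 !mulrA => H; apply: H => //.
- by rewrite mulr_gt0 // divr_gt0.
- move=> e; rewrite inE => /eqP ->; rewrite expr0z mulr1 /h -powRrM mulVf ?gt_eqF // powRr1 ?(ltW b'0) //.
  apply: (le_trans (mu_outU _ _)).
  by rewrite (mu_out_measurable (measurableC measurable_supp)) supp0 adde0.
- move=> y k; rewrite maxfun_abs => ky; exists 0; split.
  + by rewrite mem_head.
  + apply: contrapT => /not_orP[nF /contrapT sy]; move: ky; rewrite Mf0 // lte_fin.
    by rewrite ltNge exprz_ge0.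
  + rewrite expr0z divr1; have := lt_le_trans ky (Mf y); rewrite lte_fin => /lt_le_trans; apply.
    rewrite /t0 -subr_ge0 (_ : _ - _ = 2 * (B / al)); last by field; rewrite gt_eqF.
    exact: ltW.
Qed.

End FewScales.

(** If open sets attained infinitely many dyadic sizes, long lists of scales would contradict u < v.
    So the sizes are finitely many, and all finite positive measures of open sets lie in one
    interval [a, b]. *)
Theorem lor_bounded_above_diagonal u v : 0 <= u <= 1 -> 0 <= v <= 1 -> u < v ->
  lor_bounded u v ->
  forall u' v', 0 <= u' -> 0 <= v' <= 1 -> lor_bounded u' v'.
Proof.
move=> u01 v01 uv [C C0 hC].
pose E : set int := [set e | exists2 V, rho_open rho V &
     (((2 ^ e) `^ p)%:E <= mu V < ((2 ^ (e + 1)) `^ p)%:E)%E].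
have [fE|iE] := pselect (finite_set E).
  have [m Em] : exists m : nat, forall e, E e -> (`|e| <= m)%N.
    have [s Es] := (finite_seqP E).1 fE; exists (\max_(e <- s) `|e|%N)%N => e.
    rewrite Es /= => es; exact: (@leq_bigmax_seq _ _ predT (fun e : int => `|e|%N)).
  move=> u' v'; apply: (@few_scales_lor_bounded ((2 ^- m.+1) `^ p) ((2 ^+ m.+1) `^ p)).
    by rewrite powR_gt0 // invr_gt0 exprn_gt0.
  move=> V oV /andP[V0 Voo].
  have fi : mu V \is a fin_num by rewrite ge0_fin_numE // ltW.
  have f0 : 0 < fine (mu V) by rewrite fine_gt0 // V0.
  have [e /andP[e1 e2]] := floor_expz (powR_gt0 p^-1 f0).
  have pe : fine (mu V) = (fine (mu V) `^ p^-1) `^ p.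
    by rewrite -powRrM mulVf ?gt_eqF // powRr1 // ltW.
  have eb : (`|e| <= m)%N.
    apply: Em; exists V => //; rewrite -(fineK fi) lee_fin lte_fin pe.
    by rewrite ge0_ler_powR ?gt0_ltr_powR ?nnegrE ?exprz_ge0 ?powR_ge0 // ltW.
  have [em1 em2] := exp2z_absz_le R eb.
  rewrite -(fineK fi) !lee_fin pe !ge0_ler_powR ?nnegrE ?exprn_ge0 ?invr_ge0 ?powR_ge0 ?exprn_ge0 ?(ltW p0) //.
    exact: le_trans (ltW e2) em2.
  exact: le_trans em1 e1.
exfalso; have vu : 0 < v - u by rewrite subr_gt0.
have C16 : 0 < 16 * C by rewrite mulr_gt0.
(* More scales than [lor_bounded_many_scales] permits: N^(v-u) > 16 C. *)
pose N := (Num.truncn ((16 * C) `^ (v - u)^-1)).+1.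
have [F FE sF] := infinite_set_fset N iE.
pose J := finmap.enum_fset F.
have uJ : uniq J := finmap.fset_uniq F.
have [V HV] : exists V : int -> set X, forall e, e \in J -> rho_open rho (V e) /\
     (((2 ^ e) `^ p)%:E <= mu (V e) < ((2 ^ (e + 1)) `^ p)%:E)%E.
  have H e : exists V : set X, e \in J -> rho_open rho V /\
     (((2 ^ e) `^ p)%:E <= mu V < ((2 ^ (e + 1)) `^ p)%:E)%E.
    have [eJ|] := boolP (e \in J); last by exists set0.
    by have [V oV mV] := FE e eJ; exists V.
  by have [V HV] := choice H; exists V.
have J0 : (0 < size J)%N by exact: leq_trans sF.
have Jp : 0 < (size J)%:R :> R by rewrite ltr0n.
have := lor_bounded_many_scales u01 (andP v01).1 J0 uJ HV hC.
rewrite -ler_pdivrMr ?powR_gt0 // -powRB; last by apply/implyP => _; rewrite gt_eqF.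
apply/negP; rewrite -ltNge.
have -> : 16 * C = ((16 * C) `^ (v - u)^-1) `^ (v - u).
  by rewrite -powRrM mulVf ?gt_eqF // powRr1 // ltW.
rewrite gt0_ltr_powR ?nnegrE ?powR_ge0 //.
by apply: (lt_le_trans (truncnS_gt _)); rewrite ler_nat.
Qed.

End SuperDiagonal.

(** * Boundary of the boundedness region *)

Section BoundaryShape.
Variable R : realType.
Implicit Types (A B Om : set (R * R)) (u v e : R).

Lemma closure_prodP A (x : R * R) : closure A x <->
  forall e, 0 < e -> exists y, [/\ A y, `|x.1 - y.1| < e & `|x.2 - y.2| < e].
Proof.
split=> [cA e e0|cA B /nbhs_ballP[e /= e0 eB]].
  have [y [Ay [y1 y2]]] := cA (ball x e) (nbhsx_ballx x e e0).
  by exists y.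
have [y [Ay y1 y2]] := cA e e0.
by exists y; split=> //; apply: eB; split.
Qed.

Variable Om : set (R * R).
Hypothesis Om_square : Om `<=` @unit_square R.
Hypothesis Om_mono : forall u v u' v', Om (u, v) -> u <= u' <= 1 -> 0 <= v' <= v -> Om (u', v').
Hypothesis Om_diag : forall u v, Om (u, v) -> v <= u.
Hypothesis Om_interp : forall (u0 v0 u1 v1 t u : R), Om (u0, v0) -> Om (u1, v1) -> 0 <= t <= 1 ->
  (1 - t) * u0 + t * u1 < u -> u <= 1 -> Om (u, (1 - t) * v0 + t * v1).
Hypothesis Om_nonempty : exists x, Om x.

Let Om10 : Om (1, 0).
Proof.
have [[u v] Ouv] := Om_nonempty; have [/andP[u0 u1] /andP[v0 v1]] := Om_square Ouv.
by apply: Om_mono Ouv _ _; rewrite ?u1 ?v0 ?lexx.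
Qed.

Let U := [set u | Om (u, 0)].
Let delta := inf U.

Let hU : has_inf U.
Proof.
split; first by exists 1.
by exists 0 => u /Om_square[/andP[]].
Qed.

Let delta01 : 0 <= delta <= 1.
Proof.
apply/andP; split; last exact: ge_inf hU.2 _ Om10.
by apply: lb_le_inf hU.1 _ => u /Om_square[/andP[]].
Qed.

Let delta_le u v : Om (u, v) -> delta <= u.
Proof.
move=> Ouv; have [/andP[u0 u1] /andP[v0 v1]] := Om_square Ouv.
apply: ge_inf hU.2 _ _; apply: (Om_mono Ouv); rewrite ?lexx ?u1 ?v0 //.
Qed.

Let delta_adh u : delta < u -> exists2 a, a < u & Om (a, 0).
Proof.
rewrite -subr_gt0 => /inf_adherent /(_ hU)[a Oa au]; exists a => //.
by move: au; rewrite -/delta addrCA subrr addr0.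
Qed.

Section Degenerate.
Hypothesis delta1 : delta = 1.
Let V := [set v | Om (1, v)].
Let L := sup V.

Let hV : has_sup V.
Proof.
split; first by exists 0.
by exists 1 => v /Om_square[_ /andP[]].
Qed.

(** The region meets only the edge u = 1, so its boundary is a vertical segment up to the supremum
    L, and the constant L serves as F. *)
Lemma degenerate_boundary : exists d F L,
  [/\ admissible d F, (if d < 1 then F x @[x --> d^'+] --> L else L = F 1) &
     rel_boundary (@unit_square R) Om =
       [set uv | uv.1 = d /\ 0 <= uv.2 <= L] `|`
       [set uv | d < uv.1 <= 1 /\ uv.2 = F uv.1]].
Proof.
have L0 : 0 <= L by apply: ub_le_sup hV.2 _ _; exact: Om10.
have L1 : L <= 1 by apply: ge_sup hV.1 _ => v /Om_square[_ /andP[]].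
exists 1, (fun=> L), L; rewrite ltxx; split=> //.
  split=> //.
  - by rewrite ler01 lexx.
  - by move=> x y t _ _ _; rewrite -mulrDl addrCA subrr addr0 mul1r.
  - by move=> u _; rewrite L0 L1.
  - by move=> u /andP[u1 _]; apply: le_trans u1.
have below u v : u < 1 -> ~ Om (u, v).
  by move=> u1 /delta_le; rewrite delta1 leNgt u1.
apply/seteqP; split=> [[u v] [[sq cl1] cl2]|[u v] [|/= [/andP[+ /le_lt_trans h] _]]]; last first.
- by move=> /h; rewrite ltxx.
- move=> /= [-> /andP[v0 vL]].
  have sq w : 0 <= w <= 1 -> @unit_square R (w, v).
    by move=> w01; split=> //=; rewrite v0 (le_trans vL).
  split; first split; first by apply: sq; rewrite ler01 lexx.
    apply/closure_prodP => e e0 /=.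
    have [w Ow ew] := sup_adherent e0 hV.
    have [/andP[_ _] /andP[w0 w1]] := Om_square Ow.
    exists (1, Num.min v w) => /=; rewrite subrr normr0; split=> //.
      split; first by split => /=; rewrite ?ler01 ?lexx // le_min v0 w0 /= ge_min w1 orbT.
      by apply: (Om_mono Ow); rewrite ?lexx ?ler01 // le_min v0 w0 ge_min lexx orbT.
    rewrite /Num.min; case: ifP => [_|/negbT]; first by rewrite subrr normr0.
    rewrite -leNgt => wv; rewrite ger0_norm ?subr_ge0 // ltrBlDr -ltrBlDl.
    by apply: le_lt_trans ew; rewrite lerB.
  apply/closure_prodP => e e0 /=.
  pose w := Num.max 0 (1 - e / 2).
  have w1 : w < 1 by rewrite gt_max ltr01 /=; lra.
  have w0 : 0 <= w by rewrite le_max lexx.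
  exists (w, v) => /=; split; [split| |].
  + by apply: sq; rewrite w0 ltW.
  + exact: below.
  + rewrite gtr0_norm ?subr_gt0 //.
    have : 1 - e / 2 <= w by rewrite le_max lexx orbT.
    lra.
  + by rewrite subrr normr0.
left => /=; move: sq => [/= /andP[u0 u1] /andP[v0 v1]].
move: cl1 => /closure_prodP cl1; split.
  apply/eqP; rewrite eq_le u1 /= leNgt; apply/negP => u1'.
  have [|[y z] /= [[sqy Oy] uy _]] := cl1 (1 - u); first by rewrite subr_gt0.
  have := delta_le Oy; rewrite delta1; move: uy; rewrite distrC => /ltr_normlW; lra.
rewrite v0 /= leNgt; apply/negP => Lv.
have [|[y z] /= [[sqy Oy] _ vz]] := cl1 (v - L); first by rewrite subr_gt0.
have [/andP[y0 y1] /andP[z0 z1]] := Om_square Oy.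
have : z <= L.
  apply: ub_le_sup hV.2 _ _; apply: (Om_mono Oy); first by rewrite y1 lexx.
  by rewrite z0 lexx.
by move: vz => /ltr_normlW; lra.
Qed.

End Degenerate.

Section Nondegenerate.
Hypothesis delta_lt1 : delta < 1.
(** Abscissas strictly left of u, because [Om_interp] yields points only strictly to the right of a
    segment. *)
Let G u := [set v | exists2 u', u' < u & Om (u', v)].
Let F0 u := sup (G u).
(** Since [F0] is nondecreasing, this is its right limit at delta. *)
Let L := inf [set F0 u | u in [set u | delta < u <= 1]].
Let F u := if u <= delta then L else F0 u.

Let hG u : delta < u -> has_sup (G u).
Proof.
move=> /delta_adh[a au Oa]; split; first by exists 0, a.
by exists 1 => v [u' _ /Om_square[_ /andP[]]].
Qed.

Let F0_ge u' v u : u' < u -> Om (u', v) -> v <= F0 u.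
Proof.
move=> u'u O; apply: ub_le_sup; last by exists u'.
by exists 1 => w [w' _ /Om_square[_ /andP[]]].
Qed.

Let F0_bounds u : delta < u <= 1 -> 0 <= F0 u <= u.
Proof.
move=> /andP[du u1]; have [a au Oa] := delta_adh du; rewrite (F0_ge au Oa) /=.
apply: ge_sup (hG du).1 _ => v [u' u'u /Om_diag] /le_trans; apply; exact: ltW.
Qed.

Let F0_homo u w : delta < u -> u <= w -> F0 u <= F0 w.
Proof.
move=> du uw; apply: ge_sup (hG du).1 _ => v [u' u'u O].
exact: F0_ge (lt_le_trans u'u uw) O.
Qed.

Let F0_adh u v : delta < u -> v < F0 u -> exists u' v', [/\ u' < u, v < v' & Om (u', v')].
Proof.
move=> du; rewrite -subr_gt0 => /sup_adherent /(_ (hG du))[v' [u' u'u O] vv'].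
exists u', v'; split=> //; move: vv'.
by rewrite -/(F0 u) opprB addrCA subrr addr0.
Qed.

Let hL : has_inf [set F0 u | u in [set u | delta < u <= 1]].
Proof.
split; first by exists (F0 1), 1 => //=; rewrite delta_lt1 lexx.
by exists 0 => _ [u /F0_bounds /andP[u0 _] <-].
Qed.

Let L_le u : delta < u <= 1 -> L <= F0 u.
Proof. by move=> du; apply: ge_inf hL.2 _ _; exists u. Qed.

Let L0 : 0 <= L.
Proof. by apply: lb_le_inf hL.1 _ => _ [u /F0_bounds /andP[u0 _] <-]. Qed.

Let L_adh v : L < v -> exists2 u, delta < u <= 1 & F0 u < v.
Proof.
rewrite -subr_gt0 => /inf_adherent /(_ hL)[_ [u du <-]].
by rewrite -/L addrCA subrr addr0 => Fv; exists u.
Qed.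

Let L_le_delta : L <= delta.
Proof.
rewrite leNgt; apply/negP => dL.
pose u := Num.min 1 ((delta + L) / 2).
have du : delta < u <= 1 by rewrite ge_min lexx lt_min delta_lt1 /=; lra.
have h1 := L_le du; have /andP[_ h2] := F0_bounds du.
have h3 : u <= (delta + L) / 2 by rewrite ge_min lexx orbT.
lra.
Qed.

Let L1 : L <= 1.
Proof. exact: le_trans L_le_delta (ltW delta_lt1). Qed.

(** At x = delta the region has nothing to the left; the slack e to the right covers both cases. *)
Let F_adh (x v : R) : delta <= x <= 1 -> v < F x -> forall e, 0 < e ->
  exists u' v', [/\ u' < x + e, v < v' & Om (u', v')].
Proof.
move=> /andP[dx x1]; rewrite /F; case: (leP x delta) => [xd|dx'] vF e e0.
  pose u := Num.min 1 (x + e).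
  have du : delta < u <= 1 by rewrite ge_min lexx lt_min delta_lt1 /= andbT; lra.
  have [u' [v' [u'u vv' O]]] := F0_adh (andP du).1 (lt_le_trans vF (L_le du)).
  exists u', v'; split=> //; apply: (lt_le_trans u'u).
  by rewrite /u ge_min lexx orbT.
have [u' [v' [u'u vv' O]]] := F0_adh dx' vF.
by exists u', v'; split=> //; lra.
Qed.

Let F_concave_aux (x y t : R) : delta <= x <= 1 -> delta < y <= 1 -> 0 <= t < 1 ->
  t * F x + (1 - t) * F y <= F (t * x + (1 - t) * y).
Proof.
move=> dx dy /andP[t0 t1]; set z := t * x + (1 - t) * y.
have /andP[dx1 x1] := dx; have /andP[dy1 y1] := dy.
have dz : delta < z <= 1 by rewrite /z; apply/andP; split; nra.
have Fz : F z = F0 z by rewrite /F leNgt (andP dz).1.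
rewrite Fz leNgt; apply/negP => h.
pose e := (t * F x + (1 - t) * F y - F0 z) / 2.
have e0 : 0 < e by rewrite /e; lra.
have Fy : F y - e < F0 y by rewrite /F leNgt dy1 /=; lra.
have [y' [v1 [y'y v1F Oy]]] := F0_adh dy1 Fy.
(* The point chosen for y lies strictly left of y; this gap, times 1 - t, pays for the slack at x,
   so the combination stays left of z. *)
have [||x' [v0 [x'x v0F Ox]]] := @F_adh x (F x - e) dx _ ((1 - t) * (y - y')) _.
- lra.
- by rewrite mulr_gt0 // subr_gt0.
have d0 : 0 < (1 - t) * (y - y') by rewrite mulr_gt0 // subr_gt0.
have lt : t * x' + (1 - t) * y' < z.
  move: d0 x'x; rewrite (_ : z = t * x + (1 - t) * y' + (1 - t) * (y - y')); last by rewrite /z; ring.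
  by move: ((1 - t) * (y - y')) => d d0 x'd; nra.
pose w := (t * x' + (1 - t) * y' + z) / 2.
have w1 : w <= 1 by rewrite /w; have := (andP dz).2; lra.
have := @Om_interp y' v1 x' v0 t w Oy Ox; rewrite t0 (ltW t1) => /(_ isT).
have lw : (1 - t) * y' + t * x' < w by rewrite /w; lra.
move=> /(_ lw w1) Ow.
have wz : w < z by rewrite /w; lra.
have := F0_ge wz Ow.
by rewrite /e in v1F v0F; nra.
Qed.

Let F_admissible : admissible delta F.
Proof.
have Fd : F delta = L by rewrite /F lexx.
split=> //.
- move=> x y t; rewrite /= !in_itv /= => dx dy /andP[t0 t1].
  have [->|t1n] := eqVneq t 1; first by rewrite subrr !mul0r !addr0 !mul1r.
  have [->|t0n] := eqVneq t 0; first by rewrite subr0 !mul0r !add0r !mul1r.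
  have {}t0 : 0 < t by rewrite lt_neqAle eq_sym t0n.
  have {}t1 : t < 1 by rewrite lt_neqAle t1n.
  have [dy'|yd] := ltP delta y.
    by apply: F_concave_aux; rewrite ?dy' ?(andP dy).2 ?(ltW t0).
  have [dx'|xd] := ltP delta x.
    have := @F_concave_aux y x (1 - t) dy; rewrite dx' (andP dx).2 => /(_ isT).
    have -> : 0 <= 1 - t < 1 by apply/andP; split; lra.
    move=> /(_ isT); rewrite opprB addrCA subrr addr0.
    by rewrite [X in X <= _]addrC [X in _ <= F X]addrC.
  have -> : x = delta by apply/eqP; rewrite eq_le xd (andP dx).1.
  have -> : y = delta by apply/eqP; rewrite eq_le yd (andP dy).1.
  by rewrite -!mulrDl addrCA subrr addr0 !mul1r.
- move=> x y; rewrite /= !in_itv /= => /andP[dx x1] /andP[dy y1] xy; rewrite /F.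
  case: (leP y delta) => [yd|dy']; first by rewrite (le_trans xy yd).
  case: (leP x delta) => [xd|dx']; first by apply: L_le; rewrite dy' y1.
  exact: F0_homo.
- move=> u /andP[du u1]; rewrite /F; case: (leP u delta) => [ud|du']; first by rewrite L0 L1.
  have /andP[-> /=] : 0 <= F0 u <= u by apply: F0_bounds; rewrite du' u1.
  by move=> /le_trans; apply.
- move=> u /andP[du u1]; rewrite /F; case: (leP u delta) => [ud|du'].
    exact: le_trans L_le_delta du.
  by have /andP[_] : 0 <= F0 u <= u by apply: F0_bounds; rewrite du' u1.
Qed.

Let F_cvg : F x @[x --> delta^'+] --> L.
Proof.
apply/cvgrPdist_lt => e e0.
have [|u /andP[du u1] Fu] := @L_adh (L + e); first by rewrite ltrDl.
near=> x; have dx : delta < x by near: x; exact: nbhs_right_gt.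
have xu : x < u by near: x; exact: nbhs_right_lt.
rewrite /F leNgt dx /=.
have h1 : L <= F0 x by apply: L_le; rewrite dx (le_trans (ltW xu)).
have h2 : F0 x <= F0 u by apply: F0_homo => //; exact: ltW.
by rewrite distrC ger0_norm ?subr_ge0 // ltrBlDl; lra.
Unshelve. all: by end_near. Qed.

(** Interpolation with (a, 0) pulls a point slightly right of u back below u and scales its height
    by a factor near 1. Hence limits of points of the region cannot lie above [F0]. *)
Let F0_upper (u a v w e : R) : delta < u -> a < u -> Om (a, 0) -> Om (w, v) -> 0 < e -> w < u + e ->
  u <= 1 -> v * (u - a) <= F0 u * (u - a + e).
Proof.
move=> du au Oa Ow e0 we u1.
have d0 : 0 < u - a + e by rewrite addr_gt0 // subr_gt0.
pose t := (u - a) / (u - a + e).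
have t01 : 0 <= t <= 1.
  rewrite divr_ge0 ?(ltW d0) ?subr_ge0 ?(ltW au) //=.
  by rewrite ler_pdivrMr // mul1r lerDl ltW.
have t0 : 0 < t by rewrite divr_gt0 // subr_gt0.
have tE : t * (u - a + e) = u - a by rewrite divfK // gt_eqF.
have lt : (1 - t) * a + t * w < u by nra.
pose z := ((1 - t) * a + t * w + u) / 2.
have zu : z < u by rewrite /z; lra.
have := @Om_interp a 0 w v t z Oa Ow t01.
rewrite mulr0 add0r => /(_ _ _)/(F0_ge zu) h.
have : t * v <= F0 u by apply: h; rewrite /z; lra.
move=> tv; rewrite -{1}tE mulrA [v * t]mulrC; exact: ler_wpM2r (ltW d0) _ _ tv.
Qed.

Lemma nondegenerate_boundary : exists d F L,
  [/\ admissible d F, (if d < 1 then F x @[x --> d^'+] --> L else L = F 1) &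
     rel_boundary (@unit_square R) Om =
       [set uv | uv.1 = d /\ 0 <= uv.2 <= L] `|`
       [set uv | d < uv.1 <= 1 /\ uv.2 = F uv.1]].
Proof.
exists delta, F, L; rewrite delta_lt1; split=> //.
have /andP[d0 d1] := delta01.
apply/seteqP; split=> [[u v] [[/= sq cl1] cl2]|[u v] [] /=].
- have [/= /andP[u0 u1] /andP[v0 v1]] := sq.
  move: cl1 cl2 => /closure_prodP cl1 /closure_prodP cl2.
  have du : delta <= u.
    rewrite leNgt; apply/negP => ud.
    have [|[y z] /= [[_ Oy] uy _]] := cl1 (delta - u); first by rewrite subr_gt0.
    by have := delta_le Oy; move: uy; rewrite distrC => /ltr_normlW; lra.
  move: du; rewrite le_eqVlt => /orP[/eqP du|du].
    left; split=> //=; rewrite v0 /= leNgt; apply/negP => Lv.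
    have [|w /andP[dw w1] Fw] := @L_adh ((L + v) / 2); first lra.
    have [|[y z] /= [[_ Oy] uy vz]] := cl1 (Num.min (w - delta) ((v - L) / 2)).
      by rewrite lt_min; lra.
    move: uy vz; rewrite !lt_min => /andP[uy _] /andP[_ vz].
    have yw : y < w by move: uy; rewrite distrC => /ltr_normlW; lra.
    by have := F0_ge yw Oy; move: vz => /ltr_normlW; lra.
  right; split=> //=; first by rewrite du u1.
  rewrite /F leNgt du /=; apply/eqP; rewrite eq_le; apply/andP; split; last first.
    rewrite leNgt; apply/negP => /(F0_adh du)[u' [v' [u'u vv' O]]].
    have [|[y z] /= [[sqy nO] uy vz]] := cl2 (Num.min (u - u') (v' - v)).
      by rewrite lt_min !subr_gt0 u'u.
    have [/= /andP[y0 y1] /andP[z0 z1]] := sqy.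
    apply: nO; move: uy vz; rewrite !lt_min => /andP[uy _] /andP[_ vz].
    apply: (Om_mono O).
      by rewrite y1 andbT; move: uy => /ltr_normlW; lra.
    by rewrite z0 /=; move: vz; rewrite distrC => /ltr_normlW; lra.
  rewrite leNgt; apply/negP => Fv.
  have [a au Oa] := delta_adh du.
  have /andP[F00 _] : 0 <= F0 u <= u by apply: F0_bounds; rewrite du u1.
  have ua : 0 < u - a by rewrite subr_gt0.
  (* Small enough that the factor 1 + e / (u - a) from [F0_upper] cannot lift [F0 u] to v - e. *)
  pose e := Num.min ((v - F0 u) / 2) ((v - F0 u) / 4 * (u - a)).
  have e0 : 0 < e by rewrite lt_min divr_gt0 ?mulr_gt0 ?subr_gt0 // divr_gt0 ?subr_gt0.
  have [[y z] /= [[_ Oy] uy vz]] := cl1 e e0.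
  have yu : y < u + e by move: uy; rewrite distrC => /ltr_normlW; lra.
  have := F0_upper du au Oa Oy e0 yu u1.
  have ze : v - e < z by move: vz => /ltr_normlW; lra.
  have e1 : e <= (v - F0 u) / 2 by rewrite ge_min lexx.
  have e2 : e <= (v - F0 u) / 4 * (u - a) by rewrite ge_min lexx orbT.
  have F01 : F0 u <= 1 by apply: le_trans (ltW Fv) v1.
  by nra.
- move=> [-> /andP[v0 vL]]; have v1 := le_trans vL L1.
  split; first split.
  + by split=> /=; rewrite ?d0 ?d1 ?v0 ?v1.
  + apply/closure_prodP => e e0 /=.
    pose x := Num.min 1 (delta + e / 2).
    have dx : delta < x <= 1 by rewrite ge_min lexx lt_min delta_lt1 /= andbT; lra.
    have [|x' [v' [x'x vv' O]]] := @F0_adh x (v - e) (andP dx).1.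
      by have := L_le dx; lra.
    have [/= /andP[u0 u1] /andP[v'0 v'1]] := Om_square O.
    have Ouv : Om (x, Num.min v v').
      apply: (Om_mono O); rewrite ?(ltW x'x) ?(andP dx).2 //.
      by rewrite le_min v0 v'0 ge_min lexx orbT.
    exists (x, Num.min v v') => /=; split; [split=> //; exact: Om_square| |].
      have ud : x <= delta + e / 2 by rewrite ge_min lexx orbT.
      by rewrite distrC ger0_norm; have := (andP dx).1; lra.
    have : Num.min v v' <= v by rewrite ge_min lexx.
    have : v - e < Num.min v v' by rewrite lt_min vv' andbT; lra.
    by move=> h1 h2; rewrite ger0_norm; lra.
  + apply/closure_prodP => e e0 /=.
    (* The square has no point left of delta = 0; there v = 0 too, and points (0, w) with w > 0 are
       excluded by the diagonal. *)
    have [dz|dn] := eqVneq delta 0.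
      have vz : v = 0 by have := L_le_delta; lra.
      pose w := Num.min 1 (e / 2).
      have w0 : 0 < w by rewrite lt_min ltr01 divr_gt0.
      have w1 : w <= 1 by rewrite ge_min lexx.
      have we : w <= e / 2 by rewrite ge_min lexx orbT.
      exists (0, w) => /=; rewrite dz vz subrr normr0 add0r normrN gtr0_norm //; split=> //; last lra.
      by split; [split=> /=; rewrite ?lexx ?ler01 ?(ltW w0)|move=> /Om_diag; lra].
    have dp : 0 < delta by rewrite lt_neqAle eq_sym dn.
    pose w := Num.max 0 (delta - e / 2).
    have wd : w < delta by rewrite gt_max dp /=; lra.
    have w0 : 0 <= w by rewrite le_max lexx.
    have we : delta - e / 2 <= w by rewrite le_max lexx orbT.
    exists (w, v) => /=; rewrite subrr normr0 ger0_norm; last lra.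
    split=> //; last lra; split; last by move=> /delta_le; lra.
    by split=> /=; rewrite ?w0 ?v0 ?v1 //=; lra.
- move=> [/andP[du u1]]; rewrite /F leNgt du /= => vE.
  have /andP[v0 vu] : 0 <= v <= u by rewrite vE; apply: F0_bounds; rewrite du u1.
  have v1 := le_trans vu u1; have u0 := le_trans v0 vu.
  split; first split.
  + by split=> /=; rewrite ?u0 ?u1 ?v0 ?v1.
  + apply/closure_prodP => e e0 /=.
    have [|u' [v' [u'u vv' O]]] := @F0_adh u (v - e) du; first by rewrite vE; lra.
    have [/= /andP[u'0 u'1] /andP[v'0 v'1]] := Om_square O.
    have v'v : v' <= v by rewrite vE; exact: F0_ge u'u O.
    exists (u, v') => /=; rewrite subrr normr0 ger0_norm ?subr_ge0 //; split=> //; last lra.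
    have Ouv : Om (u, v') by apply: (Om_mono O); rewrite ?(ltW u'u) ?u1 ?v'0 ?lexx.
    by split=> //; exact: Om_square.
  + apply/closure_prodP => e e0 /=.
    have up : 0 < u by apply: le_lt_trans du.
    pose w := Num.max 0 (u - e / 2).
    have wu : w < u by rewrite gt_max up /=; lra.
    have w0 : 0 <= w by rewrite le_max lexx.
    have we : u - e / 2 <= w by rewrite le_max lexx orbT.
    (* Moving left and up leaves the region: either z > v = [F0 u], or z is capped at 1 and lies
       above the diagonal. *)
    pose z := Num.min 1 (v + e / 2).
    have z1 : z <= 1 by rewrite ge_min lexx.
    have ze : z <= v + e / 2 by rewrite ge_min lexx orbT.
    have vz : v <= z by rewrite le_min v1 /=; lra.
    exists (w, z) => /=; split; last 2 first.
    * by rewrite ger0_norm; lra.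
    * by rewrite distrC ger0_norm; lra.
    split; first by split=> /=; rewrite ?w0 ?z1 ?andbT /=; lra.
    move=> O; have := F0_ge wu O; have := Om_diag O; rewrite -vE.
    by rewrite /z; case: (leP 1 (v + e / 2)); lra.
Qed.

End Nondegenerate.

Lemma boundary_shape : exists d F L,
  [/\ admissible d F, (if d < 1 then F x @[x --> d^'+] --> L else L = F 1) &
     rel_boundary (@unit_square R) Om =
       [set uv | uv.1 = d /\ 0 <= uv.2 <= L] `|`
       [set uv | d < uv.1 <= 1 /\ uv.2 = F uv.1]].
Proof.
have [/nondegenerate_boundary //|d1] := ltP delta 1.
by apply: degenerate_boundary; apply/eqP; rewrite eq_le d1 (andP delta01).2.
Qed.

End BoundaryShape.

(** * Shape of the boundary for an arbitrary space *)

Section DirectPart.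
Variables (R : realType) (M : mms R) (p : R).
Hypothesis p1 : 1 < p.
Hypothesis supp0 : mms_mu M (~` supp M) = 0%E.

Lemma Omega_HLP (u v : R) : Omega_HL M p (u, v) <->
  [/\ 0 <= u <= 1, 0 <= v <= 1 & lor_bounded M p u v].
Proof.
split=> [[[u01 v01] h]|[u01 v01 h]]; last by split=> //; exact/(hl_boundedP M p1).
by split=> //; exact/(hl_boundedP M p1).
Qed.

Lemma Omega_HL_boundary :
  rel_boundary (@unit_square R) (Omega_HL M p) = set0 \/
  exists (delta : R) (F : R -> R) (L : R),
    [/\ admissible delta F,
        (if delta < 1 then F x @[x --> delta^'+] --> L else L = F 1) &
        rel_boundary (@unit_square R) (Omega_HL M p) =
          [set uv | uv.1 = delta /\ 0 <= uv.2 <= L] `|`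
          [set uv | delta < uv.1 <= 1 /\ uv.2 = F uv.1]].
Proof.
have [[u [v [/Omega_HLP[u01 v01 h] uv]]]|diag] :=
    pselect (exists u v, Omega_HL M p (u, v) /\ u < v).
  left; rewrite /rel_boundary (_ : _ `\` _ = set0) ?closure0 ?setI0 //.
  apply/seteqP; split=> // -[u' v'] /= [[u01' v01'] []]; apply/Omega_HLP; split=> //.
  by apply: (lor_bounded_above_diagonal p1 supp0 u01 v01 uv h) => //; exact: (andP u01').1.
have [[x Ox]|empty] := pselect (exists x, Omega_HL M p x); last first.
  left; rewrite /rel_boundary (_ : _ `&` Omega_HL M p = set0).
    by rewrite closure0 setI0 set0I.
  by apply/seteqP; split=> // y [_ Oy]; apply: empty; exists y.
right; apply: boundary_shape; last by exists x.
- by move=> y [].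
- move=> u v u' v' /Omega_HLP[/andP[u0 u1] /andP[v0 v1] h] /andP[uu' u1'] /andP[v0' vv'].
  apply/Omega_HLP; rewrite u1' v0' (le_trans u0) // (le_trans vv') //; split=> //.
  exact: lor_bounded_mono h.
- by move=> u v O; rewrite leNgt; apply/negP => uv; apply: diag; exists u, v.
- move=> u0 v0 u1 v1 t u /Omega_HLP[u01 v01 h0] /Omega_HLP[u11 v11 h1] t01 lt u_1.
  have /andP[t0 t1] := t01; have /andP[u00 _] := u01; have /andP[u10 _] := u11.
  have /andP[v00 v0le] := v01; have /andP[v10 v1le] := v11.
  apply/Omega_HLP; split.
  + by rewrite u_1 andbT (le_trans _ (ltW lt)) // addr_ge0 ?mulr_ge0 ?subr_ge0.
  + by apply/andP; split; nra.
  + exact: (lor_bounded_interp p1 u01 u11 v01 v11 t01 lt u_1 h0 h1).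
Qed.

End DirectPart.

(** * Random sampling on a finite cell *)

Section Chebyshev.
Variables (R : realType) (C T : finType).
Local Notation Omega := {ffun C -> T}.
Implicit Types (c e : C) (u v : T -> R).

(** Under the uniform law on functions each coordinate is uniform: write u (w c) as a product over
    all coordinates, with factor 1 off c, and exchange sum and product. *)
Lemma sum_ffun_coord c u :
  #|T|%:R * \sum_(w : Omega) u (w c) = #|Omega|%:R * \sum_t u t.
Proof.
pose F i t := if i == c then u t else 1.
have E (w : Omega) : u (w c) = \prod_i F i (w i).
  rewrite (bigD1 c) //= /F eqxx big1 ?mulr1 // => i /negbTE ic.
  by rewrite ic.
under eq_bigr do rewrite E.
rewrite -bigA_distr_bigA (bigD1 c) //= {1}/F eqxx mulrCA mulrC; congr (_ * _).
rewrite card_ffun natrX -[#|T|%:R ^+ _]mulr1.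
have -> : \prod_(i | i != c) \sum_t F i t = \prod_(i | i != c) #|T|%:R.
  apply: eq_bigr => i /negbTE ic; rewrite /F ic /= sumr_const -mulr_natl mulr1.
  by [].
by rewrite mulr1 -prodr_const [RHS](bigD1 c).
Qed.

(** Distinct coordinates are independent, so a centred factor kills the expectation. *)
Lemma sum_ffun_coord2 c e u v : c != e -> \sum_t u t = 0 ->
  \sum_(w : Omega) u (w c) * v (w e) = 0.
Proof.
move=> ce u0; pose F i t := if i == c then u t else if i == e then v t else 1.
have E (w : Omega) : u (w c) * v (w e) = \prod_i F i (w i).
  rewrite (bigD1 c) //= (bigD1 e) 1?eq_sym //= /F !eqxx eq_sym (negbTE ce).
  by rewrite big1 ?mulr1 // => i /andP[/negbTE ic /negbTE ie]; rewrite ic ie.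
under eq_bigr do rewrite E.
by rewrite -bigA_distr_bigA (bigD1 c) //= {1}/F eqxx u0 mul0r.
Qed.

(** L is the mean of the sum. The centred summands are uncorrelated, so the variance is at most the
    sum V of the second moments. *)
Lemma chebyshev_ffun (x : C -> T -> R) (L V eta : R) : (0 < #|T|)%N -> 0 < eta ->
  #|T|%:R * L = \sum_c \sum_t x c t ->
  \sum_c \sum_t x c t ^+ 2 <= #|T|%:R * V ->
  #|[set w : Omega | L + eta < \sum_c x c (w c)]%SET|%:R * eta ^+ 2 <= V * #|Omega|%:R.
Proof.
move=> T0 eta0 LE VE.
have n0 : 0 < #|T|%:R :> R by rewrite ltr0n.
pose m c := (\sum_t x c t) / #|T|%:R.
pose d c t := x c t - m c.
have d0 c : \sum_t d c t = 0.
  by rewrite sumrB sumr_const -mulr_natr /m divfK ?subrr // gt_eqF.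
have Lm : L = \sum_c m c.
  by rewrite -mulr_suml -LE mulrAC divff ?mul1r // gt_eqF.
have SD (w : Omega) : \sum_c x c (w c) - L = \sum_c d c (w c) by rewrite sumrB -Lm.
have EV : \sum_(w : Omega) (\sum_c d c (w c)) ^+ 2 <= V * #|Omega|%:R.
  have -> : \sum_(w : Omega) (\sum_c d c (w c)) ^+ 2 =
      \sum_c \sum_(w : Omega) d c (w c) ^+ 2.
    under eq_bigr do rewrite expr2 big_distrlr /=.
    rewrite exchange_big /=; apply: eq_bigr => c _.
    rewrite exchange_big /= (bigD1 c) //= [X in _ + X]big1 ?addr0; last first.
      by move=> e ec; apply: sum_ffun_coord2 => //; rewrite eq_sym.
    by apply: eq_bigr => w _; rewrite expr2.
  rewrite -(ler_pM2l n0) mulr_sumr.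
  under eq_bigr do rewrite (sum_ffun_coord _ (fun t => d _ t ^+ 2)).
  rewrite -mulr_sumr [leRHS]mulrA [leRHS]mulrC ler_wpM2l //.
  apply: le_trans VE; apply: ler_sum => c _.
  have : \sum_t d c t ^+ 2 = \sum_t x c t ^+ 2 - m c * \sum_t x c t.
    transitivity (\sum_t (x c t ^+ 2 - m c * x c t - m c * d c t)).
      by apply: eq_bigr => t _; rewrite /d; ring.
    by rewrite !sumrB -!mulr_sumr d0 mulr0 subr0.
  move=> ->; rewrite gerBl /m mulrAC -expr2 divr_ge0 ?sqr_ge0 //.
apply: le_trans EV; rewrite mulrC -sum1_card natr_sum mulr_sumr.
rewrite [leRHS](bigID (mem [set w : Omega | L + eta < \sum_c x c (w c)]%SET)) /=.
apply: ler_wpDr; first by apply: sumr_ge0 => w _; exact: sqr_ge0.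
apply: ler_sum => w; rewrite inE mulr1 -SD => lw.
have h : eta <= \sum_c x c (w c) - L by rewrite lerBrDl ltW.
by rewrite lerXn2r ?nnegrE ?(ltW eta0) // (le_trans (ltW eta0)).
Qed.

End Chebyshev.

(** * Kolmogorov's inequality and the functional behind the sample mean *)

Section LayerSums.
Variables (R : realType) (p : R).
Hypothesis p1 : 1 < p.
Variables (I : finType) (wt f : I -> R).
Hypothesis wt0 : forall i, 0 <= wt i.
Hypothesis f0 : forall i, 0 <= f i.

(** J lists the dyadic layers met by f and precedes P, so one list serves all source levels
    later. *)
Lemma layer_sum_le : exists2 J : seq int, uniq J & forall P : pred I,
  \sum_(i | P i) wt i * f i <=
  \sum_(k <- J) 2 ^ (k + 1) * \sum_(i | P i && (2 ^ k < f i)) wt i.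
Proof.
have [k kE] : exists k : I -> int, forall i, f i != 0 -> 2 ^ (k i) < f i <= 2 ^ (k i + 1).
  have H i : exists k : int, f i != 0 -> 2 ^ k < f i <= 2 ^ (k + 1).
    have [_|fi] := eqVneq (f i) 0; first by exists 0.
    have fp : 0 < f i by rewrite lt_neqAle eq_sym fi f0.
    by have [k ki] := ltS_expz fp; exists k.
  by have [k kE] := choice H; exists k.
exists (undup [seq k i | i <- enum I]); first exact: undup_uniq.
move=> P.
under [leRHS]eq_bigr do rewrite mulr_sumr big_mkcondr /=.
rewrite exchange_big /=; apply: ler_sum => i Pi.
have [->|fi] := eqVneq (f i) 0.
  by rewrite mulr0 sumr_ge0 // => e _; case: ifP => _ //; rewrite mulr_ge0 ?exprz_ge0.
have kJ : k i \in undup [seq k i | i <- enum I].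
  by rewrite mem_undup map_f // mem_enum.
rewrite (big_rem _ kJ) /=; have /andP[k1 k2] := kE i fi.
rewrite k1 mulrC; apply: ler_wpDr; last by rewrite ler_wpM2r.
by apply: sumr_ge0 => e _; case: ifP => _ //; rewrite mulr_ge0 ?exprz_ge0.
Qed.

(** tau is the height at which the mass bound m and the weak-type bound coincide; measured against
    it they form a two-sided geometric profile. *)
Lemma two_sided_term (k : int) (tau B m : R) : 0 < B -> 0 < m -> tau = B / m `^ p^-1 ->
  2 ^ k * Num.min m ((B / 2 ^ k) `^ p) =
  B * m `^ (1 - p^-1) * Num.min (2 ^ k / tau) ((2 ^ k / tau) `^ (- (p - 1))).
Proof.
move=> B0 m0 ->; have p0 : 0 < p by apply: lt_trans p1.
have mp : 0 < m `^ p^-1 by rewrite powR_gt0.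
have k0 : 0 < (2 : R) ^ k by rewrite exprz_gt0.
have c0 : 0 <= B * m `^ (1 - p^-1) by rewrite mulr_ge0 ?powR_ge0 // ltW.
rewrite !minr_pMr ?(ltW k0) //; congr Num.min.
  have mE : m = m `^ (1 - p^-1) * m `^ p^-1.
    by rewrite -powRD ?subrK ?powRr1 ?(ltW m0) // oner_eq0.
  rewrite {1}mE invfM invrK; field; rewrite gt_eqF //.
set y := B / 2 ^ k; have y0 : 0 < y by rewrite divr_gt0.
have -> : 2 ^ k / (B / m `^ p^-1) = m `^ p^-1 * y^-1.
  by rewrite /y !invfM !invrK; ring.
have mE : (m `^ p^-1) `^ (p - 1) = m `^ (1 - p^-1).
  by rewrite -powRrM; congr powR; field; rewrite gt_eqF.
rewrite powRN powRM ?invr_ge0 ?(ltW mp) ?(ltW y0) // mE invfM.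
rewrite -(powR_inv1 (ltW y0)) powRAC powR_inv1 ?powR_ge0 // invrK.
rewrite -(mulr_powRB1 (ltW y0) p0) mulrA [2 ^ k * y]mulrCA divff ?gt_eqF // mulr1.
have mn : m `^ (1 - p^-1) != 0 by rewrite gt_eqF // powR_gt0.
by field.
Qed.

(** Kolmogorov's inequality: weak L^p embeds into L^1 on a set of mass m. *)
Lemma kolmogorov_sum_le (P : pred I) (B m : R) : 0 < B -> 0 < m -> \sum_(i | P i) wt i <= m ->
  (forall k : int, \sum_(i | P i && (2 ^ k < f i)) wt i <= (B / 2 ^ k) `^ p) ->
  \sum_(i | P i) wt i * f i <= 2 * two_sided_const (p - 1) * B * m `^ (1 - p^-1).
Proof.
move=> B0 m0 Pm PB; have [J uJ /(_ P)/le_trans] := layer_sum_le; apply.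
pose tau := B / m `^ p^-1.
have tau0 : 0 < tau by rewrite divr_gt0 // powR_gt0.
apply: (@le_trans _ _ (\sum_(k <- J) 2 * (B * m `^ (1 - p^-1) *
    Num.min (2 ^ k / tau) ((2 ^ k / tau) `^ (- (p - 1)))))).
  apply: ler_sum => k _; rewrite -(two_sided_term k B0 m0 erefl) mulrA.
  rewrite expfzDr // expr1z [2 ^ k * 2]mulrC ler_wpM2l ?mulr_ge0 ?exprz_ge0 //.
  rewrite le_min PB andbT; apply: le_trans Pm.
  by rewrite [leRHS](bigID (fun i => 2 ^ k < f i)) /= ler_wpDr // sumr_ge0.
rewrite -mulr_sumr -mulr_sumr.
have pm : 0 < p - 1 by rewrite subr_gt0.
rewrite (_ : 2 * two_sided_const (p - 1) * B * m `^ (1 - p^-1) =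
  2 * (B * m `^ (1 - p^-1) * two_sided_const (p - 1))); last by ring.
do 2 (rewrite ler_wpM2l ?mulr_ge0 ?powR_ge0 ?(ltW B0) //).
exact: sum_two_sided_le.
Qed.

End LayerSums.

Section LacunaryFunctional.
Variables (R : realType) (p : R).
Hypothesis p1 : 1 < p.
Let Cp := two_sided_const (p - 1).
Let p0 : 0 < p. Proof. exact: lt_trans p1. Qed.

Lemma two_sided_const_gt0 (a : R) : 0 < a -> 0 < two_sided_const a.
Proof.
move=> a0; have r1 : 1 < (2 : R) `^ a.
  have : (1 : R) `^ a < 2 `^ a by rewrite gt0_ltr_powR ?nnegrE ?ltr1n.
  by rewrite powR1.
by rewrite addr_gt0 // divr_gt0 ?powR_gt0 // subr_gt0.
Qed.

(** What layer k, with dyadic term c, can contribute on source level i of mass 2^(ip) when a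
    fraction 2^(-i(p-1)) is sampled. *)
Let term (k i : int) (c : R) : R :=
  2 ^ k * ((2 ^ i) `^ (- (p - 1)) * Num.min ((2 ^ i) `^ p) ((c / 2 ^ k) `^ p)).

Let termE k i c : 0 < c -> term k i c =
  c * Num.min (2 ^ k / (c / 2 ^ i)) ((2 ^ k / (c / 2 ^ i)) `^ (- (p - 1))).
Proof.
move=> c0; have i0 : 0 < (2 : R) ^ i by rewrite exprz_gt0.
have m0 : 0 < ((2 : R) ^ i) `^ p by rewrite powR_gt0.
have mi : (((2 : R) ^ i) `^ p) `^ p^-1 = 2 ^ i.
  by rewrite -powRrM divff ?powRr1 ?(ltW i0) // gt_eqF.
have m1 : (((2 : R) ^ i) `^ p) `^ (1 - p^-1) = (2 ^ i) `^ (p - 1).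
  by rewrite -powRrM; congr powR; field; rewrite gt_eqF.
rewrite /term mulrCA (two_sided_term p1 k c0 m0 erefl) mi m1.
set Z := Num.min _ _; rewrite powRN.
have xn : (2 ^ i) `^ (p - 1) != 0 :> R by rewrite gt_eqF // powR_gt0.
by field.
Qed.

(** Two ways of summing balance at lam = B (N+1)^(-u). Terms above lam are summed over i first and
    then by the sequence bound; terms below are replaced by lam and summed over k first. Each half
    gives Cp B (N+1)^(1-u). *)
Lemma lacunary_functional_le u a (B : R) (J : seq int) (N : nat) :
  0 <= u <= 1 -> 0 < B -> lq u a B -> uniq J ->
  \sum_(k <- J) \sum_(i < N.+1) term k i (a k) <= 2 * Cp * B * N.+1%:R `^ (1 - u).
Proof.
move=> /andP[u0 u1] B0 [aB sB] uJ.
have pm : 0 < p - 1 by rewrite subr_gt0.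
have Cp0 : 0 < Cp by exact: two_sided_const_gt0.
have N0 : 0 < N.+1%:R :> R by rewrite ltr0n.
have N1 : 1 <= N.+1%:R :> R by rewrite ler1n.
pose lam := B * N.+1%:R `^ (- u).
have lam0 : 0 < lam by rewrite mulr_gt0 // powR_gt0.
have ui : uniq [seq (i : nat)%:Z | i : 'I_N.+1].
  by rewrite map_inj_uniq ?enum_uniq // => i j [] /ord_inj.
have sumi (F : int -> R) : \sum_(i < N.+1) F i = \sum_(i <- [seq (i : nat)%:Z | i : 'I_N.+1]) F i.
  by rewrite big_map big_enum.
have t0 k i c : 0 <= c -> 0 <= term k i c.
  by move=> c0; rewrite !mulr_ge0 ?exprz_ge0 ?powR_ge0 // le_min !powR_ge0.
have tm k i c c' : 0 <= c -> c <= c' -> term k i c <= term k i c'.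
  move=> c0 cc'; rewrite !ler_wpM2l ?exprz_ge0 ?powR_ge0 //.
  rewrite le_min ge_min lexx /= ge_min; apply/orP; right.
  have cd : c / 2 ^ k <= c' / 2 ^ k by rewrite ler_wpM2r // invr_ge0 exprz_ge0.
  have cd0 : 0 <= c / 2 ^ k by rewrite divr_ge0 // exprz_ge0.
  by rewrite ge0_ler_powR ?(ltW p0) ?nnegrE // (le_trans cd0).
have E : B * N.+1%:R `^ (1 - u) = N.+1%:R * lam.
  rewrite /lam mulrCA; congr (_ * _); rewrite powRD; last by apply/implyP => _; rewrite gt_eqF.
  by rewrite powRr1 // ltW.
rewrite (bigID (fun k => lam < a k)) /=.
rewrite (_ : 2 * Cp * B * _ = Cp * (B * N.+1%:R `^ (1 - u)) + Cp * (B * N.+1%:R `^ (1 - u))); last by ring.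
apply: lerD.
  apply: (@le_trans _ _ (\sum_(k <- J | lam < a k) a k * Cp)).
    apply: ler_sum => k lk; have ak : 0 < a k by apply: lt_trans lk.
    rewrite (sumi (fun i => term k i (a k))).
    under eq_bigr do rewrite termE //.
    rewrite -mulr_sumr ler_wpM2l ?(ltW ak) //.
    have := sum_two_sided_le pm (divr_gt0 ak (exprz_gt0 k (ltr0Sn R 1))) ui.
    apply: le_trans; apply: ler_sum => i _.
    have -> : 2 ^ k / (a k / 2 ^ i) = 2 ^ i / (a k / 2 ^ k) :> R.
      by rewrite !invfM !invrK; ring.
    exact: lexx.
  rewrite -mulr_suml mulrC ler_wpM2l ?(ltW Cp0) //.
  move: u0; rewrite le_eqVlt => /orP[/eqP uz|up].
    rewrite big1 ?mulr_ge0 ?powR_ge0 ?(ltW B0) // => k.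
    rewrite /lam -uz oppr0 powRr0 mulr1 ltNge => /negP; case.
    by have /andP[] := aB k.
  have ui0 : 1 <= u^-1 by rewrite invf_ge1.
  apply: (@le_trans _ _ (\sum_(k <- J) a k `^ u^-1 * lam `^ (1 - u^-1))).
    rewrite [leRHS](bigID (fun k => lam < a k)) /= ler_wpDr //.
      by rewrite sumr_ge0 // => k _; rewrite mulr_ge0 ?powR_ge0.
    apply: ler_sum => k lk; have ak : 0 < a k by apply: lt_trans lk.
    rewrite -[leLHS](powRr1 (ltW ak)) -[X in _ `^ X](subrK (u^-1)) addrC.
    rewrite [leLHS]powRD; last by apply/implyP => _; rewrite gt_eqF.
    rewrite ler_wpM2l ?powR_ge0 //.
    have -> : 1 - u^-1 = - (u^-1 - 1) by ring.
    rewrite !powRN lef_pV2 ?posrE ?powR_gt0 //.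
    by rewrite ge0_ler_powR ?nnegrE ?subr_ge0 // ltW.
  rewrite -mulr_suml.
  apply: (@le_trans _ _ (B `^ u^-1 * lam `^ (1 - u^-1))).
    by rewrite ler_wpM2r ?powR_ge0 // sB.
  rewrite /lam powRM ?powR_ge0 ?(ltW B0) // mulrA -powRD; last first.
    by apply/implyP => _; rewrite gt_eqF.
  rewrite addrCA subrr addr0 powRr1 ?(ltW B0) // -powRrM ler_wpM2l ?(ltW B0) //.
  by rewrite (_ : - u * (1 - u^-1) = 1 - u) //; field; rewrite gt_eqF.
apply: (@le_trans _ _ (\sum_(k <- J) \sum_(i < N.+1) term k i lam)).
  rewrite [leRHS](bigID (fun k => lam < a k)) /= ler_wpDl //.
    by rewrite sumr_ge0 // => k _; rewrite sumr_ge0 // => i _; rewrite t0 // ltW.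
  apply: ler_sum => k; rewrite -leNgt => ak; apply: ler_sum => i _.
  by apply: tm => //; have /andP[] := aB k.
rewrite exchange_big /= E mulrCA.
rewrite mulr_natl -[X in _ *+ X](card_ord N.+1) -sumr_const; apply: ler_sum => i _.
under eq_bigr do rewrite termE //.
rewrite -mulr_sumr mulrC ler_wpM2r ?(ltW lam0) //.
by apply: sum_two_sided_le => //; rewrite divr_gt0 // exprz_gt0.
Qed.

End LacunaryFunctional.

(** * One component: sources, samples and targets *)

Section Component.
Variables (R : realType) (p : R).
Hypothesis p1 : 1 < p.
Variables (N K n b k0 : nat) (s c : nat -> nat).

(** Level, block, position. Blocks of one level are sampled independently, which lowers the
    variance. *)
Definition source := ('I_N.+1 * 'I_b.+1 * 'I_n.+1)%type.
Definition sample := {ffun 'I_N.+1 * 'I_b.+1 -> 'I_n.+1}.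
(** Besides its level and sample a target has a copy number; the number of copies tunes the mass of
    the level. *)
Definition target := {k : 'I_K.+1 & (sample * 'I_(c k).+1)%type}.
Definition cell := (source + target)%type.

(** Subtraction is cyclic: the positions caught in a block form a cyclic interval starting at the
    offset given by w, so each offset catches equally many positions and each position is caught by
    equally many offsets. *)
Definition sampled (y : source) (w : sample) : bool := ((y.2 - w y.1)%R < s y.1.1)%N.

Definition source_wt (y : source) : R := (2 ^ (y.1.1 : nat)%:Z) `^ p / (b.+1%:R * n.+1%:R).
Definition target_wt (z : target) : R := 2 ^ (k0 + tag z)%N%:Z.
Definition cell_wt (x : cell) : R :=
  match x with inl y => source_wt y | inr z => target_wt z end.

Lemma source_wt_gt0 y : 0 < source_wt y.
Proof. by rewrite divr_gt0 ?powR_gt0 ?exprz_gt0 // mulr_gt0. Qed.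

Lemma cell_wt_gt0 x : 0 < cell_wt x.
Proof. by case: x => [y|z]; [exact: source_wt_gt0|rewrite exprz_gt0]. Qed.

Local Notation pow2 i := ((2 : R) ^ (i : nat)%:Z).

(** Sampling the fraction 2^(-i(p-1)) reduces the mass 2^(ip) of level i to about 2^i. *)
Definition sampling_ok := forall i : 'I_N.+1, (s i <= n.+1)%N /\
  pow2 i `^ (- (p - 1)) <= (s i)%:R / n.+1%:R <= 2 * pow2 i `^ (- (p - 1)).
Hypothesis s_ok : sampling_ok.

Let Cp := two_sided_const (p - 1).
Let p0 : 0 < p. Proof. exact: lt_trans p1. Qed.
Let pm : 0 < p - 1. Proof. by rewrite subr_gt0. Qed.
Let Cp0 : 0 < Cp. Proof. exact: two_sided_const_gt0. Qed.

Let count_sub (m : nat) (F : R) : (m <= n.+1)%N ->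
  \sum_(t < n.+1 | (t < m)%N) F = m%:R * F.
Proof.
move=> mn; rewrite -(big_ord_widen_cond _ predT (fun=> F) mn) sumr_const card_ord.
by rewrite mulr_natl.
Qed.

Lemma count_sample (i : 'I_N.+1) (v : 'I_n.+1) (F : R) :
  \sum_(t : 'I_n.+1 | ((v - t)%R < s i)%N) F = (s i)%:R * F.
Proof.
have [si _] := s_ok i; rewrite -(count_sub F si).
rewrite (reindex_inj (h := fun t => v - t)); last by move=> x y /addrI /oppr_inj.
by apply: eq_bigl => t; rewrite subKr.
Qed.

Lemma count_source (i : 'I_N.+1) (t : 'I_n.+1) (F : R) :
  \sum_(v : 'I_n.+1 | ((v - t)%R < s i)%N) F = (s i)%:R * F.
Proof.
have [si _] := s_ok i; rewrite -(count_sub F si).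
rewrite (reindex_inj (h := fun v => v + t)); last exact: addIr.
by apply: eq_bigl => v; rewrite addrK.
Qed.

Let block_mass (i : 'I_N.+1) :
  (s i)%:R * (pow2 i `^ p / (b.+1%:R * n.+1%:R)) <= 2 * pow2 i / b.+1%:R.
Proof.
have [_ /andP[_ le]] := s_ok i; have i0 : 0 < pow2 i by rewrite exprz_gt0.
have -> : (s i)%:R * (pow2 i `^ p / (b.+1%:R * n.+1%:R)) =
   ((s i)%:R / n.+1%:R) * pow2 i `^ p / b.+1%:R.
  have := pnatr_eq0 R b.+1; have := pnatr_eq0 R n.+1.
  by move: (b.+1%:R) (n.+1%:R) => y z /= /negbT zn /negbT yn; field; rewrite yn.
rewrite ler_pM2r ?invr_gt0 //.
apply: (le_trans (ler_wpM2r (powR_ge0 _ _) le)).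
rewrite -mulrA -powRD; last by apply/implyP => _; rewrite gt_eqF.
by rewrite (_ : - (p - 1) + p = 1) ?powRr1 ?(ltW i0) //; ring.
Qed.

Let pow2_le (i : 'I_N.+1) : pow2 i <= 2 ^+ N.
Proof. by rewrite -exprnP ler_eXn2l ?ltr1n // -ltnS. Qed.

Let sum_pow2 : \sum_(i < N.+1) pow2 i <= 2 ^+ N.+1.
Proof.
elim: N => [|m IH]; first by rewrite big_ord1 expr1 expr0z ler1n.
rewrite big_ord_recr /= -exprnP.
by apply: (le_trans (lerD IH (lexx _))); rewrite [leRHS]exprS; lra.
Qed.

Lemma sampled_mass_le (w : sample) : \sum_(y | sampled y w) source_wt y <= 2 ^+ N.+2.
Proof.
have -> : \sum_(y | sampled y w) source_wt y =
    \sum_e \sum_(v : 'I_n.+1 | ((v - w e)%R < s e.1)%N) source_wt (e, v).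
  by rewrite pair_big_dep /=; apply: eq_big => [[e v]|[e v] _].
under eq_bigr do rewrite /source_wt /= count_source.
apply: (@le_trans _ _ (\sum_(e : 'I_N.+1 * 'I_b.+1) 2 * pow2 e.1 / b.+1%:R)).
  by apply: ler_sum => e _; exact: block_mass.
have -> : \sum_(e : 'I_N.+1 * 'I_b.+1) 2 * pow2 e.1 / b.+1%:R =
    \sum_(i < N.+1) \sum_(j < b.+1) 2 * pow2 i / b.+1%:R by rewrite pair_bigA.
have E (z : R) : \sum_(j < b.+1) z / b.+1%:R = z.
  by rewrite sumr_const card_ord -[_ *+ b.+1]mulr_natr divfK // pnatr_eq0.
under eq_bigr do rewrite E.
by rewrite -mulr_sumr exprS ler_pM2l.
Qed.

Lemma sum_source_level (i : 'I_N.+1) (F : source -> R) :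
  \sum_(y : source | y.1.1 == i) F y = \sum_(j < b.+1) \sum_v F ((i, j), v).
Proof.
apply/esym; rewrite (eq_bigl (fun y : source => (y.1.1 == i) && true)); last by move=> y; rewrite andbT.
rewrite pair_big /=.
rewrite (reindex (fun q : 'I_b.+1 * 'I_n.+1 => ((i, q.1), q.2) : source)) /=.
  by apply: eq_bigl => -[j v] /=; rewrite eqxx.
exists (fun y : source => (y.1.2, y.2)) => [[j v]//|[[i' j] v]].
by rewrite inE andbT => /eqP /= ->.
Qed.

Lemma source_level_mass (i : 'I_N.+1) :
  \sum_(y : source | y.1.1 == i) source_wt y = pow2 i `^ p.
Proof.
have E (m : nat) (z : R) : \sum_(j < m.+1) z = z * m.+1%:R.
  by rewrite sumr_const card_ord mulr_natr.
rewrite sum_source_level /source_wt /= (eq_bigr _ (fun j _ => E n _)) E.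
have := pnatr_eq0 R b.+1; have := pnatr_eq0 R n.+1.
by move: (b.+1%:R) (n.+1%:R) => y z /= /negbT zn /negbT yn; field; rewrite ?yn ?zn.
Qed.

Lemma source_mass_le : \sum_(y : source) source_wt y <= (2 ^+ N.+1) `^ p.
Proof.
rewrite (partition_big (fun y : source => y.1.1) predT) //=.
under eq_bigr do rewrite source_level_mass.
elim: N => [|m IH]; first by rewrite big_ord1 expr0z powR1 expr1 -[leLHS](@powRr0 _ 2) ler_powR ?ler1n // ltW.
rewrite big_ord_recr /= -exprnP; apply: (le_trans (lerD IH (lexx _))).
rewrite [in leRHS]exprS powRM ?exprn_ge0 // -mulr2n -[leLHS]mulr_natl ler_wpM2r ?powR_ge0 //.
by rewrite -[leLHS](@powRr1 _ 2) // ler_powR ?ler1n // ltW.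
Qed.

(** The function 2^(-i) integrates to at least 1 over the sampled part of each level, whatever the
    sample. *)
Lemma sample_sum_test (w : sample) :
  N.+1%:R <= \sum_(y | sampled y w) source_wt y / pow2 y.1.1.
Proof.
have -> : \sum_(y | sampled y w) source_wt y / pow2 y.1.1 =
    \sum_e \sum_(v : 'I_n.+1 | ((v - w e)%R < s e.1)%N) source_wt (e, v) / pow2 e.1.
  by rewrite pair_big_dep /=; apply: eq_big => [[e v]|[e v] _].
under eq_bigr do rewrite /source_wt /= count_source.
apply: (@le_trans _ _ (\sum_(e : 'I_N.+1 * 'I_b.+1) b.+1%:R^-1)).
  by rewrite sumr_const card_prod !card_ord -[leRHS]mulr_natl natrM mulfK // pnatr_eq0.
apply: ler_sum => e _; have [_ /andP[le _]] := s_ok e.1.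
have i0 : 0 < pow2 e.1 by rewrite exprz_gt0.
have -> : (s e.1)%:R * (pow2 e.1 `^ p / (b.+1%:R * n.+1%:R) / pow2 e.1) =
   ((s e.1)%:R / n.+1%:R) * (pow2 e.1 `^ p / pow2 e.1) / b.+1%:R.
  have := pnatr_eq0 R b.+1; have := pnatr_eq0 R n.+1; have := gt_eqF i0.
  by move: (b.+1%:R) (n.+1%:R) (pow2 _) => y z t /= /negbT tn /negbT zn /negbT yn; field; rewrite yn zn tn.
rewrite -[leLHS]mul1r ler_pM2r ?invr_gt0 //.
have -> : pow2 e.1 `^ p / pow2 e.1 = (pow2 e.1 `^ (- (p - 1)))^-1.
  rewrite -powRN opprK powRB ?gt_eqF ?implybT // powRr1 ?(ltW i0) //.
by rewrite ler_pdivlMr ?mul1r // powR_gt0.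
Qed.

Section Upper.
Variables (u B : R) (a : int -> R) (f : cell -> R).
Hypothesis u01 : 0 <= u <= 1.
Hypothesis B0 : 0 < B.
Hypothesis aB : lq u a B.
Hypothesis f0 : forall x, 0 <= f x.
Hypothesis fa : forall k : int, \sum_(x | 2 ^ k < f x) cell_wt x <= (a k / 2 ^ k) `^ p.

Definition sample_sum (w : sample) : R :=
  \sum_(y | sampled y w) source_wt y * f (inl y).

Let g (y : source) := f (inl y).

Let ga (P : pred source) (k : int) :
  \sum_(y | P y && (2 ^ k < g y)) source_wt y <= (a k / 2 ^ k) `^ p.
Proof.
apply: le_trans (fa k); rewrite big_sumType /= ler_wpDr //.
  by rewrite sumr_ge0 // => z _; rewrite exprz_ge0.
rewrite [leRHS](bigID P) /= ler_wpDr //.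
  by rewrite sumr_ge0 // => y _; rewrite ltW // source_wt_gt0.
by rewrite le_eqVlt; apply/orP; left; apply/eqP; apply: eq_bigl => y; rewrite andbC.
Qed.

Let gB (P : pred source) (k : int) :
  \sum_(y | P y && (2 ^ k < g y)) source_wt y <= (B / 2 ^ k) `^ p.
Proof.
apply: (le_trans (ga P k)); have /andP[ak0 akB] := aB.1 k.
rewrite ge0_ler_powR ?(ltW p0) ?nnegrE ?divr_ge0 ?exprz_ge0 ?(ltW B0) //.
by rewrite ler_wpM2r // invr_ge0 exprz_ge0.
Qed.

(** One block as a function of its offset: the independent summands for Chebyshev's inequality. *)
Let x (e : 'I_N.+1 * 'I_b.+1) (t : 'I_n.+1) : R :=
  \sum_(v : 'I_n.+1 | ((v - t)%R < s e.1)%N) source_wt (e, v) * g (e, v).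

Lemma sample_sumE (w : sample) : sample_sum w = \sum_e x e (w e).
Proof.
rewrite /sample_sum /x pair_big_dep /=.
by apply: eq_big => [[e v]|[e v] _].
Qed.

Let wt0 y : 0 <= source_wt y. Proof. exact: ltW (source_wt_gt0 y). Qed.

Let x_ge0 e t : 0 <= x e t.
Proof. by apply: sumr_ge0 => v _; apply: mulr_ge0; [exact: wt0|exact: f0]. Qed.

(** Kolmogorov's inequality on the sampled part of one block, whose mass is small for large b; this
    makes the variance small. *)
Let x_le e t : x e t <= 2 * Cp * B * (2 ^+ N.+1 / b.+1%:R) `^ (1 - p^-1).
Proof.
pose P (y : source) := (y.1 == e) && ((y.2 - t)%R < s e.1)%N.
have m0 : 0 < 2 ^+ N.+1 / b.+1%:R :> R by rewrite divr_gt0 // exprn_gt0.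
have sumP (F : source -> R) : \sum_(y | P y) F y = \sum_(v : 'I_n.+1 | ((v - t)%R < s e.1)%N) F (e, v).
  rewrite (reindex (fun v : 'I_n.+1 => (e, v) : source)) /=.
    by apply: eq_bigl => v; rewrite /P /= eqxx.
  by exists snd => [v //|[e' v]]; rewrite inE => /andP[/eqP /= -> _].
have := @kolmogorov_sum_le R p p1 _ source_wt g wt0 (fun y => f0 _) P B _ B0 m0.
rewrite !sumP; apply; last exact: gB.
rewrite /source_wt /= count_source; apply: (le_trans (block_mass e.1)).
rewrite ler_pM2r ?invr_gt0 // exprS ler_pM2l //.
Qed.

(** Crude, exponential in N, but valid for bad samples too. *)
Lemma sample_sum_le (w : sample) : sample_sum w <= 2 * Cp * B * 2 ^+ N.+2.
Proof.
have m0 : 0 < 2 ^+ N.+2 :> R by rewrite exprn_gt0.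
have := @kolmogorov_sum_le R p p1 _ source_wt g wt0 (fun y => f0 _) (fun y => sampled y w) B _ B0 m0.
move=> H; apply: (le_trans (H _ (gB _))).
  exact: sampled_mass_le.
rewrite ler_wpM2l ?mulr_ge0 ?(ltW Cp0) ?(ltW B0) // ler1_powR //.
  by rewrite exprn_ege1 // ler1n.
by rewrite gerBl invr_ge0 ltW.
Qed.

Definition sample_mean : R := (\sum_e \sum_t x e t) / n.+1%:R.

Let xsum e : \sum_t x e t = (s e.1)%:R * \sum_v source_wt (e, v) * g (e, v).
Proof.
rewrite /x (exchange_big_dep predT) //= mulr_sumr; apply: eq_bigr => v _.
by rewrite count_sample.
Qed.

Lemma sample_mean_le : sample_mean <= 8 * Cp * B * N.+1%:R `^ (1 - u).
Proof.
have [J uJ lay] := layer_sum_le wt0 (fun y => f0 (inl y)).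
have pow0 (i : nat) : 0 <= pow2 i `^ (- (p - 1)) by exact: powR_ge0.
(* 4 is the 2 of the upper bound in [sampling_ok] times the 2 in the layer height 2^(k+1). *)
apply: (@le_trans _ _ (4 * (2 * Cp * B * N.+1%:R `^ (1 - u)))); last first.
  by rewrite le_eqVlt; apply/orP; left; apply/eqP; ring.
apply: le_trans (ler_wpM2l (ler0n R 4) (lacunary_functional_le p1 N u01 B0 aB uJ)).
rewrite exchange_big /= mulr_sumr.
rewrite /sample_mean; under eq_bigr do rewrite xsum.
have -> : \sum_(e : 'I_N.+1 * 'I_b.+1) (s e.1)%:R * \sum_v source_wt (e, v) * g (e, v) =
    \sum_(i < N.+1) \sum_(j < b.+1) (s i)%:R * \sum_v source_wt ((i, j), v) * g ((i, j), v).
  by rewrite pair_bigA; apply: eq_bigr => -[i j].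
rewrite mulr_suml.
apply: ler_sum => i _; rewrite -mulr_sumr mulrAC.
have [_ /andP[_ le]] := s_ok i.
pose P (y : source) := y.1.1 == i.
rewrite -(sum_source_level i (fun y => source_wt y * g y)).
have mass : \sum_(y | P y) source_wt y <= pow2 i `^ p by rewrite source_level_mass.
apply: (@le_trans _ _ (2 * pow2 i `^ (- (p - 1)) *
   \sum_(k <- J) 2 ^ (k + 1) * Num.min (pow2 i `^ p) ((a k / 2 ^ k) `^ p))).
  apply: ler_pM => //.
    by apply: sumr_ge0 => y _; apply: mulr_ge0; [exact: wt0|exact: f0].
  apply: (le_trans (lay P)); apply: ler_sum => k _; rewrite ler_wpM2l ?exprz_ge0 //.
  rewrite le_min ga andbT; apply: le_trans mass.
  by rewrite [leRHS](bigID (fun y => 2 ^ k < f (inl y))) /= ler_wpDr // sumr_ge0.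
rewrite !mulr_sumr le_eqVlt; apply/orP; left; apply/eqP; apply: eq_bigr => k _.
by rewrite expfzDr // expr1z; ring.
Qed.

Definition bad_samples : {set sample} := [set w | sample_mean + B < sample_sum w]%SET.

(** Second moments are at most the largest summand times the mean; the share of bad samples tends to
    0 as b grows. *)
Lemma card_bad_samples : #|bad_samples|%:R <=
  16 * Cp ^+ 2 * N.+1%:R * (2 ^+ N.+1 / b.+1%:R) `^ (1 - p^-1) * #|{: sample}|%:R.
Proof.
set V := 16 * _ * _ * _.
have n0 : (0 < #|'I_n.+1|)%N by rewrite card_ord.
have Mx : 0 <= 2 * Cp * B * (2 ^+ N.+1 / b.+1%:R) `^ (1 - p^-1).
  by rewrite !mulr_ge0 ?powR_ge0 ?(ltW Cp0) ?(ltW B0).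
have N1 : 1 <= N.+1%:R :> R by rewrite ler1n.
have := @chebyshev_ffun R _ _ x sample_mean (V * B ^+ 2) B n0 B0.
have -> : #|'I_n.+1|%:R * sample_mean = \sum_e \sum_t x e t.
  by rewrite card_ord /sample_mean mulrC divfK // pnatr_eq0.
move=> /(_ erefl) H.
have -> : bad_samples = [set w : {ffun 'I_N.+1 * 'I_b.+1 -> 'I_n.+1} | sample_mean + B < \sum_e x e (w e)]%SET.
  by apply/setP => w; rewrite !inE sample_sumE.
rewrite -(ler_pM2r (exprn_gt0 2 B0)) mulrAC; apply: H.
apply: (@le_trans _ _ (2 * Cp * B * (2 ^+ N.+1 / b.+1%:R) `^ (1 - p^-1) * \sum_e \sum_t x e t)).
  rewrite mulr_sumr; apply: ler_sum => e _; rewrite mulr_sumr; apply: ler_sum => t _.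
  by rewrite expr2 ler_wpM2r.
have -> : \sum_e \sum_t x e t = n.+1%:R * sample_mean.
  by rewrite /sample_mean mulrC divfK // pnatr_eq0.
rewrite card_ord mulrCA ler_pM2l //.
apply: (le_trans (ler_wpM2l Mx sample_mean_le)).
have Nu : N.+1%:R `^ (1 - u) <= N.+1%:R :> R.
  by rewrite ler1_powR // gerBl; have /andP[] := u01.
apply: (@le_trans _ _ (2 * Cp * B * (2 ^+ N.+1 / b.+1%:R) `^ (1 - p^-1) * (8 * Cp * B * N.+1%:R))).
  by rewrite !ler_wpM2l ?mulr_ge0 ?(ltW Cp0) ?(ltW B0).
by rewrite /V le_eqVlt; apply/orP; left; apply/eqP; ring.
Qed.

End Upper.
End Component.

(** * Maximal functions on weighted graphs *)

Definition discrete (T : Type) : Type := T.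

HB.instance Definition _ (T : pointedType) := Pointed.on (discrete T).

HB.instance Definition _ (T : pointedType) := @isMeasurable.Build default_measure_display
  (discrete T) discrete_measurable discrete_measurable0
  discrete_measurableC discrete_measurableU.

Section WeightMeasure.
Variables (R : realType) (T : pointedType) (w : T -> R).

(* The absolute value makes this a measure for every weight function. *)
Definition weight_measure (A : set (discrete T)) : \bar R :=
  \esum_(x in A) (`|w x|)%:E.

Let weight_measure0 : weight_measure set0 = 0%E.
Proof. exact: esum_set0. Qed.

Let weight_measure_ge0 A : (0 <= weight_measure A)%E.
Proof. exact: esum_ge0. Qed.

Let weight_measure_sigma_additive : semi_sigma_additive weight_measure.
Proof.
move=> F _ tF _; rewrite /weight_measure nneseries_sum_bigcup //.
by apply: is_cvg_nneseries => n _ _; exact: esum_ge0.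
Qed.

HB.instance Definition _ := isMeasure.Build _ _ _ weight_measure
  weight_measure0 weight_measure_ge0 weight_measure_sigma_additive.

End WeightMeasure.

Section GraphSpace.
Variables (R : realType) (T : pointedType) (w : T -> R) (adj : rel T) (nb : T -> seq T).
Hypothesis w0 : forall x, 0 < w x.
Hypothesis adj_sym : symmetric adj.
Hypothesis nb_uniq : forall x, uniq (nb x).
Hypothesis nbE : forall x y, (y \in nb x) = (y == x) || adj x y.
Hypothesis w_infinite : weight_measure w setT = +oo%E.

Definition graph_dist (x y : discrete T) : R :=
  if (x : T) == y then 0 else if adj x y then 1 else 2.

(** Distances between distinct points lie in [1, 2], so the triangle inequality is automatic. *)
Lemma graph_dist_metric : is_metric graph_dist.
Proof.
have ge1 x y : x != y -> 1 <= graph_dist x y <= 2.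
  by move=> /negbTE xy; rewrite /graph_dist xy; case: ifP => _; rewrite ?lexx ler1n.
have d0 x : graph_dist x x = 0 by rewrite /graph_dist eqxx.
have dge0 x y : 0 <= graph_dist x y.
  by rewrite /graph_dist; case: ifP => // _; case: ifP.
split=> //.
- move=> x y; split=> [|->]; last exact: d0.
  have [//|xy] := eqVneq x y; have /andP[+ _] := ge1 _ _ xy => h e.
  by move: h; rewrite e ler10.
- by move=> x y; rewrite /graph_dist eq_sym adj_sym.
- move=> x y z; have [->|xy] := eqVneq x y; first by rewrite d0 add0r.
  have [->|yz] := eqVneq y z; first by rewrite d0 addr0.
  have [->|xz] := eqVneq x z; first by rewrite d0 addr_ge0.
  have /andP[a1 _] := ge1 _ _ xy; have /andP[b1 _] := ge1 _ _ yz.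
  by have /andP[_ c2] := ge1 _ _ xz; apply: (le_trans c2); lra.
Qed.

Lemma graph_dist_borel (A : set (discrete T)) :
  measurable A <-> <<s rho_open graph_dist >> A.
Proof.
split=> // _; apply: sub_gen_smallest => x Ax; exists 1 => // y.
rewrite /oball /= /graph_dist; case: eqP => [<- //|_].
by case: ifP => _; rewrite ?ltxx // ltNge ler1n.
Qed.

Definition graph_mms : mms R :=
  @MMS R _ (discrete T) graph_dist (weight_measure w) graph_dist_metric graph_dist_borel.

Local Notation mu := (mms_mu graph_mms).

Let measurable_discrete (A : set (mms_T graph_mms)) : measurable A.
Proof. by []. Qed.

Let setT_seq_cons (a : T) (s : seq T) :
  [set x : discrete T | x \in a :: s] = [set a] `|` [set x : discrete T | x \in s].
Proof.
apply/seteqP; split => y /=; rewrite in_cons.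
  by move=> /orP[/eqP ->|ys]; [left|right].
by move=> [->|->]; rewrite ?eqxx ?orbT.
Qed.

Let disj_cons (a : T) (s : seq T) : a \notin s ->
  [set a] `&` [set x : discrete T | x \in s] = set0.
Proof.
move=> as_; rewrite -subset0 => y [/= ya ys].
by move: as_; rewrite -ya ys.
Qed.

Lemma graph_mu1 (x : T) : mu [set x : discrete T] = (w x)%:E.
Proof. by rewrite /= /weight_measure esum_set1 ?lee_fin ?normr_ge0 // gtr0_norm. Qed.

Lemma graph_mu_seq (s : seq T) : uniq s ->
  mu [set x : discrete T | x \in s] = (\sum_(x <- s) w x)%:E.
Proof.
elim: s => [|a s IH] /=.
  move=> _; rewrite big_nil (_ : [set _ | _] = set0) ?measure0 //.
  by apply/seteqP; split.
move=> /andP[as_ us]; rewrite setT_seq_cons.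
have /= -> := @measureU _ _ _ mu [set a] [set x : discrete T | x \in s]
  (measurable_discrete _) (measurable_discrete _) (disj_cons as_).
by have /= -> := IH us; have /= -> := graph_mu1 a; rewrite big_cons EFinD.
Qed.

Lemma graph_integral_seq (f : discrete T -> R) (s : seq T) : uniq s ->
  (\int[mu]_(y in [set x : discrete T | x \in s]) (`|f y|)%:E)%E =
  (\sum_(x <- s) w x * `|f x|)%:E.
Proof.
elim: s => [|a s IH] /=.
  move=> _; rewrite big_nil (_ : [set _ | _] = set0) ?integral_set0 //.
  by apply/seteqP; split.
move=> /andP[as_ us]; rewrite setT_seq_cons ge0_integral_setU //=; last first.
  by apply/disj_setPS; rewrite disj_cons.
rewrite IH // big_cons EFinD; congr (_ + _)%E.
rewrite (eq_integral (cst (`|f a|)%:E)); last by move=> y; rewrite inE => ->.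
by rewrite integral_cst // graph_mu1 mulrC EFinM.
Qed.

Let ball_small (x : T) (r : R) : 0 < r -> r <= 1 ->
  oball graph_dist x r = [set y : discrete T | y \in [:: x]].
Proof.
move=> r0 r1; apply/seteqP; split => y /=; rewrite inE /oball /= /graph_dist.
  case: eqP => [-> //|_]; case: ifP => _; first by rewrite ltNge r1.
  by rewrite ltNge (le_trans r1) // ler1n.
by move=> /eqP ->; rewrite eqxx.
Qed.

Let ball_nb (x : T) (r : R) : 1 < r -> r <= 2 ->
  oball graph_dist x r = [set y : discrete T | y \in nb x].
Proof.
move=> r1 r2; apply/seteqP; split => y /=; rewrite nbE /oball /= /graph_dist.
  by rewrite eq_sym; case: ifP => //= _; case: ifP => // _; rewrite ltNge r2.
rewrite eq_sym; case: ifP => /= [_ _|_ ->] //; exact: lt_trans r1.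
Qed.

Let ball_all (x : T) (r : R) : 2 < r -> oball graph_dist x r = setT.
Proof.
move=> r2; apply/seteqP; split => y //= _; rewrite /oball /= /graph_dist.
case: ifP => _; first exact: lt_trans r2.
by case: ifP => _ //; apply: lt_trans r2; rewrite ltr1n.
Qed.

(** There are three balls around x: the point, its neighbourhood, and the whole space, which has
    infinite measure and is omitted. *)
Lemma graph_maxfun_le (f : mms_T graph_mms -> R) (x : T) (t : R) :
  `|f x| <= t -> \sum_(y <- nb x) w y * `|f y| <= t * \sum_(y <- nb x) w y ->
  (maxfun f x <= t%:E)%E.
Proof.
move=> fx fnb; have t0 : 0 <= t by apply: le_trans fx.
apply: maxfun_leP => // r r0 /andP[_ moo].
have [r1|r1] := leP r 1.
  rewrite (ball_small x r0 r1) graph_integral_seq // graph_mu_seq //.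
  by rewrite !big_seq1 -EFinM lee_fin mulrC ler_wpM2r // ltW.
have [r2|r2] := leP r 2.
  by rewrite (ball_nb x r1 r2) graph_integral_seq // graph_mu_seq // -EFinM lee_fin.
by move: moo; rewrite (ball_all x r2) [X in (X < _)%E]w_infinite ltxx.
Qed.

Lemma graph_maxfun_ge (f : mms_T graph_mms -> R) (x : T) :
  (((\sum_(y <- nb x) w y * `|f y|) / \sum_(y <- nb x) w y)%:E <= maxfun f x)%E.
Proof.
have W0 : 0 < \sum_(y <- nb x) w y.
  have xn : x \in nb x by rewrite nbE eqxx.
  rewrite (big_rem _ xn) /= ltr_wpDr // sumr_ge0 // => y _; exact: ltW.
have m : mu (oball graph_dist x 2) = (\sum_(y <- nb x) w y)%:E.
  by rewrite (ball_nb x (ltr1n _ 2) (lexx 2)) graph_mu_seq.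
have H := @maxfun_ge_avg R graph_mms f x 2 (ltr0n _ 2).
have {}H := H _; apply: le_trans (H _); last by rewrite [X in (_ < X < _)%E]m lte_fin W0 ltry.
rewrite [X in fine X]m (ball_nb x (ltr1n _ 2) (lexx 2)) graph_integral_seq // -EFinM.
by rewrite lee_fin mulrC.
Qed.

End GraphSpace.

(** * The disjoint union of the cell graphs *)

Section CellGraph.
Variables (N K n b : nat) (s c : nat -> nat).
Local Notation cell := (cell N K n b c).

Definition sample_of (z : target N K n b c) : sample N n b := (tagged z).1.

Definition cell_adj (x y : cell) : bool :=
  match x, y with
  | inl y, inr z => sampled s y (sample_of z)
  | inr z, inl y => sampled s y (sample_of z)
  | _, _ => false
  end.

Lemma cell_adj_sym : symmetric cell_adj.
Proof. by move=> [x|x] [y|y]. Qed.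

Lemma sum_target_nb (V : nmodType) (F : cell -> V) z :
  \sum_(y | (y == inr z) || cell_adj (inr z) y) F y =
  F (inr z) + \sum_(y | sampled s y (sample_of z)) F (inl y).
Proof.
rewrite big_sumType /= addrC; congr (_ + _).
by under eq_bigl do rewrite orbF; rewrite big_pred1_eq.
Qed.

Lemma sum_source_nb (V : nmodType) (F : cell -> V) y :
  \sum_(x | (x == inl y) || cell_adj (inl y) x) F x =
  F (inl y) + \sum_(z | sampled s y (sample_of z)) F (inr z).
Proof.
rewrite big_sumType /=; congr (_ + _).
by under eq_bigl do rewrite orbF; rewrite big_pred1_eq.
Qed.

End CellGraph.

Record params := Params {
  pN : nat; pK : nat; pn : nat; pb : nat; pk0 : nat; ps : nat -> nat; pc : nat -> nat }.

Definition pcell (q : params) : Type := cell (pN q) (pK q) (pn q) (pb q) (pc q).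
HB.instance Definition _ (q : params) := Finite.on (pcell q).

Definition points (P : nat -> params) : Type := {j : nat & pcell (P j)}.
HB.instance Definition _ (P : nat -> params) := Choice.on (points P).
HB.instance Definition _ (P : nat -> params) :=
  isPointed.Build (points P) (existT _ 0%N (inl (ord0, ord0, ord0))).

Definition points_adj (P : nat -> params) (x y : points P) : bool :=
  (tag x == tag y) && cell_adj (ps (P (tag x))) (tagged x) (tagged_as x y).

Definition points_nb (P : nat -> params) (x : points P) : seq (points P) :=
  [seq Tagged (fun j => pcell (P j)) y
    | y <- enum [pred y | (y == tagged x) || cell_adj (ps (P (tag x))) (tagged x) y]].

Lemma points_adj_sym P : symmetric (@points_adj P).
Proof.
move=> [j x] [k y]; rewrite /points_adj /=; have [jk|//] := eqVneq j k.
by case: k / jk y => y; rewrite !tagged_asE cell_adj_sym.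
Qed.


Lemma Tagged_inj (I : eqType) (T_ : I -> eqType) (i : I) : injective (fun x : T_ i => Tagged T_ x).
Proof. by move=> x y /eqP; rewrite eq_Tagged /= => /eqP. Qed.

Section PointsGraph.
Variable P : nat -> params.
Local Notation point j := (@Tagged nat j (fun j => pcell (P j))).

Lemma Tagged_point_inj j : injective (point j).
Proof. exact: (@Tagged_inj _ (fun j => pcell (P j))). Qed.

Lemma points_nb_uniq (x : points P) : uniq (points_nb x).
Proof. by rewrite map_inj_uniq ?enum_uniq //; exact: Tagged_point_inj. Qed.

Lemma points_nbE (x y : points P) : (y \in points_nb x) = (y == x) || points_adj x y.
Proof.
case: x y => [j x] [k y]; rewrite /points_adj /=; have [jk|jk] := eqVneq j k.
  case: k / jk y => y /=; rewrite tagged_asE (mem_map (@Tagged_point_inj j)) mem_enum inE /=.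
  by rewrite (inj_eq (@Tagged_point_inj j)).
rewrite /= orbF; apply/mapP/eqP => [[z _]|]; move=> /(congr1 tag) /= kj; by rewrite kj eqxx in jk.
Qed.

Lemma sum_points_nb (V : nmodType) (F : points P -> V) (j : nat) (x : pcell (P j)) :
  \sum_(y <- points_nb (point j x)) F y =
  \sum_(y | (y == x) || cell_adj (ps (P j)) x y) F (point j y).
Proof. by rewrite /points_nb big_map big_enum. Qed.
End PointsGraph.

Section PointsSpace.
Variables (R : realType) (p : R) (P : nat -> params).
Local Notation point j := (@Tagged nat j (fun j => pcell (P j))).

Definition points_wt (x : points P) : R := cell_wt p (pk0 (P (tag x))) (tagged x).

Lemma points_wt_gt0 x : 0 < points_wt x.
Proof. exact: cell_wt_gt0. Qed.

Definition points_mms : mms R := graph_mms points_wt (@points_adj_sym P).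
Local Notation M := points_mms.

Lemma points_mu_out (j : nat) (A : pred (pcell (P j))) :
  mu_out [set x : mms_T M | exists2 y, A y & x = point j y] =
  (\sum_(y | A y) cell_wt p (pk0 (P j)) y)%:E.
Proof.
have -> : [set x : mms_T M | exists2 y, A y & x = point j y] =
    [set x : mms_T M | x \in [seq point j y | y <- enum A]].
  apply/seteqP; split => x /=.
    by move=> [y Ay ->]; rewrite map_f // mem_enum.
  by move=> /mapP[y]; rewrite mem_enum => Ay ->; exists y.
rewrite mu_out_measurable // graph_mu_seq ?big_map ?big_enum //.
  exact: points_wt_gt0.
by rewrite map_inj_uniq ?enum_uniq //; exact: Tagged_point_inj.
Qed.

(** Every component has a target atom of weight at least 1. *)
Lemma points_mu_infinite : weight_measure points_wt [set: discrete (points P)] = +oo%E.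
Proof.
pose z j : points P := point j (inr (existT _ ord0 (finfun (fun=> ord0), ord0))).
have zinj : injective z by move=> i j e; exact: (congr1 (fun x : points P => tag x) e).
have ge1 j : 1 <= points_wt (z j) by rewrite /points_wt /= /target_wt -exprnP exprn_ege1 // ler1n.
have ge m : (m%:R%:E <= weight_measure points_wt [set: discrete (points P)])%E.
  have us : uniq [seq z j | j <- iota 0 m] by rewrite map_inj_uniq ?iota_uniq.
  have H := graph_mu_seq points_wt_gt0 (@points_adj_sym P) us.
  apply: (@le_trans _ _ (mms_mu M [set` [seq z j | j <- iota 0 m]])).
    rewrite H lee_fin big_map -[m in m%:R](size_iota 0 m) -sum1_size natr_sum.
    by apply: ler_sum => j _.
  by apply: (@le_measure _ _ _ (mms_mu M)); rewrite ?inE.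
have := ge 0%N.
case: (weight_measure _ _) ge => [r| |] ge //; rewrite lee_fin => r0.
have := ge (Num.truncn r).+1; rewrite lee_fin leNgt.
by have /andP[_ ->] := Num.Theory.truncn_itv r0.
Qed.

End PointsSpace.

Section Estimates.
Variables (R : realType) (p : R) (P : nat -> params).
Hypothesis p1 : 1 < p.
Local Notation point j := (@Tagged nat j (fun j => pcell (P j))).
Local Notation M := (points_mms p P).

Let p0 : 0 < p. Proof. exact: lt_trans p1. Qed.

Let nbP := @graph_maxfun_le R (points P) (@points_wt R p P) (@points_adj P) (@points_nb P)
  (@points_wt_gt0 R p P) (@points_adj_sym P) (@points_nb_uniq P) (@points_nbE P)
  (points_mu_infinite p P).

Definition comp_fun (f : mms_T M -> R) (j : nat) : pcell (P j) -> R := fun y => `|f (point j y)|.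

(** The neighbourhood weighs at least as much as the target itself. *)
Lemma maxfun_target_le (f : mms_T M -> R) (j : nat) z :
  (maxfun f (point j (inr z)) <=
    (`|f (point j (inr z))| +
      sample_sum p (ps (P j)) (@comp_fun f j) (sample_of z) / target_wt R (pk0 (P j)) z)%:E)%E.
Proof.
have w0 : 0 < target_wt R (pk0 (P j)) z by rewrite exprz_gt0.
have S0 : 0 <= sample_sum p (ps (P j)) (@comp_fun f j) (sample_of z).
  by apply: sumr_ge0 => y _; rewrite mulr_ge0 ?normr_ge0 // ltW // source_wt_gt0.
have W0 : 0 <= \sum_(y | sampled (ps (P j)) y (sample_of z)) source_wt p y.
  by apply: sumr_ge0 => y _; rewrite ltW // source_wt_gt0.
apply: nbP; first by rewrite lerDl divr_ge0 // ltW.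
rewrite !sum_points_nb !sum_target_nb /points_wt /=.
rewrite -/(sample_sum p (ps (P j)) (@comp_fun f j) (sample_of z)).
set S := sample_sum _ _ _ _ in S0 *; set W := \sum_(_ | _) _ in W0 *.
set t := target_wt _ _ _ in w0 *; set F := `|_|.
have -> : (F + S / t) * (t + W) = t * F + S + (F + S / t) * W by field; rewrite gt_eqF.
by rewrite lerDl mulr_ge0 // addr_ge0 ?normr_ge0 // divr_ge0 // ltW.
Qed.

(** All neighbours of a source are targets, so its average mixes |f| at the source with values at
    most x. *)
Lemma maxfun_source_le (f : mms_T M -> R) (j : nat) (y : source (pN (P j)) (pn (P j)) (pb (P j))) (x : R) :
  0 <= x -> (forall z, `|f (point j (inr z))| <= x) ->
  (maxfun f (point j (inl y)) <= (`|f (point j (inl y))| + x)%:E)%E.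
Proof.
move=> x0 fx; apply: nbP; first by rewrite lerDl.
rewrite !sum_points_nb !sum_source_nb /points_wt /= mulrDr.
apply: lerD.
  by rewrite mulrC ler_pM2r ?source_wt_gt0 // lerDl.
rewrite mulr_sumr; apply: ler_sum => z _.
rewrite mulrC ler_pM2r ?exprz_gt0 //; apply: (le_trans (fx z)).
by rewrite lerDr normr_ge0.
Qed.

(** If the sampled mass is at most the target weight, the neighbourhood weighs at most twice the
    target. *)
Lemma maxfun_target_ge (f : mms_T M -> R) (j : nat) z :
  \sum_(y | sampled (ps (P j)) y (sample_of z)) source_wt p y <= target_wt R (pk0 (P j)) z ->
  ((sample_sum p (ps (P j)) (@comp_fun f j) (sample_of z) / 2 / target_wt R (pk0 (P j)) z)%:E
    <= maxfun f (point j (inr z)))%E.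
Proof.
move=> Wt; have w0 : 0 < target_wt R (pk0 (P j)) z by rewrite exprz_gt0.
have W0 : 0 <= \sum_(y | sampled (ps (P j)) y (sample_of z)) source_wt p y.
  by apply: sumr_ge0 => y _; rewrite ltW // source_wt_gt0.
have S0 : 0 <= sample_sum p (ps (P j)) (@comp_fun f j) (sample_of z).
  by apply: sumr_ge0 => y _; rewrite mulr_ge0 ?normr_ge0 // ltW // source_wt_gt0.
have := @graph_maxfun_ge R (points P) (@points_wt R p P) (@points_adj P) (@points_nb P)
  (@points_wt_gt0 R p P) (@points_adj_sym P) (@points_nb_uniq P) (@points_nbE P) f (point j (inr z)).
rewrite !sum_points_nb !sum_target_nb /points_wt /=.
rewrite -/(sample_sum p (ps (P j)) (@comp_fun f j) (sample_of z)).
apply: le_trans; rewrite lee_fin.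
set S := sample_sum _ _ _ _ in S0 *; set W := \sum_(_ | _) _ in W0 Wt *.
set t := target_wt _ _ _ in w0 Wt *; set F := `|_|.
have F0 : 0 <= F by exact: normr_ge0.
rewrite ler_pdivlMr ?ltr_wpDr //.
have -> : S / 2 / t * (t + W) = S * ((t + W) / (2 * t)) by field; rewrite gt_eqF.
rewrite -[leLHS]mul1r -[1]/(1); apply: (@le_trans _ _ S); last by rewrite lerDr mulr_ge0 // ltW.
by rewrite mul1r ler_piMr // ler_pdivrMr ?mulr_gt0 //; lra.
Qed.

Section Lor.
Variables (u B : R) (f : mms_T M -> R).
Hypothesis u01 : 0 <= u <= 1.
Hypothesis B0 : 0 < B.
Hypothesis fB : lor p u (EFin \o f) B.

Lemma comp_level (j : nat) (k : int) :
  \sum_(x | 2 ^ k < @comp_fun f j x) cell_wt p (pk0 (P j)) x <= (dyadic p (EFin \o f) k / 2 ^ k) `^ p.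
Proof.
have k0 : 0 < (2 : R) ^ k by rewrite exprz_gt0.
have [fin _] := fB.
have -> : dyadic p (EFin \o f) k / 2 ^ k = fine (distr (EFin \o f) (2 ^ k)) `^ p^-1.
  by rewrite /dyadic mulrAC divff ?mul1r // gt_eqF.
have D0 := distr_ge0 (EFin \o f) (2 ^ k).
rewrite -powRrM mulVf ?gt_eqF // powRr1; last exact: fine_ge0.
rewrite -lee_fin fineK; last by rewrite ge0_fin_numE.
rewrite -points_mu_out; apply: le_mu_out => x /= [y ky ->].
by rewrite lte_fin.
Qed.

(** Weak-type bound at an atom of mass at least 2^k0; a large k0 makes f negligible on the
    targets. *)
Lemma comp_target_le (j : nat) z :
  `|f (point j (inr z))| <= 2 * B * (2 ^+ pk0 (P j)) `^ (- p^-1).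
Proof.
rewrite leNgt; apply/negP => lt.
have Q0 : 0 < (2 ^+ pk0 (P j) : R) by rewrite exprn_gt0.
have [k /andP[k1 k2]] : exists k : int, 2 ^ k < `|f (point j (inr z))| <= 2 ^ (k + 1).
  by apply: ltS_expz; apply: le_lt_trans lt; rewrite !mulr_ge0 ?powR_ge0 // ltW.
have k0 : 0 < (2 : R) ^ k by rewrite exprz_gt0.
have : (2 ^+ pk0 (P j) : R) <= (B / 2 ^ k) `^ p.
  rewrite -lee_fin; apply: le_trans (distr_le p1 k fB).
  pose A (x : pcell (P j)) := x == inr z.
  apply: (@le_trans _ _ (mu_out [set x : mms_T M | exists2 y, A y & x = point j y])).
    rewrite points_mu_out lee_fin /A big_pred1_eq /= /target_wt -exprnP.
    by rewrite ler_eXn2l ?ltr1n // leq_addr.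
  by apply: le_mu_out => x /= [y /eqP -> ->]; rewrite lte_fin.
move=> H.
have {}H : (2 ^+ pk0 (P j)) `^ p^-1 <= B / 2 ^ k.
  by rewrite (powR_inv_le p1) ?(ltW Q0) // divr_ge0 // ltW.
move: lt; rewrite ltNge => /negP; apply; apply: (le_trans k2).
rewrite expfzDr // expr1z mulrC -mulrA ler_pM2l //.
rewrite powRN ler_pdivlMr ?powR_gt0 //.
by move: H; rewrite ler_pdivlMr // mulrC.
Qed.

End Lor.
End Estimates.

Lemma sum_target_level (R : realType) (N K n b k0 : nat) (c : nat -> nat)
    (k : 'I_K.+1) (S : {set sample N n b}) :
  \sum_(z : target N K n b c | (tag z == k) && (sample_of z \in S)) target_wt R k0 z =
  #|S|%:R * (c k).+1%:R * 2 ^ (k0 + k)%N%:Z.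
Proof.
rewrite /target_wt -(sig_big_dep (pred1 k)
   (fun (k : 'I_K.+1) (x : sample N n b * 'I_(c k).+1) => x.1 \in S)
   (fun k _ => 2 ^ (k0 + k)%N%:Z)) /= big_pred1_eq.
rewrite (eq_bigl (fun x : sample N n b * 'I_(c k).+1 => (x.1 \in S) && true)); last by move=> x; rewrite andbT.
rewrite -(pair_big_dep (mem S) (fun _ _ => true) (fun _ _ => 2 ^ (k0 + k)%N%:Z)) /=.
by rewrite !sumr_const card_ord -mulrnA -[LHS]mulr_natl natrM (mulrC _.+1%:R).
Qed.

(** * Pieces of a component and the sufficient condition *)

Section Piece.
Variables (R : realType) (p : R) (P : nat -> params).
Hypothesis p1 : 1 < p.
Local Notation point j := (@Tagged nat j (fun j => pcell (P j))).
Local Notation M := (points_mms p P).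

Definition piece (j : nat) (A : pred (pcell (P j))) : set (mms_T M) :=
  [set x | exists2 y, A y & x = point j y].

Definition target_piece j (S : {set sample (pN (P j)) (pn (P j)) (pb (P j))}) :=
  @piece j (fun y => if y is inr z then sample_of z \in S else false).

Definition source_piece j := @piece j (fun y => if y is inl _ then true else false).

Definition cutoff (D : set (mms_T M)) (H : mms_T M -> R) (x : mms_T M) : R :=
  if `[< D x >] then H x else 0.

(** The weight 2^(k0+k) of a target governs both the mass of its level and the height of H there: a
    profile with K + 1 levels. *)
Lemma target_piece_lor j (S : {set sample (pN (P j)) (pn (P j)) (pb (P j))})
    (H : mms_T M -> R) (h x v : R) :
  0 < h -> 0 < x -> 0 <= v <= 1 ->
  (forall k : 'I_(pK (P j)).+1, #|S|%:R * (pc (P j) k).+1%:R * 2 ^ (pk0 (P j) + k)%N%:Z <=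
     (h * 2 ^ (pk0 (P j) + k)%N%:Z) `^ p) ->
  (forall z, sample_of z \in S -> `|H (point j (inr z))| <= x / target_wt R (pk0 (P j)) z) ->
  lor p v (EFin \o cutoff (target_piece S) H)
    (4 * (h * x) * (pK (P j)).+1%:R `^ v).
Proof.
move=> h0 x0 v01 mass HS.
pose J : seq int := [seq (pk0 (P j) + k)%N%:Z | k : 'I_(pK (P j)).+1 <- enum 'I_(pK (P j)).+1].
pose V (e : int) : set (mms_T M) := piece (fun y : pcell (P j) =>
  if y is inr z then (e == (pk0 (P j) + tag z)%N%:Z) && (sample_of z \in S) else false).
apply: (@profile_upper _ M p p1 J V h x) => //.
- by rewrite ler1n.
- rewrite map_inj_uniq ?enum_uniq // => k l [] /eqP; rewrite eqn_add2l => /eqP kl.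
  exact: val_inj.
- by rewrite size_map size_enum_ord.
- move=> e /mapP[k _ ->]; rewrite points_mu_out lee_fin; apply: le_trans (mass k).
  rewrite -sum_target_level big_sumType /= big_pred0_eq add0r.
  rewrite le_eqVlt; apply/orP; left; apply/eqP; apply: eq_bigl => z.
  by rewrite eqz_nat eqn_add2l eq_sym.
move=> y k; rewrite /cutoff /=; case: asboolP => [[[//|z] zS ->]|_]; last first.
  by rewrite normr0 lte_fin ltNge exprz_ge0.
rewrite lte_fin => kH; exists (pk0 (P j) + tag z)%N%:Z; split.
- by apply/mapP; exists (tag z) => //; rewrite mem_enum.
- by exists (inr z) => //=; rewrite eqxx.
- by apply: (lt_le_trans kH); exact: HS.
Qed.

Lemma source_piece_lor (j : nat) (H : mms_T M -> R) (x v : R) :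
  0 < x -> 0 <= v <= 1 ->
  (forall y, `|H (point j (inl y))| <= x) ->
  lor p v (EFin \o cutoff (source_piece j) H)
    (4 * (2 ^+ (pN (P j)).+1 * x)).
Proof.
move=> x0 v01 Hx.
have -> : 4 * (2 ^+ (pN (P j)).+1 * x) = 4 * (2 ^+ (pN (P j)).+1 * x) * 1 `^ v :> R.
  by rewrite powR1 mulr1.
apply: (@profile_upper _ M p p1 [:: 0](fun=> source_piece j)) => //.
- move=> e; rewrite inE => /eqP ->; rewrite points_mu_out lee_fin expr0z mulr1.
  by rewrite big_sumType /= big_pred0_eq addr0; exact: source_mass_le.
move=> y k; rewrite /cutoff /=; case: asboolP => [[[z|//] _ ->]|_]; last first.
  by rewrite normr0 lte_fin ltNge exprz_ge0.
rewrite lte_fin => kH; exists 0; split; rewrite ?inE //.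
  by exists (inl z).
by rewrite expr0z divr1; apply: (lt_le_trans kH); exact: Hx.
Qed.

End Piece.

Arguments target_piece {R} p {P j} S.
Arguments source_piece {R} p P j.

(* The powers of 8 are the weights required by [lor_superpose] when component [j]
   contributes the three pieces with indices 3j+1, 3j+2 and 3j+3. *)
Record component_ok (R : realType) (p : R) (j : nat) (h : R) (q : params) : Prop := ComponentOk {
  ok_h : 0 < h;
  ok_sampling : sampling_ok p (pN q) (pn q) (ps q);
  ok_level : forall k : 'I_(pK q).+1,
    (h * 2 ^ (pk0 q + k)%N%:Z) `^ p <=
      #|{: sample (pN q) (pn q) (pb q)}|%:R * (pc q k).+1%:R * 2 ^ (pk0 q + k)%N%:Z <=
      (2 * h * 2 ^ (pk0 q + k)%N%:Z) `^ p;
  ok_mass : ((pN q).+2 <= pk0 q)%N;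
  ok_source : 8 * 2 ^+ (pN q).+1 * (2 ^+ pk0 q) `^ (- p^-1) <= 8^-1 ^+ (3 * j).+3;
  ok_bad : (16 * two_sided_const (p - 1) ^+ 2 * (pN q).+1%:R *
      (2 ^+ (pN q).+1 / (pb q).+1%:R) `^ (1 - p^-1)) `^ p^-1 *
    (2 * two_sided_const (p - 1) * 2 ^+ (pN q).+2) <= 1 }.

Lemma subnz_le (k : int) (n : nat) : k - n%:Z - 1 <= k - 1.
Proof. lia. Qed.

Section Space.
Variables (R : realType) (p : R) (P : nat -> params) (h : nat -> R).
Hypothesis p1 : 1 < p.
Hypothesis Pok : forall j, component_ok p j (h j) (P j).
Local Notation point j := (@Tagged nat j (fun j => pcell (P j))).
Local Notation M := (points_mms p P).
Local Notation Cp := (two_sided_const (p - 1)).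

Let p0 : 0 < p. Proof. exact: lt_trans p1. Qed.
Let Cp0 : 0 < Cp. Proof. by apply: two_sided_const_gt0; rewrite subr_gt0. Qed.

Section Upper.
Variables (u v C : R).
Hypothesis u01 : 0 <= u <= 1.
Hypothesis v01 : 0 <= v <= 1.
Hypothesis vu : v <= u.
Hypothesis C0 : 0 < C.
Hypothesis hC : forall j,
  h j * (pN (P j)).+1%:R `^ (1 - u) * (pK (P j)).+1%:R `^ v <= C * 8^-1 ^+ (3 * j).
Variables (f : mms_T M -> R) (B : R).
Hypothesis B0 : 0 < B.
Hypothesis fB : lor p u (EFin \o f) B.

Definition neighbour_part (x : points P) : R :=
  match x with
  | existT j (inl _) => 2 * B * (2 ^+ pk0 (P j)) `^ (- p^-1)
  | existT j (inr z) => sample_sum p (ps (P j)) (@comp_fun R p P f j) (sample_of z) / target_wt R (pk0 (P j)) z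
  end.

Let bad j := bad_samples p (ps (P j)) B (@comp_fun R p P f j).

Let fj0 j (x : pcell (P j)) : 0 <= @comp_fun R p P f j x. Proof. exact: normr_ge0. Qed.

Lemma maxfun_le_neighbour_part x : (maxfun f x <= (`|f x| + neighbour_part x)%:E)%E.
Proof.
case: x => j [y|z]; last exact: maxfun_target_le.
apply: maxfun_source_le; first by rewrite !mulr_ge0 ?powR_ge0 // ltW.
by move=> z; exact: (comp_target_le p1 B0 fB).
Qed.

(** Off the bad set the sample sum is at most its mean plus B, hence of order B (N+1)^(1-u). *)
Lemma good_piece_lor j :
  lor p v (EFin \o cutoff (target_piece p (~: bad j)%SET) neighbour_part)
    (8 * (8 * Cp + 1) * C * B * 8^-1 ^+ (3 * j)).
Proof.
have ok := Pok j; have h0 := ok_h ok.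
have N1 : 1 <= (pN (P j)).+1%:R `^ (1 - u).
  have /andP[_ u1] := u01.
  by rewrite -[leLHS](@powRr0 _ (pN (P j)).+1%:R) ler_powR ?ler1n // subr_ge0.
pose X := (8 * Cp + 1) * B * (pN (P j)).+1%:R `^ (1 - u).
have X0 : 0 < X by rewrite !mulr_gt0 ?addr_gt0 ?mulr_gt0 // (lt_le_trans _ N1).
apply: (@lor_weaken _ _ _ v _ (4 * (2 * h j * X) * (pK (P j)).+1%:R `^ v)); last first.
  have -> : 4 * (2 * h j * X) * (pK (P j)).+1%:R `^ v =
     8 * (8 * Cp + 1) * B * (h j * (pN (P j)).+1%:R `^ (1 - u) * (pK (P j)).+1%:R `^ v).
    by rewrite /X; ring.
  have -> : 8 * (8 * Cp + 1) * C * B * 8^-1 ^+ (3 * j) = 8 * (8 * Cp + 1) * B * (C * 8^-1 ^+ (3 * j)) by ring.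
  by rewrite ler_wpM2l // !mulr_ge0 ?addr_ge0 ?mulr_ge0 // ltW.
apply: target_piece_lor => //; first by rewrite mulr_gt0.
  move=> k; have /andP[_] := ok_level ok k; apply: le_trans.
  rewrite ler_pM2r ?exprz_gt0 // ler_pM2r ?ltr0n // ler_nat.
  exact: max_card.
move=> z; rewrite inE => zb /=.
have w0 : 0 < target_wt R (pk0 (P j)) z by rewrite exprz_gt0.
rewrite ger0_norm; last first.
  rewrite divr_ge0 ?(ltW w0) //; apply: sumr_ge0 => y _.
  by rewrite mulr_ge0 // ltW // source_wt_gt0.
rewrite ler_pM2r ?invr_gt0 //; move: zb; rewrite /bad inE -leNgt => /le_trans; apply.
have := sample_mean_le p1 (ok_sampling ok) u01 B0 fB.2 (@fj0 j) (comp_level p1 fB j) => H.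
apply: (le_trans (lerD H (lexx _))).
have -> : X = 8 * Cp * B * (pN (P j)).+1%:R `^ (1 - u) + B * (pN (P j)).+1%:R `^ (1 - u) by rewrite /X; ring.
by rewrite lerD2l ler_peMr // ltW.
Qed.

(** A share b of bad samples multiplies the mass parameter h of the profile by b^(1/p); by [ok_bad]
    this offsets the crude bound of [sample_sum_le]. *)
Lemma bad_piece_lor j :
  lor p v (EFin \o cutoff (target_piece p (bad j)) neighbour_part)
    (8 * C * B * 8^-1 ^+ (3 * j)).
Proof.
have ok := Pok j; have h0 := ok_h ok.
have N1 : 1 <= (pN (P j)).+1%:R `^ (1 - u).
  have /andP[_ u1] := u01.
  by rewrite -[leLHS](@powRr0 _ (pN (P j)).+1%:R) ler_powR ?ler1n // subr_ge0.
have [b bE] : {b : R | b = 16 * Cp ^+ 2 * (pN (P j)).+1%:R *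
    (2 ^+ (pN (P j)).+1 / (pb (P j)).+1%:R) `^ (1 - p^-1)} by eexists.
have b0 : 0 < b.
  by rewrite bE !mulr_gt0 ?exprn_gt0 // powR_gt0 // divr_gt0 ?exprn_gt0.
have bp0 : 0 < b `^ p^-1 by rewrite powR_gt0.
pose X := 2 * Cp * B * 2 ^+ (pN (P j)).+2.
have X0 : 0 < X by exact: (mulr_gt0 (mulr_gt0 (mulr_gt0 (ltr0Sn R 1) Cp0) B0) (exprn_gt0 _ (ltr0Sn R 1))).
have K0 : 0 <= (pK (P j)).+1%:R `^ v by exact: powR_ge0.
apply: (@lor_weaken _ _ _ v _ (4 * (2 * h j * b `^ p^-1 * X) * (pK (P j)).+1%:R `^ v)); last first.
  have -> : 4 * (2 * h j * b `^ p^-1 * X) * (pK (P j)).+1%:R `^ v =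
     8 * B * (h j * (b `^ p^-1 * (2 * Cp * 2 ^+ (pN (P j)).+2)) * (pK (P j)).+1%:R `^ v).
    by rewrite /X; ring.
  have -> : 8 * C * B * 8^-1 ^+ (3 * j) = 8 * B * (C * 8^-1 ^+ (3 * j)) by ring.
  rewrite ler_wpM2l ?mulr_ge0 ?(ltW B0) //; apply: le_trans (hC j).
  apply: (ler_wpM2r K0); apply: (ler_wpM2l (ltW h0)).
  by apply: le_trans N1; rewrite bE; exact: ok_bad ok.
apply: target_piece_lor => //; first by rewrite !mulr_gt0.
  move=> k; have /andP[_ le] := ok_level ok k.
  rewrite [X in X `^ p]mulrAC powRM ?mulr_ge0 ?exprz_ge0 ?(ltW h0) ?(ltW bp0) //.
  rewrite -powRrM mulVf ?gt_eqF // powRr1 ?(ltW b0) //.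
  apply: le_trans (ler_wpM2r (ltW b0) le).
  have := card_bad_samples p1 (ok_sampling ok) u01 B0 fB.2 (@fj0 j) (comp_level p1 fB j) => H.
  apply: (le_trans (ler_wpM2r _ (ler_wpM2r _ H))); rewrite ?exprz_ge0 //.
  by rewrite -bE le_eqVlt; apply/orP; left; apply/eqP; ring.
move=> z zb /=.
have w0 : 0 < target_wt R (pk0 (P j)) z by rewrite exprz_gt0.
rewrite ger0_norm; last first.
  rewrite divr_ge0 ?(ltW w0) //; apply: sumr_ge0 => y _.
  by rewrite mulr_ge0 // ltW // source_wt_gt0.
rewrite ler_pM2r ?invr_gt0 //.
exact: (sample_sum_le p1 (ok_sampling ok) B0 fB.2 (@fj0 j) (comp_level p1 fB j)).
Qed.

Lemma source_part_lor j :
  lor p v (EFin \o cutoff (source_piece p P j) neighbour_part) (8^-1 ^+ (3 * j).+3 * B).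
Proof.
have ok := Pok j.
have X0 : 0 < 2 * B * (2 ^+ pk0 (P j)) `^ (- p^-1) by rewrite !mulr_gt0 // powR_gt0 exprn_gt0.
apply: (@lor_weaken _ _ _ v _ (4 * (2 ^+ (pN (P j)).+1 * (2 * B * (2 ^+ pk0 (P j)) `^ (- p^-1))))); last first.
  have := ok_source ok; rewrite -(ler_pM2r B0); apply: le_trans.
  by rewrite le_eqVlt; apply/orP; left; apply/eqP; ring.
by apply: source_piece_lor => // y /=; rewrite ger0_norm // ltW.
Qed.

Let E := 1 + 8 ^+ 3 * (8 * Cp + 1) * C.

Let parts (n : nat) : mms_T M -> R :=
  if n is m.+1 then
    cutoff (match (m %% 3)%N with
         | 0 => target_piece p (~: bad (m %/ 3))%SET
         | 1 => target_piece p (bad (m %/ 3))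
         | _ => source_piece p P (m %/ 3) end) neighbour_part
  else f.

Let neighbour_part_cover x : exists m, parts m.+1 x = neighbour_part x.
Proof.
case: x => j [y|z].
  exists (3 * j + 2)%N; rewrite /parts mulnC modnMDl divnMDl //= addn0 /cutoff asboolT //.
  by exists (inl y).
case zb : (sample_of z \in bad j).
  exists (3 * j + 1)%N; rewrite /parts mulnC modnMDl divnMDl //= addn0 /cutoff asboolT //.
  by exists (inr z).
exists (3 * j)%N; rewrite /parts mulnC modnMl mulnK //= /cutoff asboolT //.
by exists (inr z) => //; rewrite inE zb.
Qed.

(** f itself is one of the pieces and must be bounded at the exponent 1/v; this is where v <= u
    enters. *)
Lemma maxfun_lor : lor p v (maxfun f) (16 * ((1 + 8 ^+ 3 * (8 * Cp + 1) * C) * B)).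
Proof.
have [v0 v1] : 0 <= v /\ v <= 1 by move/andP: v01.
have Cp1 : 1 <= 8 * Cp + 1 by rewrite lerDr mulr_ge0 // ltW.
have E0 : 0 < E by rewrite ltr_wpDr // !mulr_ge0 ?exprn_ge0 // ?(ltW C0) // (le_trans _ Cp1).
have E1 : 1 <= E by rewrite lerDl !mulr_ge0 ?exprn_ge0 // ?(ltW C0) // (le_trans _ Cp1).
apply: (@lor_superpose _ _ _ p1 v _ (fun n => EFin \o parts n)) => //.
  move=> x k; rewrite gee0_abs ?maxfun_ge0 // => kM.
  have := lt_le_trans kM (maxfun_le_neighbour_part x); rewrite lte_fin => kfn.
  have k0 : 0 < (2 : R) ^ (k - 1) by rewrite exprz_gt0.
  have k2 : (2 : R) ^ k = 2 ^ (k - 1) + 2 ^ (k - 1).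
    by rewrite -[in LHS](subrK 1 k) expfzDr // expr1z; ring.
  (* One of the two summands exceeds half the level; hence the extra 1 in the shift k - n - 1. *)
  have [fk|fk] := ltP (2 ^ (k - 1)) `|f x|.
    by exists 0%N; rewrite subr0 lte_fin.
  have nk : 2 ^ (k - 1) < neighbour_part x by rewrite -(ltrD2l `|f x|); lra.
  have [m mE] := neighbour_part_cover x; exists m.+1; rewrite /= -/(parts m.+1) lte_fin.
  rewrite mE (lt_le_trans _ (ler_norm _)) //; apply: le_lt_trans nk.
  by apply: ler_weXz2l; [exact: ler1n|exact: subnz_le].
move=> [|m].
  rewrite expr0 mul1r; apply: (@lor_embed _ _ p _ u) => //.
  by apply: lor_weaken fB _; rewrite ler_peMl // ltW.
have q0 i : 0 < (8^-1 : R) ^+ i by rewrite exprn_gt0 // invr_gt0.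
(* Turns the weight of component j into that of its i-th piece; the constant E absorbs 8^i. *)
have step i c : 0 <= c -> c * 8 ^+ i <= E -> forall n, c * B * 8^-1 ^+ n <= 8^-1 ^+ (n + i) * (E * B).
  move=> c0 cE n; rewrite exprD.
  have -> : 8^-1 ^+ n * 8^-1 ^+ i * (E * B) = (E / 8 ^+ i) * B * 8^-1 ^+ n by rewrite -exprVn; ring.
  by rewrite ler_pM2r // ler_pM2r // ler_pdivlMr // exprn_gt0.
rewrite /parts [in X in lor _ _ _ X](divn_eq m 3).
have : (m %% 3 < 3)%N by rewrite ltn_mod.
have c0 : 0 <= (8 * Cp + 1) * C by rewrite mulr_ge0 ?(ltW C0) // (le_trans _ Cp1).
have EE : E = 1 + 8 ^+ 3 * ((8 * Cp + 1) * C) by rewrite /E mulrA.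
have Cc : C <= (8 * Cp + 1) * C by rewrite ler_peMl // ltW.
move: (m %/ 3)%N => j; rewrite (mulnC j).
case: (m %% 3)%N => [|[|[|//]]] _ /=.
- apply: lor_weaken (good_piece_lor j) _.
  have := step 1%N (8 * (8 * Cp + 1) * C) _ _ (3 * j)%N; rewrite addn1 addn0; apply.
    by rewrite -mulrA mulr_ge0.
  by rewrite EE; lra.
- apply: lor_weaken (bad_piece_lor j) _.
  have := step 2%N (8 * C) _ _ (3 * j)%N; rewrite addn2 addn1; apply.
    by rewrite mulr_ge0 // ltW.
  by rewrite EE; lra.
apply: lor_weaken (source_part_lor j) _.
by rewrite addn2 ler_pM2l // ler_peMl // ltW.
Qed.

End Upper.
End Space.

(** * Necessary condition from extremal functions *)

Section Lower.
Variables (R : realType) (p : R) (P : nat -> params) (h : nat -> R).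
Hypothesis p1 : 1 < p.
Hypothesis Pok : forall j, component_ok p j (h j) (P j).
Local Notation point j := (@Tagged nat j (fun j => pcell (P j))).
Local Notation M := (points_mms p P).

(** The function of [sample_sum_test]: 2^(-i) on level i of mass 2^(ip), so that all levels have the
    same dyadic size. *)
Definition extremal (j : nat) (x : mms_T M) : R :=
  match (x : points P) with
  | existT i (inl y) => if i == j then (2 ^ (y.1.1 : nat)%:Z)^-1 else 0
  | _ => 0
  end.

Lemma extremal_lor (j : nat) (u : R) : 0 <= u <= 1 ->
  lor p u (EFin \o extremal j) (8 * (pN (P j)).+1%:R `^ u).
Proof.
move=> u01; have -> : 8 = 4 * (1 * 2) :> R by ring.
pose J : seq int := [seq (i : nat)%:Z | i : 'I_(pN (P j)).+1 <- enum 'I_(pN (P j)).+1].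
pose V (e : int) : set (mms_T M) := @piece _ p P j (fun y : pcell (P j) =>
  if y is inl y then e == (y.1.1 : nat)%:Z else false).
apply: (@profile_upper _ M p p1 J V) => //.
- by rewrite ler1n.
- rewrite map_inj_uniq ?enum_uniq // => k l [] kl.
  exact: val_inj.
- by rewrite size_map size_enum_ord.
- move=> e /mapP[k _ ->]; rewrite points_mu_out lee_fin mul1r.
  rewrite big_sumType /= big_pred0_eq addr0 -(source_level_mass p (pn (P j)) (pb (P j)) k).
  rewrite le_eqVlt; apply/orP; left; apply/eqP; apply: eq_bigl => y.
  by rewrite eqz_nat eq_sym.
have z0 (k : int) : ~~ ((2 : R) ^ k < `|0 : R|) by rewrite normr0 -leNgt exprz_ge0.
move=> [i [y|z]] k; rewrite /= lte_fin; last by move/negP: (z0 k).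
case: eqP => [ij|_]; last by move/negP: (z0 k).
case: j / ij @J @V => J V kf; exists (y.1.1 : nat)%:Z; split.
- by apply/mapP; exists y.1.1 => //; rewrite mem_enum.
- by exists (inl y) => /=.
apply: (lt_le_trans kf); rewrite ger0_norm ?invr_ge0 ?exprz_ge0 //.
by rewrite ler_peMl ?invr_ge0 ?exprz_ge0 // ler1n.
Qed.

Lemma maxfun_extremal (j : nat) z :
  (((pN (P j)).+1%:R / 2 / target_wt R (pk0 (P j)) z)%:E <= maxfun (extremal j) (point j (inr z)))%E.
Proof.
have ok := Pok j; have w0 : 0 < target_wt R (pk0 (P j)) z by rewrite exprz_gt0.
apply: le_trans (maxfun_target_ge _ _).
  rewrite lee_fin ler_pM2r ?invr_gt0 // ler_pM2r ?invr_gt0 //.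
  apply: (le_trans (sample_sum_test p1 (ok_sampling ok) (sample_of z))).
  apply: ler_sum => y _; rewrite /comp_fun /= eqxx ger0_norm // invr_ge0 exprz_ge0 //.
apply: (le_trans (sampled_mass_le (ok_sampling ok) _)).
rewrite /target_wt -exprnP ler_eXn2l ?ltr1n //.
exact: leq_trans (ok_mass ok) (leq_addr _ _).
Qed.

(** The norm of [extremal j] is at most of order (N+1)^u, that of its maximal function at least of
    order h (N+1) (K+1)^v. *)
Lemma lor_bounded_lower (u v : R) : 0 <= u <= 1 -> 0 <= v <= 1 -> lor_bounded M p u v ->
  exists C, forall j, h j * (pN (P j)).+1%:R `^ (1 - u) * (pK (P j)).+1%:R `^ v <= C.
Proof.
move=> u01 v01 [C C0 bd]; exists (32 * C) => j.
have ok := Pok j; have h0 := ok_h ok.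
set N1 : R := (pN (P j)).+1%:R.
have N0 : 0 < N1 by rewrite ltr0n.
have Nu : 0 < N1 `^ u by rewrite powR_gt0.
have fm : measurable_fun setT (extremal j) by [].
have B0 : 0 < 8 * N1 `^ u by rewrite mulr_gt0.
have := bd _ fm _ B0 (extremal_lor j u01) => Ml.
pose J : seq int := [seq (pk0 (P j) + k)%N%:Z | k : 'I_(pK (P j)).+1 <- enum 'I_(pK (P j)).+1].
have v0 : 0 <= v by case/andP: v01.
have := @profile_lower _ M p p1 J (h j) (N1 / 2) v _ _ h0 (divr_gt0 N0 (ltr0Sn R 1)) v0 _ _ _ Ml.
have -> : size J = (pK (P j)).+1 by rewrite size_map size_enum_ord.
move=> H; have {}H : h j * (N1 / 2) / 2 * (pK (P j)).+1%:R `^ v <= C * (8 * N1 `^ u).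
  apply: H => //.
    rewrite map_inj_uniq ?enum_uniq // => k l [] /eqP; rewrite eqn_add2l => /eqP kl.
    exact: val_inj.
  move=> e l /mapP[k _ ->] lN; have /andP[le _] := ok_level ok k.
  move: le; rewrite -cardsT -sum_target_level -lee_fin => /le_trans; apply.
  pose A (y : pcell (P j)) := if y is inr z then (tag z == k) && (sample_of z \in [set: _]%SET) else false.
  apply: (@le_trans _ _ (mu_out (@piece _ p P j A))).
    by rewrite points_mu_out lee_fin [leRHS]big_sumType /= big_pred0_eq add0r.
  apply: le_mu_out => x /= [[//|z] /andP[/eqP zk _] ->].
  rewrite gee0_abs ?maxfun_ge0 //; apply: lt_le_trans (maxfun_extremal z).
  by rewrite lte_fin /target_wt zk.
have -> : N1 `^ (1 - u) = N1 / N1 `^ u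
  by rewrite powRB ?(gt_eqF N0) ?implybT // powRr1 // ltW.
have -> : h j * (N1 / N1 `^ u) * (pK (P j)).+1%:R `^ v = h j * N1 * (pK (P j)).+1%:R `^ v / N1 `^ u by ring.
rewrite ler_pdivrMr //.
have -> : h j * N1 * (pK (P j)).+1%:R `^ v = 4 * (h j * (N1 / 2) / 2 * (pK (P j)).+1%:R `^ v) by field.
have -> : 32 * C * N1 `^ u = 4 * (C * (8 * N1 `^ u)) by ring.
by rewrite ler_pM2l.
Qed.
End Lower.

(** * Choice of the cells *)

Section Choice.
Variables (R : realType) (p : R).
Hypothesis p1 : 1 < p.

Let p0 : 0 < p. Proof. exact: lt_trans p1. Qed.

Lemma powR_le_inv (r x y : R) : 0 < r -> 0 <= x -> 0 <= y -> x `^ r <= y -> x <= y `^ r^-1.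
Proof.
move=> r0 x0 y0 H; have ri : 0 <= r^-1 by rewrite invr_ge0 ltW.
have := ge0_ler_powR ri (_ : x `^ r \is Num.nneg) (_ : y \is Num.nneg) H.
by rewrite -powRrM mulfV ?gt_eqF // powRr1 //; apply; rewrite nnegrE ?powR_ge0.
Qed.

Lemma le_inv_powR (r x y : R) : 0 < r -> 0 <= x -> 0 <= y -> x <= y `^ r^-1 -> x `^ r <= y.
Proof.
move=> r0 x0 y0 H.
have := ge0_ler_powR (ltW r0) (_ : x \is Num.nneg) (_ : y `^ r^-1 \is Num.nneg) H.
by rewrite -powRrM mulVf ?gt_eqF // powRr1 //; apply; rewrite nnegrE ?powR_ge0.
Qed.

Lemma lt_truncnS (x : R) : x < (Num.truncn x).+1%:R.
Proof.
have [x0|x0] := leP 0 x; first by have /andP[] := Num.Theory.truncn_itv x0.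
exact: lt_le_trans x0 (ler0n _ _).
Qed.

Lemma truncnS_le (x : R) : 1 <= x -> (Num.truncn x).+1%:R <= 2 * x.
Proof.
move=> x1; have x0 : 0 <= x by apply: le_trans x1.
have /andP[le _] := Num.Theory.truncn_itv x0.
by rewrite -natr1 mulr_natl mulr2n lerD.
Qed.

Lemma sampling_exists (N : nat) : exists n s, sampling_ok p N n s.
Proof.
pose n := Num.truncn ((2 ^+ N) `^ (p - 1) : R).
pose x (i : nat) : R := n.+1%:R * (2 ^ i%:Z) `^ (- (p - 1)).
exists n, (fun i => minn n.+1 (Num.truncn (x i)).+1) => i.
have n0 : 0 < n.+1%:R :> R by [].
have pm : 0 <= p - 1 by rewrite subr_ge0 ltW.
have i1 : 1 <= (2 : R) ^ (i : nat)%:Z by rewrite -exprnP exprn_ege1 // ler1n.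
have y0 : 0 < (2 ^ (i : nat)%:Z : R) `^ (- (p - 1)) by rewrite powR_gt0 // exprz_gt0.
have x1 : 1 <= x i.
  rewrite /x powRN ler_pdivlMr ?mul1r; last by rewrite powR_gt0 // exprz_gt0.
  apply: le_trans (ltW (lt_truncnS _)).
  rewrite ge0_ler_powR ?nnegrE ?exprz_ge0 ?exprn_ge0 // -exprnP ler_eXn2l ?ltr1n //.
  by rewrite -ltnS.
split; first exact: geq_minl.
rewrite ler_pdivlMr // ler_pdivrMr // natr_min le_min; apply/andP; split.
  apply/andP; split; last by rewrite mulrC ltW // lt_truncnS.
  rewrite ler_piMl ?ler0n // -[leRHS](@powRr0 _ (2 ^ (i : nat)%:Z)).
  by rewrite ler_powR // oppr_le0.
rewrite ge_min; apply/orP; right; apply: (le_trans (truncnS_le x1)).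
by rewrite /x mulrCA -mulrA mulrC mulrA.
Qed.

Lemma exp2_ge (x y : R) (m : nat) : exists k, [/\ (m <= k)%N, x <= 2 ^+ k & y <= 2 ^+ k].
Proof.
have ub (z : R) : z <= 2 ^+ (Num.truncn z).+1.
  apply: (le_trans (ltW (lt_truncnS z))).
  by rewrite -natrX ler_nat ltnW // ltn_expl.
have mono (z : R) i j : z <= 2 ^+ i -> (i <= j)%N -> z <= 2 ^+ j.
  by move=> zi ij; apply: (le_trans zi); rewrite ler_eXn2l ?ltr1n.
exists (m + (Num.truncn x).+1 + (Num.truncn y).+1)%N; split; first by rewrite -addnA leq_addr.
  by apply: mono (ub x) _; rewrite -addnA addnCA leq_addr.
by apply: mono (ub y) _; rewrite leq_addl.
Qed.

(** The order of choices matters: b determines the number W of samples, and only then can k0 be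
    taken so large that each desired number of copies is at least 1, which p > 1 makes possible. *)
Lemma component_exists (N K j : nat) (h : R) : 0 < h ->
  exists q, [/\ pN q = N, pK q = K & component_ok p j h q].
Proof.
move=> h0; have [n [s sok]] := sampling_exists N.
have pm : 0 < p - 1 by rewrite subr_gt0.
have Cp0 := two_sided_const_gt0 pm; set Cp := two_sided_const _ in Cp0.
have r0 : 0 < 1 - p^-1 by rewrite subr_gt0 invf_lt1.
have [b bP] : exists b : nat, (16 * Cp ^+ 2 * N.+1%:R *
      (2 ^+ N.+1 / b.+1%:R) `^ (1 - p^-1)) `^ p^-1 * (2 * Cp * 2 ^+ N.+2) <= 1.
  set A := 16 * Cp ^+ 2 * N.+1%:R; set D := 2 * Cp * 2 ^+ N.+2.
  have A0 : 0 < A by rewrite mulr_gt0 // mulr_gt0 // exprn_gt0.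
  have D0 : 0 < D by rewrite mulr_gt0 ?exprn_gt0 // mulr_gt0.
  (* The value of 2^(N+1)/(b+1) at which the required inequality is an equality. *)
  pose t := (D^-1 `^ p / A) `^ (1 - p^-1)^-1.
  have t0 : 0 < t by rewrite powR_gt0 // divr_gt0 // powR_gt0 ?invr_gt0.
  exists (Num.truncn (2 ^+ N.+1 / t)).
  have Di0 : 0 <= D^-1 by rewrite invr_ge0 ltW.
  have Am0 (m : R) : 0 <= A * m `^ (1 - p^-1) by exact: mulr_ge0 (ltW A0) (powR_ge0 _ _).
  rewrite -ler_pdivlMr // mul1r powR_inv_le // mulrC -ler_pdivlMr //; apply: le_inv_powR => //.
  - by rewrite divr_ge0 ?powR_ge0 // ltW.
  rewrite ler_pdivrMr // mulrC -ler_pdivrMr //; exact: ltW (lt_truncnS _).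
pose W : R := #|{: sample N n b}|%:R.
have W0 : 0 < W.
  by rewrite ltr0n; apply/card_gt0P; exists (finfun (fun=> ord0)).
have [k0 [Nk0 k1 k2]] := exp2_ge ((8 * 2 ^+ N.+1 / 8^-1 ^+ (3 * j).+3) `^ p)
  ((W / h `^ p) `^ (p - 1)^-1) N.+2.
have Q0 : 0 < (2 ^+ k0 : R) by rewrite exprn_gt0.
pose e k : R := 2 ^ (k0 + k)%N%:Z.
(* The number of copies, before rounding, that gives level k the mass (h * e k)^p. *)
pose r k : R := (h * e k) `^ p / (W * e k).
exists (Params N K n b k0 s (fun k => Num.truncn (r k))); split => //.
split => //=; last first.
  have t0 : 0 < (8^-1 : R) ^+ (3 * j).+3 by rewrite exprn_gt0 // invr_gt0.
  rewrite powRN ler_pdivrMr ?powR_gt0 // [leRHS]mulrC -ler_pdivrMr //.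
  have M0 : 0 < 8 * 2 ^+ N.+1 :> R by rewrite mulr_gt0 // exprn_gt0.
  exact: powR_le_inv p0 (ltW (divr_gt0 M0 t0)) (ltW Q0) k1.
move=> k; rewrite -/(e k) -/W.
have e0 : 0 < e k by rewrite exprz_gt0.
have We : 0 < W * e k by rewrite mulr_gt0.
have hp : 0 < h `^ p by rewrite powR_gt0.
have he0 : 0 < (h * e k) `^ p by rewrite powR_gt0 // mulr_gt0.
have r1 : 1 <= r k.
  rewrite /r ler_pdivlMr // mul1r powRM ?(ltW h0) ?(ltW e0) //.
  have -> : e k `^ p = e k `^ (p - 1) * e k.
    by rewrite mulrC mulr_powRB1 // ltW.
  rewrite mulrA ler_pM2r // mulrC -ler_pdivrMr //.
  apply: (@le_trans _ _ ((2 ^+ k0) `^ (p - 1))).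
    have := ge0_ler_powR (ltW pm) (_ : (W / h `^ p) `^ (p - 1)^-1 \is Num.nneg) (_ : 2 ^+ k0 \is Num.nneg) k2.
    rewrite -powRrM mulVf ?gt_eqF // powRr1 ?divr_ge0 ?(ltW W0) ?(ltW hp) //.
    by apply; rewrite nnegrE ?powR_ge0 // ltW.
  rewrite ge0_ler_powR ?nnegrE ?(ltW pm) ?(ltW Q0) ?(ltW e0) // /e -exprnP.
  by rewrite ler_eXn2l ?ltr1n // leq_addr.
have rE : (h * e k) `^ p = W * r k * e k by rewrite /r; field; rewrite !gt_eqF.
apply/andP; split.
  by rewrite rE ler_pM2r // ler_pM2l // ltW // lt_truncnS.
rewrite -(mulrA 2) (@powRM _ 2 (h * e k)) ?mulr_ge0 ?(ltW h0) ?(ltW e0) // rE.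
apply: (@le_trans _ _ (2 * (W * r k * e k))).
  have -> : 2 * (W * r k * e k) = W * (2 * r k) * e k by ring.
  by rewrite ler_pM2r // ler_pM2l // truncnS_le.
rewrite (ler_pM2r (mulr_gt0 (mulr_gt0 W0 (lt_le_trans ltr01 r1)) e0)).
by rewrite -[leLHS](@powRr1 _ 2) // ler_powR ?ler1n // ltW.
Qed.
End Choice.

Section SpaceExists.
Variables (R : realType) (p : R).
Hypothesis p1 : 1 < p.

Lemma space_exists (N K : nat -> nat) (h : nat -> R) : (forall j, 0 < h j) ->
  exists M : mms R, forall u v : R, 0 <= u <= 1 -> 0 <= v <= 1 ->
    (v <= u ->
       (exists2 C, 0 < C & forall j,
          h j * (N j).+1%:R `^ (1 - u) * (K j).+1%:R `^ v <= C * 8^-1 ^+ (3 * j)) ->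
       lor_bounded M p u v) /\
    (lor_bounded M p u v ->
       exists C, forall j, h j * (N j).+1%:R `^ (1 - u) * (K j).+1%:R `^ v <= C).
Proof.
move=> h0.
have [P PE] := choice (fun j => component_exists p1 (N j) (K j) j (h0 j)).
have Pok j : component_ok p j (h j) (P j) by case: (PE j).
exists (points_mms p P) => u v u01 v01; split.
  move=> vu [C C0 hC].
  have Cp0 : 0 < two_sided_const (p - 1) by apply: two_sided_const_gt0; rewrite subr_gt0.
  have hC' j : h j * (pN (P j)).+1%:R `^ (1 - u) * (pK (P j)).+1%:R `^ v <= C * 8^-1 ^+ (3 * j).
    by have [-> -> _] := PE j.
  exists (16 * (1 + 8 ^+ 3 * (8 * two_sided_const (p - 1) + 1) * C)).
    by rewrite mulr_gt0 // ltr_wpDr // !mulr_ge0 ?exprn_ge0 ?addr_ge0 ?mulr_ge0 // ltW.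
  move=> f _ B B0 fB; rewrite -mulrA.
  exact: (maxfun_lor p1 Pok u01 v01 vu C0 hC' B0 fB).
move=> /(lor_bounded_lower p1 Pok u01 v01) [C hC]; exists C => j.
by have [<- <- _] := PE j.
Qed.

(** N + 1, K + 1 and h are powers of 2 up to rounding, so the norm of a component is 2 to an affine
    function of (u, v). The loss 9 j comes from 8^(3j) = 2^(9j), three pieces per component. *)
Lemma log_space_exists (alpha lam kap : nat -> R) :
  (forall j, 0 <= lam j) -> (forall j, 0 <= kap j) ->
  exists M : mms R, forall u v : R, 0 <= u <= 1 -> 0 <= v <= 1 ->
    (v <= u ->
       (exists C, forall j, alpha j - lam j * u + kap j * v <= C - 9 * j%:R) ->
       lor_bounded M p u v) /\
    (lor_bounded M p u v -> exists C, forall j, alpha j - lam j * u + kap j * v <= C).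
Proof.
move=> lam0 kap0.
pose N j := Num.truncn (2 `^ lam j : R); pose K j := Num.truncn (2 `^ kap j : R).
pose h j : R := 2 `^ (alpha j - lam j).
have h0 j : 0 < h j by rewrite powR_gt0.
have p2 (x y : R) : 2 `^ x * 2 `^ y = 2 `^ (x + y) :> R by rewrite powRD // pnatr_eq0 implybT.
have lowT (x t : R) : 0 <= t -> 2 `^ (x * t) <= (Num.truncn (2 `^ x : R)).+1%:R `^ t :> R.
  by move=> t0; rewrite powRrM ge0_ler_powR ?nnegrE ?powR_ge0 // ltW // lt_truncnS.
have uppT (x t : R) : 0 <= x -> 0 <= t <= 1 ->
    (Num.truncn (2 `^ x : R)).+1%:R `^ t <= 2 * 2 `^ (x * t) :> R.
  move=> x0 /andP[t0 t1]; have x1 : 1 <= 2 `^ x :> R.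
    by rewrite -[leLHS](@powRr0 _ 2) ler_powR // ler1n.
  apply: (@le_trans _ _ ((2 * 2 `^ x) `^ t)).
    by rewrite ge0_ler_powR ?nnegrE ?mulr_ge0 ?powR_ge0 // truncnS_le.
  by rewrite powRM ?powR_ge0 // -powRrM ler_wpM2r ?powR_ge0 // ler1_powR // ler1n.
have [M HM] := space_exists N K h0; exists M => u v u01 v01.
have [bu bl] := HM u v u01 v01.
have [u0 u1] : 0 <= u /\ u <= 1 by move/andP: u01.
have [v0 v1] : 0 <= v /\ v <= 1 by move/andP: v01.
have u01' : 0 <= 1 - u <= 1 by rewrite subr_ge0 u1 gerBl.
have expE j : 2 `^ (alpha j - lam j) * 2 `^ (lam j * (1 - u)) * 2 `^ (kap j * v) =
    2 `^ (alpha j - lam j * u + kap j * v) :> R.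
  by rewrite !p2; congr (_ `^ _); ring.
split.
  move=> vu [C hC]; apply: bu => //; exists (4 * 2 `^ C); first by rewrite mulr_gt0 // powR_gt0.
  move=> j; apply: (@le_trans _ _ (h j * (2 * 2 `^ (lam j * (1 - u))) * (2 * 2 `^ (kap j * v)))).
    by rewrite ler_pM ?mulr_ge0 ?powR_ge0 ?(ltW (h0 j)) ?uppT // ler_pM2l // uppT.
  have -> : h j * (2 * 2 `^ (lam j * (1 - u))) * (2 * 2 `^ (kap j * v)) =
     4 * (2 `^ (alpha j - lam j) * 2 `^ (lam j * (1 - u)) * 2 `^ (kap j * v)) by rewrite /h; ring.
  rewrite expE -mulrA ler_pM2l //; apply: (@le_trans _ _ (2 `^ (C - 9 * j%:R))).
    by rewrite ler_powR ?ler1n.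
  rewrite -p2 ler_pM2l ?powR_gt0 // powRN exprVn -natrM powR_mulrn // !exprM.
  by rewrite (_ : 2 ^+ 9 = 8 ^+ 3) // -!natrX.
move=> /bl [C hC]; exists (ln C / ln 2) => j.
have C0 : 0 < 2 `^ (alpha j - lam j * u + kap j * v) :> R by rewrite powR_gt0.
have le : 2 `^ (alpha j - lam j * u + kap j * v) <= C.
  apply: le_trans (hC j); rewrite -expE ler_pM ?mulr_ge0 ?powR_ge0 ?lowT //.
  by rewrite ler_pM2l // lowT // subr_ge0.
rewrite ler_pdivlMr ?ln_gt0 ?ltr1n // -ln_powR ler_ln ?posrE //.
exact: lt_le_trans C0 le.
Qed.
End SpaceExists.

(** * A region under a concave graph cut out by countably many affine functions *)

Section ConcaveRegion.
Variables (R : realType) (delta : R) (F : R -> R).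
Hypothesis adm : admissible delta F.

Let F01 u : delta <= u <= 1 -> 0 <= F u <= 1. Proof. by case: adm => _ _ _ + _; apply. Qed.

(** The infimum of left difference quotients exists at u = 1 too. It dominates the right quotients
    by concavity and is nonnegative by monotonicity. *)
Lemma supporting_slope (u : R) : delta < u <= 1 ->
  exists2 s, 0 <= s & forall x, delta <= x <= 1 -> F x <= F u + s * (x - u).
Proof.
move=> /andP[du u1]; have [_ conc mono _ _] := adm.
have uD : `[delta, 1]%classic u by rewrite /= in_itv /= (ltW du).
pose S := [set (F u - F x) / (u - x) | x in [set x | delta <= x < u]].
have S0 y : S y -> 0 <= y.
  move=> [x /andP[dx xu] <-]; rewrite divr_ge0 ?subr_ge0 ?(ltW xu) //.
  by apply: mono; rewrite ?(ltW xu) //= in_itv /= dx (le_trans (ltW xu)).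
have Sn : S !=set0 by exists ((F u - F delta) / (u - delta)), delta => //=; rewrite lexx.
have Slb : has_lbound S by exists 0 => y; exact: S0.
exists (inf S).
  exact: lb_le_inf.
move=> x /andP[dx x1]; have [xu|ux|->] := ltgtP x u; last by rewrite subrr mulr0 addr0.
  have := @inf_lbound _ S Slb ((F u - F x) / (u - x)).
  rewrite ler_pdivlMr ?subr_gt0 //.
  have inS : S ((F u - F x) / (u - x)) by exists x => //=; rewrite dx.
  by move=> /(_ inS); lra.
rewrite -lerBlDl -ler_pdivrMr ?subr_gt0 //; apply: lb_le_inf => // _ [y /andP[dy yu] <-].
rewrite ler_pdivrMr ?subr_gt0 // mulrAC ler_pdivlMr ?subr_gt0 //.
have xy : 0 < x - y by rewrite subr_gt0 (lt_trans yu).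
have xD : `[delta, 1]%classic x by rewrite /= in_itv /= dx.
have yD : `[delta, 1]%classic y by rewrite /= in_itv /= dy (le_trans (ltW yu)).
have t01 : 0 <= (u - y) / (x - y) <= 1.
  apply/andP; split; last by rewrite ler_pdivrMr // mul1r lerD2r ltW.
  by rewrite divr_ge0 ?(ltW xy) // subr_ge0 ltW.
have := conc x y _ xD yD t01.
have -> : (u - y) / (x - y) * x + (1 - (u - y) / (x - y)) * y = u by field; rewrite gt_eqF.
have -> : (u - y) / (x - y) * F x + (1 - (u - y) / (x - y)) * F y =
   ((u - y) * F x + (x - u) * F y) / (x - y) by field; rewrite gt_eqF.
rewrite ler_pdivrMr //.
by lra.
Qed.

(** Rational coefficients make the family of majorants countable. Increasing the slope keeps a
    majorant because x >= 0. *)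
Lemma rational_line (u v : R) : delta < u <= 1 -> F u < v ->
  exists a s : rat, [/\ 0 <= s, forall x, delta <= x <= 1 -> F x <= ratr a + ratr s * x &
    ratr a + ratr s * u < v].
Proof.
move=> du Fv; have [s s0 sP] := supporting_slope du.
have [d01 _ _ _ _] := adm; have /andP[d0 _] := d01; have /andP[du' u1] := du.
have e0 : 0 < (v - F u) / 4 by rewrite divr_gt0 // subr_gt0.
have [t /andP[st te]] : exists t : rat, s < ratr t < s + (v - F u) / 4.
  by have [t] := @rat_in_itvoo R s (s + (v - F u) / 4) (ltr_pwDr e0 (lexx _)); rewrite in_itv; exists t.
have [a /andP[sa ae]] : exists a : rat, F u - s * u < ratr a < F u - s * u + (v - F u) / 4.
  by have [a] := @rat_in_itvoo R (F u - s * u) (F u - s * u + (v - F u) / 4) (ltr_pwDr e0 (lexx _));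
    rewrite in_itv; exists a.
exists a, t; split.
- by rewrite -(ler0q R) ltW // (le_lt_trans s0).
- move=> x /[dup] dx /sP; have /andP[dx' x1] := dx => Fx.
  have : s * x <= ratr t * x by rewrite ler_wpM2r ?(le_trans d0) // ltW.
  by lra.
have u0 : 0 <= u by rewrite (le_trans d0) // ltW.
have : ratr t * u <= (s + (v - F u) / 4) * u by rewrite ler_wpM2r // ltW.
have : (v - F u) / 4 * u <= (v - F u) / 4 by rewrite ler_piMr // ltW.
by lra.
Qed.

Lemma quadratic_unbounded (a : R) (b : R) : 0 < a ->
  exists m, forall j : nat, (m <= j)%N -> b < a * j%:R ^+ 2 - 9 * j%:R.
Proof.
move=> a0; exists (Num.truncn ((9 + `|b| + 1) / a)).+1 => j mj.
have jm : (9 + `|b| + 1) / a < j%:R.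
  by apply: lt_le_trans (lt_truncnS _) _; rewrite ler_nat.
have j1 : 1 <= j%:R :> R by rewrite ler1n; case: (j) mj.
have aj : 9 + `|b| + 1 < a * j%:R by rewrite mulrC -ltr_pdivrMr.
have : (9 + `|b| + 1) * j%:R <= a * j%:R * j%:R by rewrite ler_pM2r ?(lt_le_trans ltr01) // ltW.
have : `|b| * 1 <= `|b| * j%:R by rewrite ler_wpM2l.
have := ler_norm b; rewrite expr2; lra.
Qed.

(** The 2-adic valuation takes every value infinitely often. *)
Lemma infinitely_often (T : countType) :
  exists d : nat -> option T, forall x m, exists2 j, (m <= j)%N & d j = Some x.
Proof.
exists (fun j => unpickle (logn 2 j)) => x m.
exists (2 ^ pickle x * (2 * m).+1)%N.
  rewrite (leq_trans (_ : m <= (2 * m).+1)%N) ?leq_pmull ?expn_gt0 //.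
  by rewrite ltnW // ltnS leq_pmull.
by rewrite lognM ?expn_gt0 // pfactorK // lognE /= dvdn2 /= mul2n odd_double /= addn0 pickleK.
Qed.

(** Each constraint recurs with multipliers j^2: once violated it outgrows the loss 9 j, otherwise
    it stays nonpositive. Since F may jump at delta, that line is special: the coefficient j^3
    excludes u < delta, the j^2 term then imposes v <= F delta at u = delta, and for u > delta the
    cubic term wins. *)
Lemma region_separation : exists alpha lam kap : nat -> R,
  [/\ forall j, 0 <= lam j, forall j, 0 <= kap j &
   forall u v, 0 <= u <= 1 -> 0 <= v <= 1 ->
    (delta <= u -> v <= F u ->
       exists C, forall j, alpha j - lam j * u + kap j * v <= C - 9 * j%:R) /\
    ((exists C, forall j, alpha j - lam j * u + kap j * v <= C) -> delta <= u /\ v <= F u)].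
Proof.
have [d dP] := @infinitely_often (option (rat * rat)).
pose ok (l : rat * rat) := `[< 0 <= l.2 /\ forall x, delta <= x <= 1 -> F x <= ratr l.1 + ratr l.2 * x >].
pose par j : R * R * R := match d j with
  | Some (Some l) => if ok l then (- j%:R ^+ 2 * ratr l.1, j%:R ^+ 2 * ratr l.2, j%:R ^+ 2) else (0, 0, 0)
  | Some None => (j%:R ^+ 3 * delta - j%:R ^+ 2 * F delta, j%:R ^+ 3, j%:R ^+ 2)
  | None => (0, 0, 0) end.
exists (fun j => (par j).1.1 - 9 * j%:R), (fun j => (par j).1.2), (fun j => (par j).2).
have [/andP[d0 d1] _ _ _ _] := adm.
have /andP[Fd0 Fd1] : 0 <= F delta <= 1 by apply: F01; rewrite lexx.
split.
- move=> j; rewrite /par; case: (d j) => [[l|]|] //=.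
  by case: ifP => //= /asboolP[s0 _]; rewrite mulr_ge0 ?exprn_ge0 // ler0q.
- move=> j; rewrite /par; case: (d j) => [[l|]|] //=.
  by case: ifP => //= _; rewrite exprn_ge0.
move=> u v /andP[u0 u1] /andP[v0 v1]; split.
  (* For u > delta the quadratic term can win only while j < 1 / (u - delta); at u = delta the
     constant is 0, as the inverse of 0 is 0. *)
  move=> du vF; exists (((u - delta)^-1) ^+ 2) => j.
  have C0 : 0 <= ((u - delta)^-1) ^+ 2 by rewrite exprn_ge0 // invr_ge0 subr_ge0.
  have j0 : 0 <= (j%:R : R) by [].
  rewrite /par; case: (d j) => [[l|]|] /=; last by lra.
    case: ifP => [/asboolP[_ lP]|_] /=; last by lra.
    have uF : F u <= ratr l.1 + ratr l.2 * u by apply: lP; rewrite du.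
    have : j%:R ^+ 2 * v <= j%:R ^+ 2 * (ratr l.1 + ratr l.2 * u).
      by rewrite ler_wpM2l ?exprn_ge0 // (le_trans vF).
    by lra.
  have [uE|du'] := eqVneq u delta.
    have : j%:R ^+ 2 * v <= j%:R ^+ 2 * F delta by rewrite ler_wpM2l ?exprn_ge0 // -uE.
    by rewrite uE in C0 *; lra.
  have t0 : 0 < u - delta by rewrite subr_gt0 lt_neqAle eq_sym du'.
  suff : j%:R ^+ 2 * (v - F delta) - j%:R ^+ 3 * (u - delta) <= ((u - delta)^-1) ^+ 2 by lra.
  have -> : j%:R ^+ 3 * (u - delta) = j%:R ^+ 2 * (j%:R * (u - delta)) by ring.
  rewrite -mulrBr; have [jt|jt] := leP 1 (j%:R * (u - delta)).
    apply: le_trans C0; rewrite mulr_ge0_le0 ?exprn_ge0 //; lra.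
  have jt' : j%:R <= (u - delta)^-1 by rewrite -[leRHS]mul1r ler_pdivlMr // ltW.
  apply: (@le_trans _ _ (j%:R ^+ 2)).
    rewrite ler_piMr ?exprn_ge0 //.
    have : 0 <= j%:R * (u - delta) by rewrite mulr_ge0 // ltW.
    lra.
  by rewrite lerXn2r ?nnegrE // invr_ge0 ltW.
move=> [C HC].
have contra (x : option (rat * rat)) (a : R) (m0 : nat) : 0 < a ->
    (forall j : nat, (m0 <= j)%N -> d j = Some x ->
      a * j%:R ^+ 2 - 9 * j%:R <= (par j).1.1 - 9 * j%:R - (par j).1.2 * u + (par j).2 * v) -> False.
  move=> a0 H; have [m mP] := quadratic_unbounded C a0.
  have [j mj dj] := dP x (m + m0)%N.
  have := lt_le_trans (mP j (leq_trans (leq_addr _ _) mj))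
    (le_trans (H j (leq_trans (leq_addl _ _) mj) dj) (HC j)).
  by rewrite ltxx.
have du : delta <= u.
  rewrite leNgt; apply/negP => ud.
  have t0 : 0 < delta - u by rewrite subr_gt0.
  (* From here on j (delta - u) > 2, which beats v - F delta >= -1 and leaves at least j^2. *)
  apply: (contra None 1 (Num.truncn (2 / (delta - u))).+1) => // j mj dj.
  have jt : 2 < j%:R * (delta - u).
    by rewrite -ltr_pdivrMr //; apply: lt_le_trans (lt_truncnS _) _; rewrite ler_nat.
  rewrite /par dj /=.
  have : 0 <= j%:R ^+ 2 * (j%:R * (delta - u) + (v - F delta) - 1).
    by rewrite mulr_ge0 ?exprn_ge0 //; lra.
  have -> : j%:R ^+ 3 = j%:R ^+ 2 * j%:R :> R by rewrite -exprSr.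
  lra.
split=> //; rewrite leNgt; apply/negP => Fv.
have [uE|du'] := eqVneq u delta.
  apply: (contra None (v - F u) 0%N); first by rewrite subr_gt0.
  by move=> j _ dj; rewrite /par dj /= uE; lra.
have duu : delta < u <= 1 by rewrite lt_neqAle eq_sym du' du.
have [a [s [s0 sP sv]]] := rational_line duu Fv.
apply: (contra (Some (a, s)) (v - (ratr a + ratr s * u)) 0%N); first by rewrite subr_gt0.
move=> j _ dj; rewrite /par dj /= (_ : ok (a, s)) /=; last by apply/asboolP.
by rewrite le_eqVlt; apply/orP; left; apply/eqP; ring.
Qed.
End ConcaveRegion.

Unset Implicit Arguments.
Set Strict Implicit.

Theorem theorem4p4p1 (R : realType) (p : R) (hp : 1 < p) :
  (forall M : mms R,
     mms_mu M (~` supp M) = 0%E ->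
     rel_boundary (@unit_square R) (Omega_HL M p) = set0 \/
     exists (delta : R) (F : R -> R) (L : R),
       [/\ admissible delta F,
           (if delta < 1 then F x @[x --> delta^'+] --> L else L = F 1) &
           rel_boundary (@unit_square R) (Omega_HL M p) =
             [set uv | uv.1 = delta /\ 0 <= uv.2 <= L] `|`
             [set uv | delta < uv.1 <= 1 /\ uv.2 = F uv.1]]) /\
  (forall (delta : R) (F : R -> R), admissible delta F ->
     exists M : mms R, forall u v : R, 0 <= u <= 1 -> 0 <= v <= 1 ->
       (hl_bounded M p (exp_of_inv u) (exp_of_inv v) <-> delta <= u /\ v <= F u)).
Proof.
split=> [M supp0|delta F adm]; first exact: Omega_HL_boundary.
have [alpha [lam [kap [lam0 kap0 sep]]]] := region_separation adm.
have [M HM] := log_space_exists hp alpha lam0 kap0.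
exists M => u v u01 v01; rewrite (hl_boundedP M hp u01 v01).
have [sub sup] := sep u v u01 v01; have [bd unbd] := HM u v u01 v01.
split=> [/unbd /sup //|[du vF]]; apply: bd; last exact: sub.
(* F u <= u puts the region below the diagonal, as the sufficient condition requires. *)
have [_ _ _ _ Fu] := adm; apply: (le_trans vF); apply: Fu.
by rewrite du; case/andP: u01.
Qed.
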